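(* Let $\alpha_0$ be a real quadratic irrational number over $\mathbb{Q}$. Then $\operatorname{Sp}_{\alpha_0}$ is a closed bounded subset of $[0,+\infty[$. Furthermore, let $\psi:\,]0,+\infty[\,\to\,]0,+\infty[$ be a map such that $t\mapsto\log(\psi(e^{-t}))$ is Lipschitz. If $\int_0^1\psi(t)/t^2\,dt$ diverges (resp. converges), then for Lebesgue almost all $x\in\mathbb{R}$, $$\liminf_{\alpha\in\mathcal E_{\alpha_0},\ |\alpha-\alpha^\sigma|\to0}\ \frac{|x-\alpha|}{\psi(|\alpha-\alpha^\sigma|)}=0\quad(\text{resp. }=+\infty).$$
   Context: For a real quadratic irrational number $\alpha$ over $\mathbb{Q}$, $\alpha^\sigma$ denotes its Galois conjugate. $\mathcal E_{\alpha_0}=\mathrm{PSL}_2(\mathbb{Z})\cdot\{\alpha_0,\alpha_0^\sigma\}$ is the (countable, dense in $\mathbb{R}$) orbit for the action of $\mathrm{PSL}_2(\mathbb{Z})$ by homographies on $\mathbb{R}\cup\{\infty\}$. For $x\in\mathbb{R}-(\mathbb{Q}\cup\mathcal E_{\alpha_0})$, the approximation constant of $x$ by elements of $\mathcal E_{\alpha_0}$ is $$c_{\alpha_0}(x)=\liminf_{\alpha\in\mathcal E_{\alpha_0},\ |\alpha-\alpha^\sigma|\to0}\ 2\,\frac{|x-\alpha|}{|\alpha-\alpha^\sigma|},$$ and the approximation spectrum is $\operatorname{Sp}_{\alpha_0}=\{c_{\alpha_0}(x):x\in\mathbb{R}-(\mathbb{Q}\cup\mathcal E_{\alpha_0})\}$.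 *)

(* Defs.v *)
From HB Require Import structures.
From mathcomp Require Import all_boot all_order all_algebra.
From mathcomp Require Import all_classical all_reals all_analysis.
Import Order.TTheory GRing.Theory Num.Theory.
Import numFieldNormedType.Exports.

Set Implicit Arguments.
Unset Strict Implicit.
Unset Printing Implicit Defensive.

Local Open Scope classical_set_scope.
Local Open Scope ring_scope.

Definition quadratic_irrational (R : realType) (a : R) : Prop :=
  exists p : {poly rat},
    [/\ irreducible_poly p, size p = 3%N & root (map_poly ratr p) a].

(* The other root of the minimal polynomial of [a] over the rationals. For a
   quadratic irrational it exists, is real and is unique; the default value 0
   is only reached outside this case. *)
Definition galois_conj (R : realType) (a : R) : R :=
  xget 0 [set b : R | b != a /\ exists p : {poly rat},
    [/\ irreducible_poly p, root (map_poly ratr p) a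
      & root (map_poly ratr p) b]].

(* Here [option R] is the real line with a point at infinity, [None]. *)
Definition homography (R : realType) (g : 'M[int]_2) (z : option R)
    : option R :=
  let: a := (g 0 0)%:~R in let: b := (g 0 1)%:~R in
  let: c := (g 1 0)%:~R in let: d := (g 1 1)%:~R in
  match z with
  | Some x => if c * x + d == 0 then None else Some ((a * x + b) / (c * x + d))
  | None => if c == 0 then None else Some (a / c)
  end.

(* Elements of PSL_2(Z) are represented by matrices in SL_2(Z): a matrix and
   its opposite define the same homography. *)
Definition PSL2Z_orbit (R : realType) (A : set (option R)) : set (option R) :=
  [set w | exists g : 'M[int]_2,
     \det g = 1 /\ exists2 z, A z & w = homography g z].

Definition quad_orbit (R : realType) (alpha0 : R) : set R :=
  [set alpha | PSL2Z_orbit [set Some alpha0; Some (galois_conj alpha0)]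
                 (Some alpha)].

(* The filter "alpha in E_{alpha0}, |alpha - alpha^sigma| -> 0". *)
Definition small_orbit_filter (R : realType) (alpha0 : R) : set_system R :=
  filter_from [set e : R | 0 < e]
    (fun e => [set alpha | quad_orbit alpha0 alpha /\
                           `|alpha - galois_conj alpha| < e]).

Definition liminf_orbit (R : realType) (alpha0 : R) (f : R -> R) : \bar R :=
  limf_einf (fun alpha => (f alpha)%:E) (small_orbit_filter alpha0).

Definition approx_constant (R : realType) (alpha0 x : R) : \bar R :=
  liminf_orbit alpha0
    (fun alpha => 2 * (`|x - alpha| / `|alpha - galois_conj alpha|)).

Definition approx_spectrum (R : realType) (alpha0 : R) : set (\bar R) :=
  approx_constant alpha0 @` ~` (rational `|` quad_orbit alpha0).

(* Main.v *)
Require Import Defs.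
From HB Require Import structures.
From mathcomp Require Import all_boot all_order all_algebra finmap.
From mathcomp Require Import all_classical all_reals all_analysis.
From mathcomp Require Import measurable_realfun ring lra zify.
Import Order.TTheory GRing.Theory Num.Theory.
Import numFieldNormedType.Exports.

(** Let [E] be the orbit and let the width of a point of [E] be its distance to
    its conjugate. All points of [E] are roots of integral binary quadratic
    forms of one discriminant [D], and the width is [sqrt D] divided by the
    absolute value of the leading coefficient. Two facts about [E] carry the
    proof. The first is a repulsion property: the resultant of two such forms
    without common root is a nonzero integer, so two points of [E] of width at
    least [t] are at distance at least a constant times [t]
    ([quad_orbit_repulsion]). The second is that near each fraction [p / q] there
    is a point of [E] at distance at most [1 / q ^ 2] whose width is comparable
    with [1 / q ^ 2] ([orbit_near_fraction]); with Dirichlet's theorem this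
    bounds the approximation constants ([orbit_dirichlet], [spectrum_bound]).

    Almost everywhere statements. By repulsion, an interval contains
    [O(length / t)] points of width at least [t], so that the convergent case is
    the Borel-Cantelli lemma ([orbit_khintchine_convergence]). For the divergent
    case, Dirichlet's theorem provides at least [c * length / t] points of width
    comparable with [t] in a given interval, for all small [t]: up to half of the
    length, every point is near a fraction of large denominator
    ([large_denominators_cover], [orbit_regular_system]). Thus the levels of [E],
    taken at widely spaced widths, form a regular system: a ball of radius [r]
    around a point of one level meets [O(r / t)] later balls of scale [t] and none
    when [r] is much smaller than [t]. Keeping greedily the balls which avoid the
    previous ones, the union of the balls of large index fills a fixed proportion
    of every interval as soon as the series diverges ([greedy_long],
    [approximable_proportion]), and a set missing such a proportion of every
    interval is null ([negligible_of_deficient]). The series is compared with the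
    integral on geometric scales, where [psi] varies by bounded factors.

    Closedness. A real number [x] is coded by the infinite word of left and right
    turns of the vertical geodesic ending at [x] through the Farey tessellation.
    After [k] letters, applying the inverse of the product [g_k] of the letters
    moves the geodesic to one crossing the line from 0 to infinity, and
    [|x - b| / |b - b'|], with [b'] the conjugate of [b], becomes a cross-ratio
    of the new endpoints and of [g_k^-1 b], [g_k^-1 b'] ([hval_ratio]). A point
    [b] of [E] that approximates [x] well stays with [x] in the cells of the
    coding for a while; in the last cell containing [b] and [b'] the values of
    the translated form at three neighbouring cusps are bounded, so [g_k^-1 b]
    lies in a fixed bounded set ([approximation_seen]). Hence the approximation
    constant is a lower limit, along the positions of the word, of a function
    which depends up to a small error on a bounded window only
    ([approx_constant_code], [window_transfer]). Such lower limits form a closed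
    set: given words whose lower limits converge, compactness provides patterns
    common to infinitely many places where the lower limits are nearly attained,
    and cutting and gluing along these patterns gives one word all of whose long
    windows come from the given words ([gluing]). The number it codes realises the
    limit; when the limit is positive this number is not in [E], because the
    coding of a point of [E] sees the point itself at distance 0
    ([code_liminf_orbit]). The value 0 is realised by almost every number, by the
    divergent case. *)

Local Open Scope classical_set_scope.
Local Open Scope ring_scope.

Set Implicit Arguments.
Unset Strict Implicit.
Unset Printing Implicit Defensive.

(** * Quadratic irrationals and integral binary forms *)

Section Rationals.
Variable R : realType.
Implicit Types x y : R.

Lemma rational_ratr (q : rat) : rational (ratr q : R).
Proof. by exists q. Qed.

Lemma rational_int (n : int) : rational (n%:~R : R).
Proof. by exists n%:~R => //; rewrite ratr_int. Qed.

Lemma rational_add x y : rational x -> rational y -> rational (x + y).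
Proof. by move=> [p _ <-] [q _ <-]; exists (p + q) => //; rewrite rmorphD. Qed.

Lemma rational_mul x y : rational x -> rational y -> rational (x * y).
Proof. by move=> [p _ <-] [q _ <-]; exists (p * q) => //; rewrite rmorphM. Qed.

Lemma rational_opp x : rational x -> rational (- x).
Proof. by move=> [p _ <-]; exists (- p) => //; rewrite rmorphN. Qed.

Lemma rational_inv x : rational x -> rational (x^-1).
Proof. by move=> [p _ <-]; exists (p^-1) => //; rewrite fmorphV. Qed.

Lemma irrational_affine_neq0 x (r s : int) :
  ~ rational x -> (r != 0) || (s != 0) -> r%:~R * x + s%:~R != 0.
Proof.
move=> xirr rs; apply/eqP => /eqP; rewrite addr_eq0 => /eqP e.
have [r0|r0] := eqVneq r 0.
  move: e; rewrite r0 mul0r => /eqP; rewrite eq_sym oppr_eq0 intr_eq0.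
  by move: rs; rewrite r0 eqxx /= => /negPf ->.
apply: xirr.
have -> : x = - s%:~R * (r%:~R)^-1.
  by rewrite -e mulrC mulKf // intr_eq0.
apply: rational_mul; first exact/rational_opp/rational_int.
exact/rational_inv/rational_int.
Qed.

End Rationals.

Section ConjPair.
Variable R : realType.
Implicit Types (a b x : R) (A B C : int).

(** Vieta's relations determine the second root as well, so that the two
    conjugates play symmetric roles. *)
Definition conj_pair A B C a b := [/\ A != 0, A%:~R * (a + b) = - B%:~R,
  A%:~R * (a * b) = C%:~R, ~ rational a & a != b].

Lemma conj_pair_irr A B C a b : conj_pair A B C a b -> ~ rational b.
Proof.
move=> [A0 sab _ airr _] brat; apply: airr.
have -> : a = - B%:~R * (A%:~R)^-1 - b.
  by rewrite -sab mulrC mulKf ?intr_eq0 // addrK.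
apply: rational_add; last exact: rational_opp.
by apply: rational_mul; [apply: rational_opp; apply: rational_int
  | apply: rational_inv; apply: rational_int].
Qed.

Lemma conj_pair_sym A B C a b : conj_pair A B C a b -> conj_pair A B C b a.
Proof.
move=> h; have birr := conj_pair_irr h; case: h => A0 sab pab airr ab.
by split=> //; rewrite 1?addrC 1?[b * a]mulrC // eq_sym.
Qed.

Lemma conj_pair_disc A B C a b : conj_pair A B C a b ->
  (A%:~R * (a - b)) ^+ 2 = (B ^+ 2 - 4 * A * C)%:~R.
Proof.
move=> [A0 sab pab _ _].
rewrite rmorphB rmorphXn /= !rmorphM /= -mulrA -pab -[B%:~R]opprK -sab.
rewrite -[4%:~R]/(4%:R); ring.
Qed.

Definition ratquad A B C : {poly rat} :=
  A%:~R *: 'X^2 + B%:~R *: 'X + (C%:~R)%:P.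

Lemma size_ratquad A B C : A != 0 -> size (ratquad A B C) = 3%N.
Proof.
move=> A0; rewrite /ratquad -addrA size_polyDl.
  by rewrite size_scale ?size_polyXn // intr_eq0.
rewrite size_scale ?intr_eq0 // size_polyXn.
apply: (leq_ltn_trans (size_polyD _ _)); rewrite ltnS geq_max.
rewrite (leq_trans (size_scale_leq _ _)) ?size_polyX //.
by rewrite (leq_trans (size_polyC_leq1 _)).
Qed.

Lemma map_ratquad A B C : map_poly ratr (ratquad A B C) =
  A%:~R *: 'X^2 + B%:~R *: 'X + (C%:~R)%:P :> {poly R}.
Proof.
by rewrite /ratquad !rmorphD /= !linearZ_LR /= map_polyXn map_polyX map_polyC
  /= !ratr_int.
Qed.

Lemma horner_ratquad A B C a b x : conj_pair A B C a b ->
  (map_poly ratr (ratquad A B C)).[x] = A%:~R * ((x - a) * (x - b)).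
Proof.
move=> [_ sab pab _ _]; rewrite map_ratquad !(hornerD, hornerZ, hornerXn, hornerX, hornerC) -pab.
rewrite -[B%:~R]opprK -sab. ring.
Qed.

Lemma root_ratquad A B C a b x : conj_pair A B C a b ->
  root (map_poly ratr (ratquad A B C)) x = (x == a) || (x == b).
Proof.
move=> h; rewrite rootE (horner_ratquad x h) !mulf_eq0 intr_eq0 !subr_eq0.
by case: h => /negPf ->.
Qed.

Lemma irreducible_ratquad A B C a b : conj_pair A B C a b ->
  irreducible_poly (ratquad A B C).
Proof.
move=> h; have [A0 _ _ airr _] := h; have birr := conj_pair_irr h.
apply: cubic_irreducible; first by rewrite size_ratquad.
move=> q; apply/negP => rq.
have : root (map_poly ratr (ratquad A B C)) (ratr q : R) by rewrite fmorph_root.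
rewrite (root_ratquad _ h) => /orP[] /eqP e; [apply: airr|apply: birr];
  by rewrite -e; apply: rational_ratr.
Qed.

(** An irreducible rational polynomial vanishing at [a] divides, up to a
    constant, the polynomial with roots [a] and [b]; no other conjugate is
    possible. *)
Lemma galois_conj_pair A B C a b : conj_pair A B C a b -> galois_conj a = b.
Proof.
move=> h; have irr := irreducible_ratquad h; have [A0 _ _ _ ab] := h.
rewrite /galois_conj; apply: xget_unique => /=.
  split; first by rewrite eq_sym.
  by exists (ratquad A B C); split; rewrite // (root_ratquad _ h) eqxx ?orbT.
move=> y [ya [p [pirr pa py]]].
have pq : p %| ratquad A B C.
  rewrite -[_ %| _]negbK -irreducible_poly_coprime //.
  apply/negP => cop.
  have := coprimep_root (p := map_poly ratr p : {poly R})
            (q := map_poly ratr (ratquad A B C)) (x := a).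
  rewrite coprimep_map => /(_ cop pa) /negP; apply.
  by rewrite -rootE (root_ratquad _ h) eqxx.
have : root (map_poly ratr (ratquad A B C)) y.
  move: pq; rewrite -(dvdp_map (ratr : {rmorphism rat -> R})).
  by case/dvdpP => u ->; rewrite rootM py orbT.
by rewrite (root_ratquad _ h) (negPf ya) => /eqP.
Qed.

Lemma quadratic_irrational_pair a : quadratic_irrational a ->
  exists A B C, conj_pair A B C a (galois_conj a).
Proof.
move=> [p [pirr psz pa]].
have p2 : p`_2 != 0.
  by have := lead_coef_eq0 p; rewrite lead_coefE psz /= -size_poly_eq0 psz => ->.
pose d := denq p`_0 * denq p`_1 * denq p`_2.
pose A := numq p`_2 * (denq p`_0 * denq p`_1).
pose B := numq p`_1 * (denq p`_0 * denq p`_2).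
pose C := numq p`_0 * (denq p`_1 * denq p`_2).
pose dR : R := d%:~R.
have d0 : dR != 0 by rewrite intr_eq0 !mulf_neq0 ?denq_neq0.
have cE q : (numq q)%:~R = ratr q * (denq q)%:~R :> R.
  by rewrite /ratr mulfVK // intr_eq0 denq_neq0.
have AE : A%:~R = dR * ratr p`_2 by rewrite /A /dR /d !rmorphM /= cE; ring.
have BE : B%:~R = dR * ratr p`_1 by rewrite /B /dR /d !rmorphM /= cE; ring.
have CE : C%:~R = dR * ratr p`_0 by rewrite /C /dR /d !rmorphM /= cE; ring.
have A0 : A%:~R != 0 :> R by rewrite AE mulf_neq0 // fmorph_eq0.
have airr : ~ rational a.
  move=> [q _ qa]; move: pa; rewrite -qa fmorph_root => pq.
  have : 'X - q%:P %| p by rewrite dvdp_XsubCl.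
  move/(apply_irredp pirr); rewrite size_XsubC => /(_ isT) /eqp_size.
  by rewrite size_XsubC psz.
pose b := - B%:~R / A%:~R - a.
have bE : A%:~R * (a + b) = - B%:~R.
  by rewrite /b addrCA subrr addr0 mulrCA divff // mulr1.
have ra : A%:~R * a ^+ 2 + B%:~R * a + C%:~R = 0.
  have : (map_poly ratr p).[a] = 0 by apply/eqP; rewrite -rootE.
  rewrite (horner_coef_wide _ (n := 3)) ?size_map_poly ?psz //.
  rewrite !big_ord_recl big_ord0 /= /bump /= !coef_map /= expr0 expr1 addr0 => e.
  by rewrite AE BE CE -[RHS](mulr0 dR) -e; ring.
have h : conj_pair A B C a b.
  split => //; first by rewrite -(intr_eq0 R).
    apply/eqP; rewrite -subr_eq0; apply/eqP; rewrite -[RHS]oppr0 -ra.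
    by rewrite -[B%:~R]opprK -bE; ring.
  apply/eqP => ab; apply: airr.
  have -> : a = - B%:~R / (2%:~R * A%:~R).
    by rewrite -bE -ab; field; rewrite A0.
  apply: rational_mul; first exact/rational_opp/rational_int.
  by rewrite -rmorphM /=; apply/rational_inv/rational_int.
by exists A, B, C; rewrite (galois_conj_pair h).
Qed.

(** The integral form with roots [g a], [g b] is obtained from the one with
    roots [a], [b] by an integral unimodular substitution, which preserves the
    discriminant. *)
Lemma conj_pair_moebius A B C a b (p q r s : int) :
  p * s - q * r = 1 -> conj_pair A B C a b ->
  exists A' B' C', B' ^+ 2 - 4 * A' * C' = B ^+ 2 - 4 * A * C /\
    conj_pair A' B' C' ((p%:~R * a + q%:~R) / (r%:~R * a + s%:~R))
                       ((p%:~R * b + q%:~R) / (r%:~R * b + s%:~R)).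
Proof.
move=> det h; have [A0 sab pab airr ab] := h; have birr := conj_pair_irr h.
have rs : (r != 0) || (s != 0).
  by case: (r =P 0) => // r0; case: (s =P 0) => // s0; move: det;
     rewrite r0 s0 !mulr0 subr0.
have da := irrational_affine_neq0 airr rs.
have db := irrational_affine_neq0 birr rs.
have detR : p%:~R * s%:~R - q%:~R * r%:~R = 1 :> R.
  by rewrite -!rmorphM /= -rmorphB /= det.
pose A' := A * s ^+ 2 - B * (r * s) + C * r ^+ 2.
pose B' := - (2 * A * q * s) + B * (p * s + q * r) - 2 * C * p * r.
pose C' := A * q ^+ 2 - B * (p * q) + C * p ^+ 2.
have A'E : A'%:~R = A%:~R * ((r%:~R * a + s%:~R) * (r%:~R * b + s%:~R)).
  rewrite /A' !(rmorphD, rmorphN, rmorphXn, rmorphM) /= -pab.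
  by rewrite -[B%:~R]opprK -sab; ring.
have A'0 : A' != 0 by rewrite -(intr_eq0 R) A'E !mulf_neq0 // intr_eq0.
exists A', B', C'; split.
  have -> : B ^+ 2 - 4 * A * C = (B ^+ 2 - 4 * A * C) * (p * s - q * r) ^+ 2.
    by rewrite det expr1n mulr1.
  by rewrite /A' /B' /C'; ring.
have dif : (p%:~R * a + q%:~R) / (r%:~R * a + s%:~R) -
           (p%:~R * b + q%:~R) / (r%:~R * b + s%:~R) =
           (a - b) / ((r%:~R * a + s%:~R) * (r%:~R * b + s%:~R)) :> R.
  have -> : a - b = (p%:~R * s%:~R - q%:~R * r%:~R) * (a - b).
    by rewrite detR mul1r.
  by field; rewrite da db.
split=> //.
- rewrite A'E /B' !(rmorphD, rmorphN, rmorphXn, rmorphM) /=.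
  rewrite !rmorph1 -pab.
  by rewrite -[B%:~R]opprK -sab; field; rewrite da db.
- rewrite A'E /C' !(rmorphD, rmorphN, rmorphXn, rmorphM) /= -pab.
  by rewrite -[B%:~R]opprK -sab; field; rewrite da db.
- set z := (X in rational X) => zrat; apply: airr.
  have zE : z * (r%:~R * a + s%:~R) = p%:~R * a + q%:~R by rewrite mulfVK.
  have e0 : (p%:~R - r%:~R * z) * a = s%:~R * z - q%:~R.
    apply/eqP; rewrite -subr_eq0.
    have -> : (p%:~R - r%:~R * z) * a - (s%:~R * z - q%:~R) =
      (p%:~R * a + q%:~R) - z * (r%:~R * a + s%:~R) by ring.
    by rewrite zE subrr.
  have c0 : p%:~R - r%:~R * z != 0.
    apply/eqP => c0; move: e0; rewrite c0 mul0r => e0.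
    have : (1 : R) = 0; last by move/eqP; rewrite oner_eq0.
    rewrite -detR.
    have -> : p%:~R = r%:~R * z by apply/eqP; rewrite -subr_eq0 c0.
    have -> : q%:~R = s%:~R * z by apply/eqP; rewrite eq_sym -subr_eq0 -e0.
    by ring.
  have -> : a = (s%:~R * z - q%:~R) / (p%:~R - r%:~R * z).
    by rewrite -e0 mulrC mulKf.
  have ri := @rational_int R.
  apply: rational_mul; [|apply: rational_inv];
   (apply: rational_add; [|apply: rational_opp]);
   try exact: ri; apply: rational_mul => //; exact: ri.
- by rewrite -subr_eq0 dif !mulf_neq0 ?invr_eq0 ?mulf_neq0 // subr_eq0.
Qed.

End ConjPair.

Lemma det_mx2 (g : 'M[int]_2) : \det g = g 0 0 * g 1 1 - g 0 1 * g 1 0.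
Proof.
rewrite (expand_det_row _ 0) !big_ord_recl big_ord0 addr0 /cofactor !det_mx11.
rewrite !mxE /= expr0 expr1 mul1r mulN1r mulrN.
by congr (_ * g _ _ - g _ _ * g _ _); apply/val_inj.
Qed.

Section Resultant.
Variable R : realType.
Implicit Types (a b : R).

(** The left-hand side is the resultant of the two integral forms. *)
Lemma conj_pair_resultant (A B C P Q S : int) a a' b b' :
  conj_pair A B C a a' -> conj_pair P Q S b b' ->
  ((A * S - C * P) ^+ 2 - (A * Q - B * P) * (B * S - C * Q))%:~R =
  (A%:~R * P%:~R) ^+ 2 * ((a - b) * (a - b') * (a' - b) * (a' - b')).
Proof.
move=> [_ sa pa _ _] [_ sb pb _ _].
rewrite !(rmorphD, rmorphN, rmorphXn, rmorphM) /= -pa -pb.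
rewrite -[B%:~R]opprK -sa -[Q%:~R]opprK -sb; ring.
Qed.

Lemma intr_norm_ge1 (n : int) : n != 0 -> 1 <= `|n%:~R| :> R.
Proof. by move=> n0; rewrite -intr_norm ler1z; lia. Qed.

End Resultant.

Section Orbit.
Variables (R : realType) (alpha0 : R).
Hypothesis halpha0 : quadratic_irrational alpha0.
Local Notation E := (quad_orbit alpha0).
Local Notation sg := (@galois_conj R).
Implicit Types a b : R.

Lemma quad_orbitP a : E a -> exists p q r s : int, p * s - q * r = 1 /\
  exists2 z, z = alpha0 \/ z = sg alpha0 &
    a = (p%:~R * z + q%:~R) / (r%:~R * z + s%:~R).
Proof.
move=> [g [dg [z Az az]]].
exists (g 0 0), (g 0 1), (g 1 0), (g 1 1); split; first by rewrite -det_mx2.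
move: az; case: Az => -> /=; case: ifP => // _ [->];
  [exists alpha0|exists (sg alpha0)]; auto.
Qed.

Lemma quad_orbit_moebius0 (p q r s : int) z : p * s - q * r = 1 ->
  z = alpha0 \/ z = sg alpha0 -> E ((p%:~R * z + q%:~R) / (r%:~R * z + s%:~R)).
Proof.
move=> det zz.
have zirr : ~ rational z.
  have [A [B [C h]]] := quadratic_irrational_pair halpha0.
  by case: zz => ->; [case: h | exact: conj_pair_irr h].
have rs : (r != 0) || (s != 0) by lia.
have d0 := irrational_affine_neq0 zirr rs.
exists (\matrix_(i, j) if i == 0 then if j == 0 then p else q
                       else if j == 0 then r else s).
split; first by rewrite det_mx2 !mxE.
exists (Some z); first by case: zz => ->; [left|right].
by rewrite /= !mxE /= (negPf d0).
Qed.

(** The orbit is used below only through these forms of fixed discriminant and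
    through its invariance under the modular group. *)
Lemma quad_orbit_disc : exists2 D : int, 0 < D & forall a, E a ->
  exists A B C, B ^+ 2 - 4 * A * C = D /\ conj_pair A B C a (sg a).
Proof.
have [A [B [C h]]] := quadratic_irrational_pair halpha0.
exists (B ^+ 2 - 4 * A * C).
  rewrite -(ltr_int R) -(conj_pair_disc h) exprn_even_gt0 //=.
  by case: h => A0 _ _ _ ab; rewrite mulf_neq0 ?intr_eq0 // subr_eq0.
move=> a /quad_orbitP[p [q [r [s [det [z zz ->]]]]]].
have hz : conj_pair A B C z (sg z).
  by case: zz => -> //; rewrite (galois_conj_pair (conj_pair_sym h));
     apply: conj_pair_sym.
have [A' [B' [C' [dE h']]]] := conj_pair_moebius det hz.
by exists A', B', C'; rewrite (galois_conj_pair h').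
Qed.

Lemma quad_orbit_irr a : E a -> ~ rational a.
Proof. by have [D _ h] := quad_orbit_disc => /h[A [B [C [_ []]]]]. Qed.

Lemma quad_orbit_neq a : E a -> a != sg a.
Proof. by have [D _ h] := quad_orbit_disc => /h[A [B [C [_ []]]]]. Qed.

Lemma galois_conjK a : E a -> sg (sg a) = a.
Proof.
have [D _ h] := quad_orbit_disc => /h[A [B [C [_ hp]]]].
exact: galois_conj_pair (conj_pair_sym hp).
Qed.

Lemma quad_orbit_width_gt0 a : E a -> 0 < `|a - sg a|.
Proof. by move=> Ea; rewrite normr_gt0 subr_eq0 quad_orbit_neq. Qed.

Lemma galois_conj_moebius a (p q r s : int) : E a -> p * s - q * r = 1 ->
  sg ((p%:~R * a + q%:~R) / (r%:~R * a + s%:~R)) =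
  (p%:~R * sg a + q%:~R) / (r%:~R * sg a + s%:~R).
Proof.
have [D _ h] := quad_orbit_disc => /h[A [B [C [_ hp]]]] det.
have [A' [B' [C' [_ h']]]] := conj_pair_moebius det hp.
exact: galois_conj_pair h'.
Qed.

Lemma quad_orbit_conj a : E a -> E (sg a).
Proof.
move=> /quad_orbitP[p [q [r [s [det [z zz ->]]]]]].
have [A [B [C h]]] := quadratic_irrational_pair halpha0.
have hz : conj_pair A B C z (sg z).
  by case: zz => -> //; rewrite (galois_conj_pair (conj_pair_sym h));
     apply: conj_pair_sym.
have [A' [B' [C' [_ h']]]] := conj_pair_moebius det hz.
rewrite (galois_conj_pair h'); apply: quad_orbit_moebius0 => //.
by case: zz => ->; [right|left; rewrite (galois_conj_pair (conj_pair_sym h))].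
Qed.

Lemma quad_orbit_moebius a (p q r s : int) : E a -> p * s - q * r = 1 ->
  E ((p%:~R * a + q%:~R) / (r%:~R * a + s%:~R)).
Proof.
move=> Ea det; have airr := quad_orbit_irr Ea.
have [p' [q' [r' [s' [det' [z zz aE]]]]]] := quad_orbitP Ea.
have rs : (r != 0) || (s != 0) by lia.
have d0 := irrational_affine_neq0 airr rs.
have zirr : ~ rational z.
  have [A [B [C h]]] := quadratic_irrational_pair halpha0.
  by case: zz => ->; [case: h | exact: conj_pair_irr h].
have rs' : (r' != 0) || (s' != 0) by lia.
have d0' := irrational_affine_neq0 zirr rs'.
have det2 : (p * p' + q * r') * (r * q' + s * s') -
            (p * q' + q * s') * (r * p' + s * r') = 1.
  have -> : (p * p' + q * r') * (r * q' + s * s') -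
    (p * q' + q * s') * (r * p' + s * r') =
    (p * s - q * r) * (p' * s' - q' * r') by ring.
  by rewrite det det' mulr1.
have -> : (p%:~R * a + q%:~R) / (r%:~R * a + s%:~R) =
  ((p * p' + q * r')%:~R * z + (p * q' + q * s')%:~R) /
  ((r * p' + s * r')%:~R * z + (r * q' + s * s')%:~R); last first.
  exact: quad_orbit_moebius0.
have rs2 : (r * p' + s * r' != 0) || (r * q' + s * s' != 0).
  rewrite -negb_and; apply/negP => /andP[/eqP e1 /eqP e2].
  by move: det2; rewrite e1 e2 !mulr0 subr0.
have := irrational_affine_neq0 zirr rs2.
rewrite aE in d0 *; rewrite !(rmorphD, rmorphM) /= => d2.
by field; rewrite d0' d2.
Qed.

Lemma quad_orbit0 : E alpha0.
Proof.
have := @quad_orbit_moebius0 1 0 0 1 alpha0 (erefl _) (or_introl (erefl _)).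
by rewrite /= mul1r addr0 mul0r add0r divr1.
Qed.

Lemma countable_quad_orbit : countable E.
Proof.
pose f (u : bool * (int * int * int * int)) : R :=
  let: (e, (p, q, r, s)) := u in
  let z := if e then alpha0 else sg alpha0 in
  (p%:~R * z + q%:~R) / (r%:~R * z + s%:~R).
apply: (@sub_countable _ _ _ (range f)); last first.
  exact: (card_le_trans (card_image_le f setT) (countableP _)).
apply: subset_card_le => a /quad_orbitP[p [q [r [s [_ [z zz ->]]]]]].
by case: zz => ->; [exists (true, (p, q, r, s))|exists (false, (p, q, r, s))].
Qed.

(** The resultant of two integral forms without common root is a nonzero
    integer. When [a] and [b] are close, three of the four differences in it are
    bounded by multiples of the widths, which bounds the fourth from below. *)
Lemma quad_orbit_repulsion : exists2 kap : R, 0 < kap &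
  forall a b t, E a -> E b -> a != b -> 0 < t ->
    t <= `|a - sg a| -> t <= `|b - sg b| -> kap * t <= `|a - b|.
Proof.
have [D D0 h] := quad_orbit_disc.
have D0R : 0 < D%:~R :> R by rewrite ltr0z.
have D1R : 1 <= D%:~R :> R by rewrite ler1z; lia.
have k0 : 0 < (12 * D%:~R ^+ 2)^-1 :> R by rewrite invr_gt0; nra.
exists (12 * D%:~R ^+ 2)^-1 => // a b t Ea Eb ab t0 ta tb.
have k1 : (12 * D%:~R ^+ 2)^-1 <= 1 :> R by rewrite invf_le1; nra.
wlog sab : a b Ea Eb ab ta tb / `|b - sg b| <= `|a - sg a|.
  move=> W; have [|/ltW] := leP `|b - sg b| `|a - sg a|; first exact: W.
  by move=> ?; rewrite distrC; apply: W => //; rewrite eq_sym.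
suff : (12 * D%:~R ^+ 2)^-1 * `|b - sg b| <= `|a - b|.
  by apply: le_trans; rewrite ler_pM2l.
have [abs|abs] := leP `|b - sg b| `|a - b|.
  by apply: (le_trans _ abs); rewrite ler_piMl.
have [sab'|sab'] := eqVneq a (sg b).
  by move: abs; rewrite sab' distrC ltxx.
have sab2 : sg a != b by apply: contraNneq sab' => <-; rewrite galois_conjK.
have sab3 : sg a != sg b.
  by apply: contraNneq ab => e; rewrite -[a]galois_conjK // e galois_conjK.
have [A [B [C [dE hp]]]] := h a Ea; have [P [Q [S [dE' hp']]]] := h b Eb.
have := conj_pair_resultant hp hp'; set N := (X in X%:~R = _) => NE.
have N1 : 1 <= `|N%:~R| :> R.
  apply: intr_norm_ge1; rewrite -(intr_eq0 R) NE.
  case: hp hp' => A0 _ _ _ _ [P0 _ _ _ _].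
  by rewrite !mulf_neq0 ?sqrf_eq0 ?mulf_neq0 ?intr_eq0 // subr_eq0.
move: N1; rewrite NE normrM normrX !normrM.
have := conj_pair_disc hp; rewrite dE => /(congr1 Num.norm).
rewrite normrX normrM [in RHS]gtr0_norm // => e1.
have := conj_pair_disc hp'; rewrite dE' => /(congr1 Num.norm).
rewrite normrX normrM [in RHS]gtr0_norm // => e2.
move=> N1.
have b1 : `|a - sg b| <= 2 * `|b - sg b|.
  by have := ler_distD b a (sg b); clear -abs; lra.
have b2 : `|sg a - b| <= 2 * `|a - sg a|.
  by have := ler_distD a (sg a) b; rewrite (distrC (sg a) a); clear -abs sab; lra.
have b3 : `|sg a - sg b| <= 3 * `|a - sg a|.
  by have := ler_distD b (sg a) (sg b); clear -b2 sab; lra.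
have u0 := normr_ge0 (a - b).
have s0 := quad_orbit_width_gt0 Ea; have t0' := quad_orbit_width_gt0 Eb.
have step : `|a - b| * `|a - sg b| * `|sg a - b| * `|sg a - sg b| <=
   `|a - b| * (2 * `|b - sg b|) * (2 * `|a - sg a|) * (3 * `|a - sg a|).
  by rewrite !ler_pM ?mulr_ge0.
rewrite ler_pdivrMl; last by rewrite mulr_gt0 // exprn_gt0.
rewrite -(ler_pM2r (x := `|b - sg b| * `|a - sg a| ^+ 2)); last first.
  by rewrite mulr_gt0 // exprn_gt0.
have n0 : 0 <= (`|A%:~R| * `|P%:~R|) ^+ 2 :> R by rewrite exprn_ge0 ?mulr_ge0.
have := le_trans N1 (ler_wpM2l n0 step) => N2.
have -> : `|b - sg b| * (`|b - sg b| * `|a - sg a| ^+ 2) =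
          `|b - sg b| ^+ 2 * `|a - sg a| ^+ 2 by ring.
have w0 : 0 <= `|b - sg b| ^+ 2 * `|a - sg a| ^+ 2 by rewrite mulr_ge0 ?exprn_ge0.
apply: (le_trans (ler_peMr w0 N2)).
rewrite le_eqVlt; apply/orP; left; apply/eqP.
have -> : D%:~R ^+ 2 = (`|A%:~R| * `|a - sg a|) ^+ 2 * (`|P%:~R| * `|b - sg b|) ^+ 2 :> R.
  by rewrite e1 e2.
by ring.
Qed.

End Orbit.

(** * Dirichlet approximation and the orbit near rational points *)

Section Farey.
Variable R : realType.
Implicit Types x : R.

(** When the two denominators add up to the new bound, the mediant replaces the
    neighbour lying on its own side of [x]. *)
Lemma farey_neighbours x (N : nat) : (0 < N)%N ->
  exists p q p' q' : int, [/\ p * q' - p' * q = 1, 1 <= q <= N%:Z,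
    1 <= q' <= N%:Z, N%:Z < q + q' &
    p'%:~R <= q'%:~R * x /\ q%:~R * x <= p%:~R].
Proof.
elim: N => // -[_ _|N IH _].
  have [f1 f2] : (Num.floor x)%:~R <= x /\ x < (Num.floor x + 1)%:~R.
    by rewrite floor_le lt_succ_floor.
  exists (Num.floor x + 1), 1, (Num.floor x), 1; split=> //.
    by rewrite !mulr1 addrC addKr.
  by rewrite !mul1r; split=> //; apply: ltW.
have [p [q [p' [q' [det qN q'N qq [lo hi]]]]]] := IH isT.
have [big|small] := ltP N.+2%:Z (q + q').
  by exists p, q, p', q'; split=> //; lia.
have qR : 1 <= q%:~R :> R by rewrite ler1z; lia.
have qR' : 1 <= q'%:~R :> R by rewrite ler1z; lia.
have [m|m] := leP ((q + q')%:~R * x) (p + p')%:~R.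
  by exists (p + p'), (q + q'), p', q'; split => //; lia.
exists p, q, (p + p'), (q + q'); split => //; try lia.
by split=> //; apply: ltW.
Qed.

(** Dirichlet's theorem, with the fraction completed to a unimodular matrix. *)
Lemma dirichlet x (N : nat) : (0 < N)%N ->
  exists p q r s : int, [/\ p * s - r * q = 1, 1 <= q <= N%:Z &
    `|q%:~R * x - p%:~R| * N%:R <= 1].
Proof.
move=> N0; have [p [q [p' [q' [det qN q'N qq [lo hi]]]]]] := farey_neighbours x N0.
have detR : p%:~R * q'%:~R - p'%:~R * q%:~R = 1 :> R.
  by rewrite -!rmorphM /= -rmorphB /= det.
have qqR : N%:R <= q%:~R + q'%:~R :> R.
  by rewrite -rmorphD /= -[N%:R]/(N%:Z%:~R) ler_int ltW.
have q1 : 1 <= q%:~R :> R by rewrite ler1z; lia.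
have q1' : 1 <= q'%:~R :> R by rewrite ler1z; lia.
have sum1 : q'%:~R * (p%:~R - q%:~R * x) + q%:~R * (q'%:~R * x - p'%:~R) = 1.
  by apply: etrans detR; ring.
have [le|lt] := leP (p%:~R - q%:~R * x) (q'%:~R * x - p'%:~R).
  exists p, q, p', q'; split=> //.
  by rewrite distrC ger0_norm; [nra|lra].
exists p', q', (- p), (- q); split=> //; first by rewrite -det; ring.
by rewrite ger0_norm; [nra|lra].
Qed.

(** This forces the denominators of the Dirichlet approximations of [x] to tend
    to infinity. *)
Lemma irrational_dist_int x (Q : nat) : ~ rational x -> exists2 d : R, 0 < d &
  forall q p : int, 1 <= q <= Q%:Z -> d <= `|q%:~R * x - p%:~R|.
Proof.
move=> xirr; elim: Q => [|Q [d d0 IH]].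
  by exists 1 => // q p; lia.
pose y := Q.+1%:R * x; pose f := Num.floor y.
have yirr : ~ rational y.
  move=> yr; apply: xirr.
  have -> : x = y * (Q.+1%:R)^-1 by rewrite /y mulrAC divff ?mul1r // pnatr_eq0.
  by apply: rational_mul => //; apply: rational_inv; apply: (@rational_int _ Q.+1).
have f1 : f%:~R < y.
  rewrite lt_neqAle floor_le andbT; apply/eqP => e.
  by apply: yirr; rewrite -e; apply: rational_int.
have f2 : y < (f + 1)%:~R by rewrite lt_succ_floor.
rewrite rmorphD /= in f2.
pose g := Num.min (y - f%:~R) (f%:~R + 1 - y).
have g0 : 0 < g by rewrite lt_min; apply/andP; split; lra.
have gy : g <= y - f%:~R by rewrite ge_min lexx.
have gy' : g <= f%:~R + 1 - y by rewrite ge_min lexx orbT.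
exists (Num.min d g) => [|q p /andP[q1 qQ]]; first by rewrite lt_min d0.
have [->|qn] := eqVneq q Q.+1%:Z; last first.
  by apply: (le_trans _ (IH q p _)); [rewrite ge_min lexx | lia].
rewrite -[Q.+1%:Z%:~R]/(Q.+1%:R) -/y; apply: (@le_trans _ _ g).
  by rewrite ge_min lexx orbT.
have [pf|pf] := leP p f.
  have : p%:~R <= f%:~R :> R by rewrite ler_int.
  by move=> ?; rewrite ger0_norm; lra.
have : (f + 1)%:~R <= p%:~R :> R by rewrite ler_int; lia.
by rewrite rmorphD /= => ?; rewrite ler0_norm; lra.
Qed.

End Farey.

Section NearFractions.
Variables (R : realType) (alpha0 : R).
Hypothesis halpha0 : quadratic_irrational alpha0.
Local Notation E := (quad_orbit alpha0).
Local Notation sg := (@galois_conj R).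
Implicit Types a b x : R.

(** The translates [alpha0 + k] in the cusp at [p / q] have width comparable to
    [1 / q ^ 2] as soon as [k] is chosen to keep both conjugates in a fixed
    compact interval. *)
Lemma orbit_near_fraction : exists2 K : R, 1 <= K &
  forall p q r s : int, p * s - r * q = 1 -> 1 <= q ->
  exists a, [/\ E a, `|a - p%:~R / q%:~R| * q%:~R ^+ 2 <= 1,
    1 <= K * (`|a - sg a| * q%:~R ^+ 2) & `|a - sg a| * q%:~R ^+ 2 <= K].
Proof.
have E0 := quad_orbit0 halpha0.
pose w := `|alpha0 - sg alpha0|.
have w0 : 0 < w := quad_orbit_width_gt0 halpha0 E0.
pose K := (2 + 2 * w) ^+ 2 / w + w + 1.
have Kge : 1 <= K.
  by rewrite /K lerDr addr_ge0 // ?divr_ge0 ?exprn_even_ge0 ?ltW.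
exists K => // p q r s det q1.
have q1R : 1 <= q%:~R :> R by rewrite ler1z.
have qn0 : q%:~R != 0 :> R by rewrite intr_eq0; lia.
pose k := Num.ceil (1 + w - alpha0 - s%:~R / q%:~R).
have [k1 k2] : 1 + w - alpha0 - s%:~R / q%:~R <= k%:~R /\
               k%:~R < 2 + w - alpha0 - s%:~R / q%:~R.
  split; first exact: ceil_ge.
  by have := ceilB1_lt (1 + w - alpha0 - s%:~R / q%:~R); rewrite -/k rmorphB /=; lra.
pose t := alpha0 + k%:~R + s%:~R / q%:~R.
pose t' := sg alpha0 + k%:~R + s%:~R / q%:~R.
have tE : 1 + w <= t < 2 + w by rewrite /t; apply/andP; split; lra.
have tt' : `|t - t'| = w by congr `|_|; rewrite /t /t'; ring.
have t'E : 1 <= t' <= 2 + 2 * w.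
  by move: tt'; rewrite /w => tt'; move: (ler_norm (t - t')) (ler_normr w (t - t'));
     have := ler_norm (t' - t); rewrite distrC tt' -/w; lra.
have qtE z : q%:~R * z + (q * k + s)%:~R = q%:~R * (z + k%:~R + s%:~R / q%:~R) :> R.
  by rewrite rmorphD rmorphM /=; field.
have detR : p%:~R * s%:~R - r%:~R * q%:~R = 1 :> R.
  by rewrite -!rmorphM /= -rmorphB /= det.
have det' : p * (q * k + s) - (p * k + r) * q = 1 by rewrite -det; ring.
pose f z : R := (p%:~R * z + (p * k + r)%:~R) / (q%:~R * z + (q * k + s)%:~R).
have fE z : z + k%:~R + s%:~R / q%:~R != 0 ->
    f z - p%:~R / q%:~R = - ((z + k%:~R + s%:~R / q%:~R) * q%:~R ^+ 2)^-1.
  move=> z0; have qz0 : q%:~R * (z + k%:~R) + s%:~R != 0.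
    by have := mulf_neq0 qn0 z0; rewrite mulrDr mulrCA divff ?mulr1.
  rewrite /f !rmorphD !rmorphM /=.
  have -> : p%:~R * z + (p%:~R * k%:~R + r%:~R) =
     (p%:~R * (q%:~R * (z + k%:~R) + s%:~R) -
      (p%:~R * s%:~R - r%:~R * q%:~R)) / q%:~R by field.
  rewrite detR.
  have -> : q%:~R * z + (q%:~R * k%:~R + s%:~R) = q%:~R * (z + k%:~R) + s%:~R by ring.
  by field; rewrite qn0 [_ * q%:~R]mulrC qz0.
have tn0 : t != 0 by lra.
have tn0' : t' != 0 by lra.
exists (f alpha0).
have sgf : sg (f alpha0) = f (sg alpha0).
  by rewrite /f (galois_conj_moebius halpha0 E0).
split; first exact: quad_orbit_moebius.
- rewrite fE // normrN normfV normrM (@ger0_norm _ (_ ^+ _)) ?exprn_even_ge0 //.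
  rewrite invfM mulfVK ?expf_neq0 //; rewrite -/t ger0_norm ?invf_le1; clear -w0 tE; lra.
- rewrite sgf.
  have -> : f alpha0 - f (sg alpha0) = (t - t') / (t * t') / q%:~R ^+ 2.
    rewrite -[_ - _](subrKA (p%:~R / q%:~R)) -[p%:~R / q%:~R - _]opprB !fE // -/t -/t'.
    by field; rewrite tn0 tn0' qn0.
  rewrite normrM normfV (@ger0_norm _ (q%:~R ^+ _)) ?exprn_even_ge0 //.
  rewrite mulfVK ?expf_neq0 // normrM tt' normfV ger0_norm ?mulr_ge0; try by clear -w0 tE t'E; lra.
  have : 0 <= w / (t * t').
    by rewrite divr_ge0 ?(ltW w0) // mulr_ge0 //; clear -w0 tE t'E; lra.
  set v := w / (t * t') => v0.
  rewrite /K !mulrDl -addrA mul1r -[leLHS]addr0 lerD //; last first.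
    by apply: addr_ge0 => //; apply: mulr_ge0 => //; exact: ltW.
  rewrite /v mulrA mulfVK ?gt_eqF // ler_pdivlMr ?mul1r; clear -w0 tE t'E; nra.
- rewrite sgf.
  have -> : f alpha0 - f (sg alpha0) = (t - t') / (t * t') / q%:~R ^+ 2.
    rewrite -[_ - _](subrKA (p%:~R / q%:~R)) -[p%:~R / q%:~R - _]opprB !fE // -/t -/t'.
    by field; rewrite tn0 tn0' qn0.
  rewrite normrM normfV (@ger0_norm _ (q%:~R ^+ _)) ?exprn_even_ge0 //.
  rewrite mulfVK ?expf_neq0 // normrM tt' normfV ger0_norm ?mulr_ge0; try by clear -w0 tE t'E; lra.
  rewrite ler_pdivrMr; last by clear -w0 tE t'E; nra.
  have u0 : 0 <= (2 + 2 * w) ^+ 2 / w by rewrite divr_ge0 ?exprn_even_ge0 ?ltW.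
  have : 1 <= t * t' by clear -w0 tE t'E; nra.
  have : w <= K by rewrite /K -addrA addrCA lerDl addr_ge0.
  by nra.
Qed.

Lemma orbit_dirichlet : exists2 C : R, 0 < C & forall x, ~ rational x ->
  forall e, 0 < e -> exists a, [/\ E a, `|a - sg a| < e &
    `|x - a| <= C * `|a - sg a|].
Proof.
have [K K1 HK] := orbit_near_fraction.
exists (2 * K); first by lra.
move=> x xirr e e0.
pose Q := (Num.truncn (K / e)).+1.
have QE : K / e < Q%:R.
  exact: truncnS_gt.
have [d d0 Hd] := irrational_dist_int Q xirr.
pose N := (Num.truncn d^-1).+1.
have NE : d^-1 < N%:R by apply: truncnS_gt.
have [p [q [r [s [det /andP[q1 qN] ap]]]]] := dirichlet x (ltn0Sn (Num.truncn d^-1)).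
rewrite -/N in qN ap.
have qQ : Q%:Z < q.
  rewrite ltNge; apply/negP => qQ.
  have : d <= `|q%:~R * x - p%:~R| by apply: Hd; rewrite q1.
  have : 1 < d * N%:R by rewrite mulrC -ltr_pdivrMr // div1r.
  by have := normr_ge0 (q%:~R * x - p%:~R); nra.
have q1R : 1 <= q%:~R :> R by rewrite ler1z.
have qNR : q%:~R <= N%:R :> R by rewrite -[N%:R]/(N%:Z%:~R) ler_int.
have qQR : Q%:R < q%:~R :> R by rewrite -[Q%:R]/(Q%:Z%:~R) ltr_int.
have [a [Ea a1 a2 a3]] := HK p q r s det q1.
exists a; split=> //.
  have Ke : K < e * q%:~R.
    by rewrite mulrC -ltr_pdivrMr //; apply: lt_trans QE qQR.
  have -> : `|a - sg a| = `|a - sg a| * q%:~R ^+ 2 / q%:~R ^+ 2.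
    by rewrite mulfK // expf_neq0 // gt_eqF //; lra.
  rewrite ltr_pdivrMr; last by nra.
  by nra.
have xpq : `|x - p%:~R / q%:~R| * q%:~R ^+ 2 <= 1.
  have -> : x - p%:~R / q%:~R = (q%:~R * x - p%:~R) / q%:~R by field; rewrite gt_eqF //; lra.
  rewrite normrM normfV (@ger0_norm _ q%:~R); last by lra.
  rewrite expr2 mulrA mulfVK; last by rewrite gt_eqF //; lra.
  apply: le_trans ap; rewrite ler_wpM2l //.
rewrite -(ler_pM2r (x := q%:~R ^+ 2)); last by nra.
have := ler_distD (p%:~R / q%:~R) x a; rewrite (distrC (p%:~R / q%:~R)) => tri.
have q20 : 0 < q%:~R ^+ 2 :> R by nra.
by nra.
Qed.

End NearFractions.

(** * Packing, covering and null sets on the line *)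

Section Packing.
Variable R : realType.
Local Notation mu := (@lebesgue_measure R).
Implicit Types (b : R * R) (s : seq (R * R)) (A : set R).

(** A pair stands for the interval with this centre and this radius. *)
Definition far b b' : bool := b.2 + b'.2 <= `|b.1 - b'.1|.

Definition total_length s : R := \sum_(b <- s) 2 * b.2.

Lemma lebesgue_measure_oo (u v : R) : u <= v -> mu `]u, v[%classic = (v - u)%:E.
Proof.
move=> uv; rewrite lebesgue_measure_itv /= lte_fin; case: ltgtP uv => // -> _.
by rewrite subrr.
Qed.

Lemma lebesgue_measure_cc (u v : R) : u <= v -> mu `[u, v]%classic = (v - u)%:E.
Proof.
move=> uv; rewrite lebesgue_measure_itv /= lte_fin; case: ltgtP uv => // -> _.
by rewrite subrr.
Qed.

Lemma packing_le_measure s A : measurable A -> pairwise far s ->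
  (forall b, b \in s -> 0 <= b.2 /\
    `]b.1 - b.2, b.1 + b.2[%classic `<=` A) ->
  ((total_length s)%:E <= mu A)%E.
Proof.
elim: s A => [|b s IH] A mA /=.
  by move=> _ _; rewrite /total_length big_nil measure_ge0.
move=> /andP[/allP bs ps] H.
have [b0 bA] := H b (mem_head _ _).
pose I := `]b.1 - b.2, b.1 + b.2[%classic.
have mI : measurable (I : set R) by exact: measurable_itv.
rewrite /total_length big_cons EFinD (measureDI mu mA mI) addeC leeD //.
  apply: IH => //; first exact: measurableD.
  move=> b' b's; have [b'0 b'A] := H b' (mem_behead (s := b :: s) b's).
  split=> // x xb'; split; first exact: b'A.
  move: xb'; rewrite /I /= !in_itv /= => /andP[x1 x2] /andP[x3 x4].
  have := bs _ b's; rewrite /far ler_normr => /orP[]; lra.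
rewrite setIC setIidl // /I. rewrite /= lebesgue_measure_oo; last by lra.
by rewrite lee_fin; lra.
Qed.

Lemma measure_le_covering s A : measurable A ->
  (forall b, b \in s -> 0 <= b.2) ->
  (forall x, A x -> exists2 b, b \in s & `|x - b.1| <= b.2) ->
  (mu A <= (total_length s)%:E)%E.
Proof.
elim: s A => [|b s IH] A mA /= H cA.
  have -> : A = set0 by rewrite -subset0 => x /cA[b]; rewrite in_nil.
  by rewrite measure0 /total_length big_nil.
pose I := `[b.1 - b.2, b.1 + b.2]%classic.
have mI : measurable (I : set R) by exact: measurable_itv.
have b0 := H b (mem_head _ _).
rewrite /total_length big_cons EFinD (measureDI mu mA mI) addeC leeD //.
  apply: IH; first exact: measurableD.
    by move=> b' b's; apply: H; rewrite inE b's orbT.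
  move=> x [Ax xI]; have [b' + xb'] := cA x Ax.
  rewrite inE => /orP[/eqP e|b's]; last by exists b'.
  exfalso; apply: xI; rewrite /I /= in_itv /=; subst b'.
  by move: xb'; rewrite ler_norml => /andP[? ?]; apply/andP; split; lra.
apply: (@le_trans _ _ (mu I)).
  by apply: le_measure; rewrite ?inE //; exact: measurableI.
by rewrite /I /= lebesgue_measure_cc ?lee_fin; lra.
Qed.

(** The intervals of radius [rho / 2] around the points are disjoint. *)
Lemma size_separated (s : seq R) (rho u v : R) : 0 < rho -> u <= v -> uniq s ->
  (forall x, x \in s -> u <= x <= v) ->
  {in s &, forall x y, x != y -> rho <= `|x - y|} ->
  (size s)%:R * rho <= v - u + rho.
Proof.
move=> rho0 uv us sI sep.
pose f x : R * R := (x, rho / 2).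
have := @packing_le_measure (map f s) `]u - rho / 2, v + rho / 2[%classic.
rewrite lebesgue_measure_oo; last by lra.
have -> : total_length (map f s) = (size s)%:R * rho.
  rewrite /total_length big_map /=; elim: s {us sI sep} => [|x s IH] /=.
    by rewrite big_nil mul0r.
  by rewrite big_cons IH -[(size s).+1%:R]natr1; field.
rewrite lee_fin => H; apply: (le_trans (H _ _ _)); last by lra.
- exact: measurable_itv.
- rewrite pairwise_map; move: us; rewrite uniq_pairwise.
  apply: (@sub_in_pairwise _ (mem s)); last exact/allP.
  move=> x y xs ys /= xy.
  by rewrite /far /= -splitr sep.
- move=> b /mapP[x xs ->] /=; split; first by lra.
  have := sI x xs => /andP[ux xv] y; rewrite /= !in_itv /= => /andP[? ?].
  by apply/andP; split; lra.
Qed.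

(** Comparing the outer measure of [F] with a nearly optimal covering by
    intervals shows that it is at most a fixed fraction of itself. *)
Lemma negligible_of_deficient (F : set R) (c : R) : 0 < c -> measurable F ->
  (forall u v, u < v -> (mu (F `&` `]u, v[%classic) <= ((1 - c) * (v - u))%:E)%E) ->
  mu F = 0%E.
Proof.
move=> c0 mF Fuv.
have c1 : 0 <= 1 - c.
  have := Fuv 0 1 ltr01; rewrite subr0 mulr1 => h.
  by have := le_trans (measure_ge0 mu _) h; rewrite lee_fin.
suff H (n : nat) : mu (F `&` `]- n%:R, n%:R[%classic) = 0%E.
  have FE : F = \bigcup_n (F `&` `]- n%:R, n%:R[%classic).
    rewrite -setI_bigcupr; apply/seteqP; split=> [x Fx|x []] //; split=> //.
    exists (Num.truncn `|x|).+1 => //=; rewrite in_itv /= -ltr_norml.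
    exact: truncnS_gt.
  apply/eqP; rewrite eq_le measure_ge0 andbT.
  have mFn (n : nat) : measurable (F `&` `]- n%:R, n%:R[%classic).
    by apply: measurableI => //; exact: measurable_itv.
  rewrite {1}FE.
  apply: (le_trans (measure_sigma_subadditive mu mFn _ (@subset_refl _ _))).
    exact: bigcupT_measurable.
  by rewrite eseries0 // => i _ _; exact: H.
set G := F `&` _; have mG : measurable G.
  by apply: measurableI => //; exact: measurable_itv.
have Guv u v : u < v -> (mu (G `&` `]u, v[%classic) <= ((1 - c) * (v - u))%:E)%E.
  move=> uv; apply: le_trans (Fuv _ _ uv); rewrite le_measure ?inE //.
  - by apply: measurableI => //; exact: measurable_itv.
  - by apply: measurableI => //; exact: measurable_itv.
  - by move=> x [[]].
have Gfin : (mu G < +oo)%E.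
  apply: (@le_lt_trans _ _ (mu `]- n%:R, n%:R[%classic)).
    by apply: le_measure; rewrite ?inE //; exact: subIsetr.
  by rewrite lebesgue_measure_oo ?ltry //; have := ler0n R n; lra.
have Gnum : mu G \is a fin_num by rewrite ge0_fin_numE.
pose g := fine (mu G).
have gE : mu G = g%:E by rewrite fineK.
have g0 : 0 <= g by rewrite fine_ge0.
rewrite gE; congr (_%:E).
suff: forall e, 0 < e -> g <= (1 - c) * (g + e).
  move=> H; apply/eqP; rewrite eq_le g0 andbT leNgt; apply/negP => gp.
  have := H (c * g / 2) _; have e0 : 0 < c * g / 2 by nra.
  by move=> /(_ e0); nra.
move=> e e0.
have outE : mu G = ((@wlength R idfun)^* G)%mu by [].
move: (Gnum); rewrite outE outer_measure_open_itv_cover => Gnum'.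
have [_ [J [Jitv GJ] <-]] := lb_ereal_inf_adherent e0 Gnum'.
rewrite -outer_measure_open_itv_cover -outE gE -EFinD => /ltW Je.
have lJ k : @wlength R idfun (J k) = mu (J k).
  by case: (Jitv k) => -[u v] -> /=; rewrite wlength_itv lebesgue_measure_itv.
have mJ k : measurable (J k).
  by case: (Jitv k) => -[u v] ->; exact: measurable_itv.
rewrite -lee_fin EFinM -gE.
apply: (@le_trans _ _ (\sum_(0 <= k <oo) mu (G `&` J k))%E).
  apply: measure_sigma_subadditive => //.
    by move=> k; apply: measurableI; [exact: mG|exact: mJ].
  by move=> x Gx; have [k _ Jx] := GJ x Gx; exists k.
apply: (@le_trans _ _ (\sum_(0 <= k <oo) (1 - c)%:E * mu (J k))%E).
  apply: lee_nneseries => // k _.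
  case: (Jitv k) => -[u v] -> /=.
  have [uv|vu] := ltP u v; last first.
    by rewrite set_itv_ge ?setI0 ?measure0 ?mule0 //= bnd_simp -leNgt.
  by rewrite lebesgue_measure_oo ?(ltW uv) // -EFinM; exact: Guv.
rewrite nneseriesZl // ?lee_wpmul2l //; first by under eq_eseriesr do rewrite -lJ.
Qed.

End Packing.
Arguments far {R}.
Arguments total_length {R}.

(** * A Khintchine theorem for regular systems *)

(** The hypotheses on the levels [L n] at the scales [t n] are those of a regular
    system of points in the sense of Baker and Schmidt, with the separation
    required across different levels too. *)
Section RegularSystem.
Variables (R : realType) (L : nat -> set R) (t : nat -> R) (kap c : R).
Local Notation mu := (@lebesgue_measure R).
Hypotheses (kap0 : 0 < kap) (c0 : 0 < c) (t0 : forall n, 0 < t n).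
Hypothesis t_small : forall e, 0 < e -> exists N, forall n, (N <= n)%N -> t n < e.
Hypothesis L_sep : forall n m a b, (n <= m)%N -> L n a -> L m b -> a != b ->
  kap * t m <= `|a - b|.
Hypothesis L_disj : forall n m a b, (n < m)%N -> L n a -> L m b -> a != b.
Hypothesis L_ubiq : forall u v, u < v -> exists N, forall n, (N <= n)%N ->
  exists s : seq R, [/\ uniq s, forall x, x \in s -> L n x /\ u <= x <= v &
    c * (v - u) <= (size s)%:R * t n].

Arguments L_sep {n m a b}.
Arguments L_disj {n m a b}.
Arguments L_ubiq {u v}.

Definition approximable (phi : nat -> R) (N : nat) : set R :=
  [set x | exists n a, [/\ (N <= n)%N, L n a & `|x - a| < phi n * t n]].

Lemma approximable_measurable phi N : measurable (approximable phi N).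
Proof.
apply: open_measurable.
have -> : approximable phi N = \bigcup_(p in [set p : nat * R |
    (N <= p.1)%N /\ L p.1 p.2])
    `]p.2 - phi p.1 * t p.1, p.2 + phi p.1 * t p.1[%classic.
  apply/seteqP; split=> [x [n [a [Nn La xa]]]|x [[n a] [/= Nn La] xa]].
    exists (n, a) => //=; rewrite in_itv /=.
    by move: xa; rewrite ltr_norml => /andP[? ?]; apply/andP; split; lra.
  exists n, a; split=> //; move: xa; rewrite /= in_itv /= => /andP[? ?].
  by rewrite ltr_norml; apply/andP; split; lra.
by apply: bigcup_open => p _; exact: interval_open.
Qed.

Section Bounded.
Variable phi : nat -> R.
Hypothesis phi0 : forall n, 0 <= phi n.
Hypothesis phi_le : forall n, phi n <= kap / 4.
Hypothesis phi_div : forall M, exists n, M <= \sum_(i < n) phi i.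

Let r n := phi n * t n.

Let r0 n : 0 <= r n. Proof. by rewrite mulr_ge0 // ltW. Qed.

Let r_le n : 4 * r n <= kap * t n.
Proof. by have := phi_le n; have := t0 n; rewrite /r; nra. Qed.

Let phi_div_from N M : exists n, M <= \sum_(i < n) phi (N + i)%N.
Proof.
have [n hn] := phi_div (M + \sum_(i < N) phi i).
exists n; have [nN|nN] := leqP n N.
  apply: (@le_trans _ _ 0); last by apply: sumr_ge0.
  have : \sum_(i < n) phi i <= \sum_(i < N) phi i.
    rewrite -(subnKC nN) big_split_ord /= lerDl; exact: sumr_ge0.
  by lra.
have : \sum_(i < n) phi i <= \sum_(i < N + n) phi i.
  by rewrite addnC big_split_ord /= lerDl; apply: sumr_ge0.
by rewrite big_split_ord /=; lra.
Qed.

Section Greedy.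
Variables (S : nat -> seq R) (N : nat).

(** Levels are processed in turn; a ball is kept when it avoids all the balls
    kept before. *)
Fixpoint greedy (j : nat) : seq (R * R) :=
  if j is j'.+1 then
    let m := (N + j')%N in
    [seq (x, r m) | x <- S m & all (far (x, r m)) (greedy j')] ++ greedy j'
  else [::].

Variables u v : R.
Hypothesis uv : u < v.
Hypothesis S_uniq : forall n, (N <= n)%N -> uniq (S n).
Hypothesis S_in : forall n, (N <= n)%N -> forall x, x \in S n -> L n x /\ u <= x <= v.
Hypothesis S_size : forall n, (N <= n)%N -> c * (v - u) <= (size (S n))%:R * t n.

Arguments S_in {n} _ {x}.
Arguments S_size {n}.

Lemma greedy_mem j b : b \in greedy j ->
  exists n, [/\ (N <= n < N + j)%N, L n b.1, b.2 = r n & u <= b.1 <= v].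
Proof.
elim: j => //= j IH; rewrite mem_cat => /orP[|/IH[n [nN Ln bn ub]]]; last first.
  by exists n; split => //; lia.
move=> /mapP[x]; rewrite mem_filter => /andP[_ xS] -> /=.
have [Lx ux] := S_in (leq_addr j N) xS.
by exists (N + j)%N; split => //; lia.
Qed.

Lemma greedy_far j : pairwise far (greedy j).
Proof.
elim: j => //= j IH; rewrite pairwise_cat IH andbT; apply/andP; split.
  apply/allrelP => _ b /mapP[x + ->] bg.
  by rewrite mem_filter => /andP[/allP/(_ _ bg)].
rewrite pairwise_map.
have us : uniq [seq x <- S (N + j)%N | all (far (x, r (N + j)%N)) (greedy j)].
  by rewrite filter_uniq // S_uniq //; lia.
move: us; rewrite uniq_pairwise.
apply: (@sub_in_pairwise _ (mem (S (N + j)%N))); last first.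
  by apply/allP => x; rewrite mem_filter => /andP[].
move=> x y xs ys /= xy.
have [Lx _] := S_in (leq_addr j N) xs.
have [Ly _] := S_in (leq_addr j N) ys.
rewrite /far /=; have := L_sep (leqnn _) Lx Ly xy.
by have := r_le (N + j)%N; have := r0 (N + j)%N; lra.
Qed.

(** By repulsion a later centre near a kept ball of radius [r] can only occur
    when [r] is not small compared with the later scale. *)
Lemma count_not_far m n b : (N <= m)%N -> (n < m)%N -> L n b.1 -> b.2 = r n ->
  (count (fun x => ~~ far (x, r m) b) (S m))%:R * (kap * t m) <= 4 * b.2.
Proof.
move=> Nm nm Lb br; rewrite -size_filter.
set s := [seq x <- S m | _].
have us : uniq s by rewrite filter_uniq // S_uniq.
have sS x : x \in s -> L m x /\ kap * t m <= `|b.1 - x| < r m + b.2.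
  rewrite mem_filter -ltNge /= => /andP[xb xS]; have [Lx _] := S_in Nm xS.
  split=> //; rewrite (L_sep (ltnW nm) Lb Lx (L_disj nm Lb Lx)) /=.
  by rewrite distrC.
have kt0 : 0 < kap * t m by rewrite mulr_gt0.
have b0 : 0 <= b.2 by rewrite br.
have [sE|[x xs]] : s = [::] \/ exists x, x \in s.
  case: (s) => [|x s']; first by left.
  by right; exists x; rewrite mem_head.
  by rewrite sE mul0r mulr_ge0.
have [_ /andP[x1 x2]] := sS x xs.
have rm := r_le m.
have := @size_separated R s (kap * t m) (b.1 - (r m + b.2)) (b.1 + (r m + b.2)) kt0.
have rm0 := r0 m.
move=> /(_ _ us) H; apply: (le_trans (H _ _ _)) => //; try lra.
  move=> y /sS[_ /andP[_]]; rewrite ltr_norml => /andP[? ?].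
  by apply/andP; split; lra.
by move=> y z /sS[Ly _] /sS[Lz _] yz; apply: L_sep Ly Lz yz.
Qed.

Lemma count_not_all_far m K : (N <= m)%N ->
  (forall b, b \in K -> exists2 n, (n < m)%N & L n b.1 /\ b.2 = r n) ->
  (count (fun x => ~~ all (far (x, r m)) K) (S m))%:R * (kap * t m) <=
  2 * total_length K.
Proof.
move=> Nm; elim: K => [|b K IH] HK /=.
  by rewrite (@eq_count _ _ pred0) // count_pred0 mul0r /total_length big_nil mulr0.
have kt0 : 0 < kap * t m by rewrite mulr_gt0.
have [n nm [Lb bn]] := HK b (mem_head _ _).
have h1 := count_not_far Nm nm Lb bn.
have h2 := IH (fun b' b'K => HK b' (mem_behead (s := b :: K) b'K)).
rewrite /total_length big_cons -/(total_length K).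
suff : (count (fun x => ~~ (far (x, r m) b && all (far (x, r m)) K)) (S m))%:R <=
  (count (fun x => ~~ far (x, r m) b) (S m))%:R +
  (count (fun x => ~~ all (far (x, r m)) K) (S m))%:R :> R by nra.
rewrite -natrD ler_nat -count_predUI.
apply: leq_trans (leq_addr _ _); apply: sub_count => x /=.
by rewrite negb_and.
Qed.

Lemma greedy_step j : total_length (greedy j) < c * kap / 4 * (v - u) ->
  total_length (greedy j) + c * (v - u) * phi (N + j)%N <=
  total_length (greedy j.+1).
Proof.
move=> small; set m := (N + j)%N.
pose s := [seq x <- S m | all (far (x, r m)) (greedy j)].
have -> : total_length (greedy j.+1) =
    \sum_(b <- [seq (x, r m) | x <- s]) 2 * b.2 + total_length (greedy j).
  by rewrite /total_length -big_cat.
rewrite addrC lerD2r.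
have Nm : (N <= m)%N by rewrite /m; lia.
rewrite big_map /= big_const_seq count_predT iter_addr_0.
have h := @count_not_all_far m (greedy j) Nm _.
have {}h : (count (fun x => ~~ all (far (x, r m)) (greedy j)) (S m))%:R * (kap * t m) <=
  2 * total_length (greedy j).
  apply: h => b /greedy_mem[n [nN Lb bn _]]; exists n => //.
  by move: nN; rewrite /m; lia.
have e : (size s + count (fun x => ~~ all (far (x, r m)) (greedy j)) (S m))%N =
   size (S m).
  by rewrite size_filter; exact: count_predC.
have := S_size Nm; rewrite -e natrD.
set x := (size s)%:R; set y := (count _ _)%:R => h2.
have y0 : 0 <= y by rewrite ler0n.
rewrite -mulr_natr -/x /r.
have h3 : y * t m <= c / 2 * (v - u).
  by rewrite -(ler_pM2r kap0); move: h; rewrite -/y; nra.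
have h4 : c / 2 * (v - u) <= x * t m by lra.
by have := phi0 m; nra.
Qed.

(** As long as the kept balls fill less than a fixed proportion of the interval,
    they spoil at most half of the centres of the next level, so that the total
    length grows by a multiple of the next term of the divergent series. *)
Lemma greedy_long : exists j, c * kap / 4 * (v - u) <= total_length (greedy j).
Proof.
have [n hn] := phi_div_from N (kap / 4).
apply: contrapT => /forallNP small.
have {}small j : total_length (greedy j) < c * kap / 4 * (v - u).
  by rewrite ltNge; apply/negP.
have : c * (v - u) * (\sum_(i < n) phi (N + i)%N) <= total_length (greedy n).
  elim: n {hn} => [|n IH]; first by rewrite big_ord0 mulr0 /total_length big_nil.
  rewrite big_ord_recr /= mulrDr; apply: le_trans (greedy_step (small n)).
  by rewrite lerD2r.
move=> h; have := small n.
have : c * (v - u) * (kap / 4) <= c * (v - u) * (\sum_(i < n) phi (N + i)%N).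
  by rewrite ler_wpM2l // mulr_ge0 // ltW // subr_gt0.
by lra.
Qed.

End Greedy.

(** The greedy selection is run with centres in the middle half of the interval,
    which leaves room for the balls around them. *)
Lemma approximable_proportion N u v : u < v ->
  ((c * kap / 8 * (v - u))%:E <= mu (approximable phi N `&` `]u, v[%classic))%E.
Proof.
move=> uv; pose l := v - u.
have l0 : 0 < l by rewrite subr_gt0.
have u'v' : u + l / 4 < v - l / 4 by rewrite /l; lra.
have [N1 H1] := L_ubiq u'v'.
have [N2 H2] := @t_small (l / kap) (divr_gt0 l0 kap0).
pose N' := maxn N (maxn N1 N2).
have /choice[S HS] : forall n, exists s, (N' <= n)%N -> [/\ uniq s,
    forall x, x \in s -> L n x /\ u + l / 4 <= x <= v - l / 4 &
    c * (v - l / 4 - (u + l / 4)) <= (size s)%:R * t n].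
  move=> n; have [Nn|nN] := leqP N' n; last by exists [::].
  by have [|s Hs] := H1 n; [lia|exists s].
have HSu n (h : (N' <= n)%N) : uniq (S n) by have [] := HS n h.
have HSi n (h : (N' <= n)%N) : forall x, x \in S n -> L n x /\ u + l / 4 <= x <= v - l / 4.
  by have [] := HS n h.
have HSs n (h : (N' <= n)%N) : c * (v - l / 4 - (u + l / 4)) <= (size (S n))%:R * t n.
  by have [] := HS n h.
have [j Hj] := greedy_long u'v' HSu HSi HSs.
apply: (@le_trans _ _ (total_length (greedy S N' j))%:E).
  by rewrite lee_fin; apply: le_trans Hj; rewrite /l; lra.
apply: packing_le_measure.
- apply: measurableI; last exact: measurable_itv.
  exact: approximable_measurable.
- exact: (greedy_far u'v' HSu HSi).
- move=> b bg; have [n [nN Lb bn ub]] := greedy_mem u'v' HSi bg.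
  rewrite bn; split=> // x /=; rewrite !in_itv /= => /andP[x1 x2]; split.
    exists n, b.1; split => //; first by move: nN; rewrite /N'; clear; lia.
    by rewrite ltr_norml; apply/andP; split; rewrite -/(r n); lra.
  have tn : t n < l / kap by apply: H2; move: nN; rewrite /N'; clear; lia.
  have : kap * t n < l by rewrite mulrC -ltr_pdivlMr.
  by have := r_le n; move=> ? ?; apply/andP; split; lra.
Qed.

Lemma approximable_full N : mu (~` approximable phi N) = 0%E.
Proof.
have mA := approximable_measurable phi N.
apply: (@negligible_of_deficient R _ (c * kap / 8)); first by rewrite divr_gt0 ?mulr_gt0.
  exact: measurableC.
move=> u v uv; set I := `]u, v[%classic.
have mI : measurable (I : set R) by exact: measurable_itv.
have low := approximable_proportion N uv.
have e : mu I = (mu (I `\` approximable phi N) + mu (I `&` approximable phi N))%E.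
  exact: measureDI.
have IE : mu I = (v - u)%:E by rewrite lebesgue_measure_oo // ltW.
rewrite setIC -setDE.
move: low; rewrite setIC -/I => low.
have fin : mu (I `&` approximable phi N) \is a fin_num.
  rewrite ge0_fin_numE // (@le_lt_trans _ _ (mu I)) ?IE ?ltry //.
  by rewrite -IE; apply: le_measure; rewrite ?inE //; exact: measurableI.
have -> : mu (I `\` approximable phi N) = ((v - u)%:E - mu (I `&` approximable phi N))%E.
  by rewrite -IE e addeK.
by move: low; rewrite -(fineK fin) -EFinB !lee_fin; lra.
Qed.

End Bounded.

(** Khintchine's theorem for a regular system: truncating the radii to a small
    fraction of the scale keeps the series divergent. *)
Theorem regular_system_khintchine (phi : nat -> R) : (forall n, 0 <= phi n) ->
  (forall M, exists n, M <= \sum_(i < n) phi i) ->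
  {ae mu, forall x, forall N, exists n a,
    [/\ (N <= n)%N, L n a & `|x - a| < phi n * t n]}.
Proof.
move=> phi0 phi_div.
pose psi n := Num.min (phi n) (kap / 4).
have k4 : 0 < kap / 4 by rewrite divr_gt0.
have psi0 n : 0 <= psi n by rewrite le_min phi0 ltW.
have psi_le n : psi n <= kap / 4 by rewrite ge_min lexx orbT.
have psi_phi n : psi n <= phi n by rewrite ge_min lexx.
have psi_div M : exists n, M <= \sum_(i < n) psi i.
  apply: contrapT => /forallNP bd.
  have {}bd n : \sum_(i < n) psi i <= M by rewrite ltW // ltNge; apply/negP.
  have cv : cvgn (series psi).
    apply: nondecreasing_is_cvgn.
      apply/nondecreasing_seqP => n.
      by rewrite /series /= big_nat_recr //= lerDl.
    by exists M => _ [n _ <-]; rewrite /series /= big_mkord.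
  have /cvgrPdist_lt /(_ _ k4) [N0 _ HN0] := cvg_series_cvg_0 cv.
  have psiE n : (N0 <= n)%N -> psi n = phi n.
    move=> /HN0 /=; rewrite sub0r normrN ger0_norm // /psi.
    by case: (ltP (phi n) (kap / 4)) => // _; rewrite ltxx.
  have [n hn] := phi_div (M + \sum_(i < N0) phi i + 1).
  have : \sum_(i < n) phi i <= \sum_(i < n) psi i + \sum_(i < N0) phi i.
    elim: n {hn} => [|n IH]; first by rewrite !big_ord0 add0r sumr_ge0.
    have [nN|Nn] := leqP N0 n.
      by rewrite !big_ord_recr /= psiE //; lra.
    have -> : N0 = (n.+1 + (N0 - n.+1))%N by rewrite subnKC.
    rewrite [X in _ <= _ + X]big_split_ord /= addrA addrAC lerDr.
    by rewrite addr_ge0 // sumr_ge0.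
  by have := bd n; lra.
have : mu.-negligible (\bigcup_N ~` approximable psi N).
  apply: negligible_bigcup => N; apply/negligibleP.
    by apply: measurableC; exact: approximable_measurable.
  exact: approximable_full.
apply: negligibleS => x /= /existsNP[N hN]; exists N => //= -[n [a [Nn La xa]]].
apply: hN; exists n, a; split=> //; apply: lt_le_trans xa _.
by rewrite ler_wpM2r // ltW.
Qed.

End RegularSystem.

(** * The orbit is a regular system *)

Lemma int_le_nat (m n : int) : m <= n -> exists i : nat, n = m + i%:Z.
Proof. by move=> mn; exists `|(n - m)%R|%N; lia. Qed.

Section SmallDenominators.
Variable R : realType.
Implicit Types u v x : R.

Lemma harmonic_sum_small (d : R) : 0 < d -> exists N0, forall N, (N0 <= N)%N ->
  \sum_(0 <= q < N) q.+1%:R^-1 <= d * N%:R.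
Proof.
move=> d0; have /cvgrPdist_lt /(_ _ d0) [N0 _ H] := cesaro (@cvg_harmonic R).
exists N0.+1 => -[//|N] NN; have /= := H N NN.
have s0 : 0 <= \sum_(0 <= q < N.+1) q.+1%:R^-1 :> R by apply: sumr_ge0.
rewrite sub0r normrN ger0_norm; last by rewrite mulr_ge0.
by rewrite ltr_pdivrMl ?ltr0n // mulrC => /ltW.
Qed.

(** These balls contain the points of the interval which have a Dirichlet
    approximation with denominator at most [N / 8]. The numerators start one
    below [q * u] rounded down, to account for fractions outside the interval. *)
Definition small_denominator_balls u v (N : nat) : seq (R * R) :=
  [seq (((Num.floor (q%:R * u))%:~R - 1 + i%:R) / q%:R, (q%:R * N%:R)^-1)
    | q <- iota 1 (N %/ 8), i <- iota 0 (Num.truncn (q%:R * (v - u)) + 4)].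

Lemma small_denominator_balls_length u v : u < v -> exists N0, forall N,
  (N0 <= N)%N -> total_length (small_denominator_balls u v N) <= (v - u) / 2.
Proof.
move=> uv; have d0 : 0 < (v - u) / 32 by lra.
have [N0 H] := harmonic_sum_small d0.
exists N0.+1 => N N0N; have N1 : 1 <= N%:R :> R by rewrite ler1n; lia.
have {}H := H N (ltnW N0N).
rewrite /total_length big_allpairs_dep /=.
apply: (@le_trans _ _ (\sum_(q <- iota 1 (N %/ 8)) (2 * (v - u) / N%:R +
    8 / N%:R * q%:R^-1))).
  rewrite !big_seq; apply: ler_sum => q; rewrite mem_iota => /andP[q1 _].
  have qR : 1 <= q%:R :> R by rewrite ler1n.
  rewrite big_const_seq count_predT size_iota iter_addr_0 -(mulr_natr (2 * _)) natrD.
  have tr : (Num.truncn (q%:R * (v - u)))%:R <= q%:R * (v - u).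
    by rewrite truncn_le // mulr_ge0 //; lra.
  have -> : 2 * (v - u) / N%:R + 8 / N%:R * q%:R^-1 =
     2 * (q%:R * N%:R)^-1 * (q%:R * (v - u) + 4).
    by field; apply/andP; split; rewrite gt_eqF //; lra.
  rewrite ler_wpM2l ?lerD2r // mulr_ge0 // invr_ge0; nra.
rewrite big_split /= big_const_seq count_predT size_iota iter_addr_0 -(mulr_natr (_ / _)).
have le8 : (N %/ 8)%:R <= N%:R / 8 :> R.
  by rewrite ler_pdivlMr // -natrM ler_nat leq_trunc_div.
rewrite -mulr_sumr.
have le1 : \sum_(q <- iota 1 (N %/ 8)) q%:R^-1 <= \sum_(0 <= q < N) q.+1%:R^-1 :> R.
  have -> : iota 1 (N %/ 8) = map S (iota 0 (N %/ 8)) by rewrite -(iotaDl 1).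
  rewrite big_map; have -> : iota 0 (N %/ 8) = index_iota 0 (N %/ 8).
    by rewrite /index_iota subn0.
  by rewrite [leRHS](big_cat_nat (n := N %/ 8)) ?leq_div //= lerDl sumr_ge0.
have le2 := le_trans le1 H.
have -> : (v - u) / 2 = 2 * (v - u) / N%:R * (N%:R / 8) + 8 / N%:R * ((v - u) / 32 * N%:R).
  by field; rewrite gt_eqF //; lra.
by apply: lerD; apply: ler_wpM2l => //; rewrite divr_ge0 //; lra.
Qed.

Lemma small_denominator_balls_cover u v (N : nat) x (p q : int) : (0 < N)%N ->
  u <= x <= v -> 1 <= q -> 8 * q <= N%:Z -> `|q%:~R * x - p%:~R| * N%:R <= 1 ->
  exists2 b, b \in small_denominator_balls u v N & `|x - b.1| <= b.2.
Proof.
move=> N0 /andP[ux xv] q1 qN h.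
have N1 : 1 <= N%:R :> R by rewrite ler1n.
have [k qE] : exists k : nat, q = k%:Z by exists `|q|%N; lia.
subst q; rewrite -[k%:Z%:~R]/(k%:R) in h.
have k1 : 1 <= k%:R :> R by rewrite ler1n; lia.
have hp : `|k%:R * x - p%:~R| <= 1.
  by apply: le_trans h; rewrite ler_peMr.
pose f := Num.floor (k%:R * u).
have f1 : f%:~R <= k%:R * u by rewrite floor_le.
have f2 : k%:R * u < (f + 1)%:~R by rewrite lt_succ_floor.
have kux : k%:R * u <= k%:R * x by rewrite ler_pM2l //; lra.
have kxv : k%:R * x <= k%:R * v by rewrite ler_pM2l //; lra.
move: (hp); rewrite ler_norml => /andP[hp1 hp2].
have pf : f - 1 <= p.
  by rewrite -(ler_int R) rmorphB /=; lra.
have [i iE] := int_le_nat pf.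
have iR : p%:~R = f%:~R - 1 + i%:R :> R by rewrite iE rmorphD rmorphB.
exists ((f%:~R - 1 + i%:R) / k%:R, (k%:R * N%:R)^-1).
  apply/allpairsPdep; exists k, i.
  have kN : k \in iota 1 (N %/ 8).
    by rewrite mem_iota add1n ltnS leq_divRL //; move: q1 qN; clear; lia.
  split; [exact: kN| |reflexivity].
  rewrite mem_iota leq0n add0n /= -(ltr_nat R) natrD.
  have := truncnS_gt (k%:R * (v - u)); rewrite -natr1 => h1.
  rewrite rmorphD /= in f2; lra.
rewrite /= -iR.
have -> : x - p%:~R / k%:R = (k%:R * x - p%:~R) / k%:R by field; rewrite gt_eqF //; lra.
rewrite normrM normfV (@ger0_norm _ k%:R); last by lra.
have hN : `|k%:R * x - p%:~R| <= (N%:R)^-1.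
  by rewrite -div1r ler_pdivlMr //; lra.
rewrite invfM mulrC; apply: ler_wpM2l hN; rewrite invr_ge0; lra.
Qed.

(** By Dirichlet every point lies near a fraction of denominator at most [N];
    the points for which this denominator is smaller than [N / 8] fill at most
    half of the interval. *)
Lemma large_denominators_cover u v : u < v -> exists N0, forall N, (N0 <= N)%N ->
  forall (s : seq R) (rho : R), 0 <= rho ->
  (forall x (p q r s' : int), u <= x <= v -> p * s' - r * q = 1 -> 1 <= q <= N%:Z ->
     N%:Z < 8 * q -> `|q%:~R * x - p%:~R| * N%:R <= 1 ->
     exists2 a, a \in s & `|x - a| <= rho) ->
  (v - u) / 2 <= (size s)%:R * (2 * rho).
Proof.
move=> uv; have [N0 H] := small_denominator_balls_length uv.
exists N0.+1 => N NN s rho rho0 Hs; have {}H := H N (ltnW NN).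
have N1 : (0 < N)%N by lia.
have := @measure_le_covering R (small_denominator_balls u v N ++
   [seq (a, rho) | a <- s]) `[u, v]%classic (measurable_itv _).
rewrite lebesgue_measure_cc ?(ltW uv) // /total_length big_cat /= big_map /=.
rewrite big_const_seq count_predT iter_addr_0 lee_fin => Hm.
have : v - u <= total_length (small_denominator_balls u v N) + (2 * rho) *+ size s.
  apply: Hm.
    move=> b; rewrite mem_cat => /orP[/allpairsPdep[q [i [_ _ ->]]]|/mapP[a _ ->]] //=.
  move=> x; rewrite /= in_itv /= => xuv.
  have [p [q [r [s' [det /andP[q1 qN] h]]]]] := dirichlet x N1.
  have [q8|q8] := leP (8 * q) N%:Z.
    have [b bs xb] := small_denominator_balls_cover N1 xuv q1 q8 h.
    by exists b => //; rewrite mem_cat bs.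
  have [a as_ xa] := Hs x p q r s' xuv det (introT andP (conj q1 qN)) q8 h.
  exists (a, rho) => //; rewrite mem_cat; apply/orP; right.
  by apply/mapP; exists a.
by rewrite -mulr_natl; lra.
Qed.

End SmallDenominators.

Section OrbitLevels.
Variables (R : realType) (alpha0 : R).
Hypothesis halpha0 : quadratic_irrational alpha0.
Local Notation E := (quad_orbit alpha0).
Local Notation sg := (@galois_conj R).

(** By repulsion the points counted here are separated. *)
Lemma finite_orbit_level (u v t : R) : 0 < t ->
  finite_set [set a | [/\ E a, t <= `|a - sg a| & u <= a <= v]].
Proof.
move=> t0; have [kap kap0 Hk] := quad_orbit_repulsion halpha0.
apply: contrapT => /(@infinite_set_fset _ _ (Num.truncn ((v - u) / (kap * t)) + 2)).
move=> [B BE Bn].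
have kt0 : 0 < kap * t by rewrite mulr_gt0.
have [x0 x0B] : exists x, x \in B.
  by apply/fset0Pn; rewrite -cardfs_gt0; lia.
have uv : u <= v by have [_ _ /andP[]] := BE _ x0B; apply: le_trans.
have := @size_separated R (enum_fset B) (kap * t) u v kt0 uv (fset_uniq B).
move=> H; have {}H := H (fun x xB => let: And3 _ _ h := BE _ xB in h).
have {}H : (#|` B|)%:R * (kap * t) <= v - u + kap * t.
  apply: H => x y /BE[Ex tx _] /BE[Ey ty _] xy; exact: Hk.
have n1 : (Num.truncn ((v - u) / (kap * t)) + 2)%:R <= (#|` B|)%:R :> R.
  by rewrite ler_nat.
have n2 := truncnS_gt ((v - u) / (kap * t)).
have n3 : (v - u) / (kap * t) + 1 < (#|` B|)%:R.
  by apply: lt_le_trans n1; rewrite addn2 -natr1 ltrD2r.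
move: n3; rewrite -ltrBrDr ltr_pdivrMr //; lra.
Qed.

(** The levels are made disjoint by taking the ratio of the scales larger than
    the ratio [M] of the widths inside one level. Separation is repulsion, and
    ubiquity comes from the points of the orbit near fractions whose
    denominators are between [N / 8] and [N]. *)
Lemma orbit_regular_system : exists (M kap c K : R) (T : nat),
  [/\ 1 < M, 0 < kap, 0 < c, 1 <= K & (1 < T)%N] /\
  let t n : R := (K * T%:R ^+ n)^-1 in
  let L n := [set a | [/\ E a, t n <= `|a - sg a| & `|a - sg a| < M * t n]] in
  [/\ forall n m a b, (n <= m)%N -> L n a -> L m b -> a != b ->
        kap * t m <= `|a - b|,
      forall n m a b, (n < m)%N -> L n a -> L m b -> a != b &
      forall u v, u < v -> exists N, forall n, (N <= n)%N ->
        exists s : seq R, [/\ uniq s, forall x, x \in s -> L n x /\ u <= x <= v &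
          c * (v - u) <= (size s)%:R * t n]].
Proof.
have [K K1 HK] := orbit_near_fraction halpha0; have K0 : 0 < K := lt_le_trans ltr01 K1.
have [kap kap0 Hk] := quad_orbit_repulsion halpha0.
pose M := 64 * K ^+ 2 + 1.
have M2 : 1 < M by rewrite /M; nra.
have [th thM] : exists th : nat, M < th%:R.
  by exists (Num.truncn M).+1; apply: truncnS_gt.
have th1 : (1 < th)%N.
  by rewrite -(ltr_nat R); apply: lt_trans thM.
pose t n : R := (K * (th ^ 2)%:R ^+ n)^-1.
have T0 : 0 < (th ^ 2)%:R :> R by rewrite ltr0n expn_gt0; lia.
have t0 n : 0 < t n by rewrite invr_gt0 mulr_gt0 ?exprn_gt0 //; lra.
have tS n : M * t n.+1 < t n.
  rewrite /t exprS mulrCA invfM mulrA -ltr_pdivlMr ?invr_gt0; last first.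
    by rewrite mulr_gt0 ?exprn_gt0 //; lra.
  rewrite divff ?invr_eq0 ?gt_eqF ?mulr_gt0 ?exprn_gt0 //; try lra.
  rewrite ltr_pdivrMr // mul1r; apply: (lt_le_trans thM).
  by rewrite ler_nat -mulnn leq_pmulr //; lia.
have t_le n m : (n <= m)%N -> t m <= t n.
  move=> /subnKC <-; elim: (m - n)%N => [|k IH]; first by rewrite addn0.
  by apply: le_trans IH; rewrite addnS; have := tS (n + k)%N; have := t0 (n + k).+1; nra.
exists M, kap, (1 / (576 * K)), K, (th ^ 2)%N; split.
  have c0 : 0 < 1 / (576 * K) by rewrite div1r invr_gt0; lra.
  have T1 : (1 < th ^ 2)%N by rewrite -[1%N](exp1n 2) ltn_exp2r.
  by split.
split.
- move=> n m a b nm [Ea ta _] [Eb tb _] ab.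
  exact: (Hk a b (t m) Ea Eb ab (t0 m) (le_trans (t_le _ _ nm) ta) tb).
- move=> n m a b nm [_ ta _] [_ _ tb]; apply/eqP => e; rewrite e in ta.
  have := t_le _ _ nm; have := tS n => h1 h2.
  by move: (lt_le_trans tb (ler_wpM2l (ltW (lt_trans ltr01 M2)) h2)); rewrite /t in h1 ta *; lra.
move=> u v uv; pose l := v - u.
have l0 : 0 < l by rewrite subr_gt0.
have u'v' : u + l / 4 < v - l / 4 by rewrite /l; lra.
have [N0 HN0] := large_denominators_cover u'v'.
have [N1 HN1] : exists N1 : nat, 288 / l < N1%:R.
  by exists (Num.truncn (288 / l)).+1; apply: truncnS_gt.
exists (N0 + N1)%N => n Nn.
pose N := (th ^ n)%N.
have nN : (n < N)%N by exact: ltn_expl.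
have NN1 : 288 / l < N%:R.
  apply: (lt_trans HN1); rewrite ltr_nat; apply: (leq_ltn_trans _ nN).
  exact: (leq_trans (leq_addl _ _) Nn).
have NR1 : 1 <= N%:R :> R by rewrite ler1n; exact: (leq_ltn_trans _ nN).
have tE : t n = (K * N%:R ^+ 2)^-1.
  by rewrite /t /N !natrX -!exprM mulnC.
have /finite_seqP[s sE] := finite_orbit_level u v (t0 n).
pose s' := undup [seq a <- s | `|a - sg a| < M * t n].
have s'P x : x \in s' <-> [/\ E x, t n <= `|x - sg x|, `|x - sg x| < M * t n & u <= x <= v].
  have -> : x \in s' = (`|x - sg x| < M * t n) && (x \in s).
    by rewrite mem_undup mem_filter.
  have : [set` s] x <-> [/\ E x, t n <= `|x - sg x| & u <= x <= v] by rewrite -sE.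
  move=> /= [h1 h2]; split => [/andP[h3 /h1[? ? ?]]//|[? ? h3 ?]].
  by rewrite h3 h2.
exists s'; split; first exact: undup_uniq.
  by move=> x /s'P[].
have rho0 : 0 <= 72 / N%:R ^+ 2 :> R by rewrite divr_ge0 // exprn_ge0.
have N20 : 0 < N%:R ^+ 2 :> R by rewrite exprn_gt0 // (lt_le_trans ltr01 NR1).
have := HN0 N _ s' (72 / N%:R ^+ 2) rho0.
move=> /(_ _ _) H; have {}H : (v - l / 4 - (u + l / 4)) / 2 <= (size s')%:R * (2 * (72 / N%:R ^+ 2)).
  apply: H; first exact: (ltnW (leq_ltn_trans (leq_trans (leq_addr _ _) Nn) nN)).
  move=> x p q r s0 /andP[ux xv] det /andP[q1 qN] q8 h.
  have [a [Ea a1 a2 a3]] := HK p q r s0 det q1.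
  have q1R : 1 <= q%:~R :> R by rewrite ler1z.
  have q0R : 0 < q%:~R :> R := lt_le_trans ltr01 q1R.
  have qNR : q%:~R <= N%:R :> R by rewrite -[N%:R]/(N%:Z%:~R) ler_int.
  have q8R : N%:R < 8 * q%:~R :> R.
    by rewrite -[N%:R]/(N%:Z%:~R) -[8]/(8%:Z%:~R) -rmorphM /= ltr_int.
  have q20 : 0 < q%:~R ^+ 2 :> R by rewrite exprn_gt0.
  have qN2 : q%:~R ^+ 2 <= N%:R ^+ 2 :> R by rewrite lerXn2r ?nnegrE // ltW.
  have Nq2 : N%:R ^+ 2 <= 64 * q%:~R ^+ 2 :> R.
    have -> : 64 * q%:~R ^+ 2 = (8 * q%:~R) ^+ 2 :> R by ring.
    by rewrite lerXn2r ?nnegrE // ltW // mulr_gt0.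
  have w0 : 0 < `|a - sg a| := quad_orbit_width_gt0 halpha0 Ea.
  have xpq : `|x - p%:~R / q%:~R| * N%:R ^+ 2 <= 8.
    have -> : x - p%:~R / q%:~R = (q%:~R * x - p%:~R) / q%:~R.
      by field; rewrite gt_eqF.
    rewrite normrM normfV (gtr0_norm q0R).
    rewrite mulrAC ler_pdivrMr //.
    by rewrite expr2 mulrA; move: h; set y := _ * N%:R; clear -NR1 q8R; nra.
  have apq : `|a - p%:~R / q%:~R| * N%:R ^+ 2 <= 64.
    by have := normr_ge0 (a - p%:~R / q%:~R); clear -a1 Nq2; nra.
  have xa : `|x - a| <= 72 / N%:R ^+ 2.
    rewrite ler_pdivlMr //.
    have := ler_distD (p%:~R / q%:~R) x a; rewrite (distrC (p%:~R / q%:~R)) => tri.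
    have := ler_wpM2r (ltW N20) tri; rewrite mulrDl; clear -xpq apq; lra.
  have rl : 72 / N%:R ^+ 2 <= l / 4.
    rewrite ler_pdivrMr //; move: NN1; rewrite ltr_pdivrMr // => NN1.
    by rewrite expr2; clear -NN1 NR1 l0; nra.
  exists a => //; apply/s'P; split=> //.
  - rewrite tE -div1r ler_pdivrMr; last by rewrite mulr_gt0.
    by apply: (le_trans a2); rewrite mulrCA ler_pM2l // ler_pM2l.
  - rewrite tE ltr_pdivlMr; last by rewrite mulr_gt0.
    apply: (@le_lt_trans _ _ (64 * K ^+ 2)); last by rewrite /M ltrDl.
    have -> : 64 * K ^+ 2 = K * (64 * K) by ring.
    rewrite mulrCA ler_pM2l //.
    by apply: (le_trans (ler_wpM2l (ltW w0) Nq2)); rewrite mulrCA ler_pM2l.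
  - move: xa; rewrite ler_norml => /andP[x1 x2].
    by clear -ux xv rl x1 x2; apply/andP; split; lra.
rewrite -[X in _ <= _ * X]/(t n) tE -/l.
have {}H : l / 576 <= (size s')%:R * (N%:R ^+ 2)^-1.
  by move: H; set z := (N%:R ^+ 2)^-1; rewrite /l; clear -uv; lra.
have -> : 1 / (576 * K) * l = K^-1 * (l / 576) by field; rewrite gt_eqF.
have -> : (size s')%:R * (K * N%:R ^+ 2)^-1 = K^-1 * ((size s')%:R * (N%:R ^+ 2)^-1).
  by rewrite invfM mulrCA.
by rewrite ler_pM2l // invr_gt0.
Qed.

End OrbitLevels.

(** * Lower limits along the orbit and logarithmically Lipschitz maps *)

Section LiminfOrbit.
Variables (R : realType) (alpha0 : R).
Local Notation E := (quad_orbit alpha0).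
Local Notation sg := (@galois_conj R).
Implicit Types (f : R -> R) (c e l : R).

Let small_sets_filter e : 0 < e ->
  small_orbit_filter alpha0 [set a | E a /\ `|a - sg a| < e].
Proof. by move=> e0; exists e. Qed.

Lemma liminf_orbit_ge f c e : 0 < e ->
  (forall a, E a -> `|a - sg a| < e -> c <= f a) ->
  (c%:E <= liminf_orbit alpha0 f)%E.
Proof.
move=> e0 H; rewrite /liminf_orbit limf_einfE.
apply: le_ereal_sup_tmp => /=.
exists (ereal_inf ((fun a => (f a)%:E) @` [set a | E a /\ `|a - sg a| < e])).
  by exists [set a | E a /\ `|a - sg a| < e] => //; exact: small_sets_filter.
by apply: le_ereal_inf_tmp => _ [a [Ea ae] <-]; rewrite lee_fin H.
Qed.

Lemma liminf_orbit_le f c :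
  (forall e, 0 < e -> exists a, [/\ E a, `|a - sg a| < e & f a <= c]) ->
  (liminf_orbit alpha0 f <= c%:E)%E.
Proof.
move=> H; rewrite /liminf_orbit limf_einfE.
apply: ge_ereal_sup => _ [V [e e0 eV] <-].
have [a [Ea ae fc]] := H e e0.
apply: ge_ereal_inf; exists (f a)%:E; last by rewrite lee_fin.
by exists a => //; apply: eV.
Qed.

Lemma liminf_orbit_gt f c : (c%:E < liminf_orbit alpha0 f)%E ->
  exists2 e, 0 < e & forall a, E a -> `|a - sg a| < e -> c <= f a.
Proof.
rewrite /liminf_orbit limf_einfE => /ereal_sup_gt[_ [V [e e0 eV] <-] cV].
exists e => // a Ea ae; rewrite -lee_fin; apply: (le_trans (ltW cV)).
by apply: ereal_inf_lbound; exists a => //; apply: eV.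
Qed.

Lemma liminf_orbit_lt f c e : (liminf_orbit alpha0 f < c%:E)%E -> 0 < e ->
  exists a, [/\ E a, `|a - sg a| < e & f a < c].
Proof.
rewrite /liminf_orbit limf_einfE => lc e0.
pose V := [set a | E a /\ `|a - sg a| < e].
have : (ereal_inf ((fun a => (f a)%:E) @` V) < c%:E)%E.
  apply: le_lt_trans lc; apply: ereal_sup_ubound.
  by exists V => //; exact: small_sets_filter.
by move=> /ereal_inf_lt[_ [a [Ea ae] <-]]; rewrite lte_fin => fc; exists a.
Qed.

Lemma liminf_orbit_eqP f l : (liminf_orbit alpha0 f = l%:E) <->
  (forall d, 0 < d -> exists2 e, 0 < e &
     forall a, E a -> `|a - sg a| < e -> l - d <= f a) /\
  (forall d e, 0 < d -> 0 < e ->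
     exists a, [/\ E a, `|a - sg a| < e & f a <= l + d]).
Proof.
split=> [fl|[H1 H2]].
  split=> [d d0|d e d0 e0].
    by apply: liminf_orbit_gt; rewrite fl lte_fin; lra.
  have [|a [Ea ae fa]] := @liminf_orbit_lt f (l + d) e _ e0.
    by rewrite fl lte_fin; lra.
  by exists a; split => //; exact: ltW.
apply/eqP; rewrite eq_le; apply/andP; split.
  apply/lee_addgt0Pr => d d0; rewrite -EFinD; apply: liminf_orbit_le => e e0.
  exact: H2.
apply/lee_subgt0Pr => d d0; have [e e0 He] := H1 d d0.
by rewrite -EFinB; apply: liminf_orbit_ge e0 He.
Qed.

Lemma liminf_orbit_eqyP f :
  (forall c, exists2 e, 0 < e & forall a, E a -> `|a - sg a| < e -> c <= f a) ->
  liminf_orbit alpha0 f = +oo%E.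
Proof.
move=> H; apply/eqyP => c c0; have [e e0 He] := H c.
exact: liminf_orbit_ge e0 He.
Qed.

End LiminfOrbit.

Section LogLipschitz.
Variables (R : realType) (psi : R -> R).
Hypothesis psi0 : forall t, 0 < t -> 0 < psi t.
Hypothesis psi_lip : lipschitz (fun t : R => ln (psi (expR (- t)))).

Lemma log_lipschitz_bound : exists2 Lam : R, 0 <= Lam &
  forall x y, `|ln (psi (expR (- x))) - ln (psi (expR (- y)))| <= Lam * `|x - y|.
Proof.
move: psi_lip; rewrite /lipschitz_on => H.
have [Lam [Lam0 HL]] : exists Lam : R, 0 <= Lam /\ dominated_by (self_sub id) Lam
  (self_sub (fun t : R => ln (psi (expR (- t)))) : R * R -> R) (globally (setT `*` setT)).
  by near (pinfty_nbhs R) => Lam; exists Lam; split; near: Lam => //; exact: nbhs_pinfty_ge.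
by exists Lam => // x y; apply: (HL (x, y)).
Unshelve. all: by end_near. Qed.

(** A logarithmic Lipschitz bound says that [psi] is multiplicatively constant
    up to a bounded factor on scales of bounded ratio. *)
Lemma log_lipschitz_doubling (m : R) : 1 <= m -> exists2 C : R, 1 <= C &
  forall s t, 0 < s -> 0 < t -> s <= m * t -> t <= m * s -> psi s <= C * psi t.
Proof.
move=> m1; have [Lam L0 H] := log_lipschitz_bound.
have lm0 : 0 <= ln m by rewrite ln_ge0.
exists (expR (Lam * ln m)) => [|s t s0 t0 st ts].
  by rewrite -expR0 ler_expR mulr_ge0.
have := H (- ln s) (- ln t); rewrite !opprK !lnK ?posrE // => h.
have h2 : `|- ln s + ln t| <= ln m.
  rewrite addrC ler_norml; apply/andP; split.
    rewrite lerNl opprB -ln_div ?posrE // ler_ln ?posrE ?divr_gt0 //; last by lra.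
    by rewrite ler_pdivrMr.
  rewrite -ln_div ?posrE // ler_ln ?posrE ?divr_gt0 //; last by lra.
  by rewrite ler_pdivrMr.
have h3 : ln (psi s) - ln (psi t) <= Lam * ln m.
  exact: (le_trans (ler_norm _) (le_trans h (ler_wpM2l L0 h2))).
rewrite -[psi s]lnK ?posrE ?psi0 // -[psi t]lnK ?posrE ?psi0 // -expRD ler_expR.
by lra.
Qed.

Lemma log_lipschitz_measurable : measurable_fun (`]0, +oo[%classic : set R) psi.
Proof.
have [Lam L0 H] := log_lipschitz_bound.
pose g (t : R) : R := ln (psi (expR (- t))).
have cg : continuous g.
  move=> x; apply/cvgrPdist_le => e e0.
  near=> y; apply: (le_trans (H x y)).
  have : `|x - y| <= e / (Lam + 1).
    near: y; apply: cvgr_dist_le; first exact: cvg_id.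
    by rewrite divr_gt0 //; lra.
  rewrite ler_pdivlMr; last by lra.
  by have := normr_ge0 (x - y); nra.
apply: (eq_measurable_fun (fun t => expR (g (- ln t)))).
  move=> t; rewrite inE /= in_itv /= andbT => t0.
  by rewrite /g opprK !lnK ?posrE ?psi0.
apply: measurable_funTS.
apply: (measurableT_comp (f := expR)); first exact: measurable_expR.
apply: (measurableT_comp (f := g)).
  exact: continuous_measurable_fun.
  by apply: measurable_funN; exact: measurable_ln.
Unshelve. all: by end_near. Qed.

End LogLipschitz.

(** * Comparison of the integral with a series over geometric scales *)

Section GeometricScales.
Variables (R : realType) (psi : R -> R) (K : R) (T : nat).
Local Notation mu := (@lebesgue_measure R).
Hypothesis psi0 : forall t, 0 < t -> 0 < psi t.
Hypothesis psi_lip : lipschitz (fun t : R => ln (psi (expR (- t)))).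
Hypotheses (K1 : 1 <= K) (T1 : (1 < T)%N).

Definition scale n : R := (K * T%:R ^+ n)^-1.

Lemma scale_gt0 n : 0 < scale n.
Proof.
by rewrite invr_gt0 mulr_gt0 ?exprn_gt0 ?ltr0n //; [move: K1; lra | lia].
Qed.

Lemma scaleS n : scale n.+1 * T%:R = scale n.
Proof.
have T0 : T%:R != 0 :> R by rewrite pnatr_eq0; lia.
have K0 : K != 0 by rewrite gt_eqF //; move: K1; lra.
by rewrite /scale exprS; field; rewrite K0 T0 expf_neq0.
Qed.

Lemma scale_lt n : scale n.+1 < scale n.
Proof. by rewrite -(scaleS n) ltr_pMr ?ltr1n // scale_gt0. Qed.

Lemma scale_le n m : (n <= m)%N -> scale m <= scale n.
Proof.
move=> /subnKC <-; elim: (m - n)%N => [|k IH]; first by rewrite addn0.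
by apply: le_trans IH; rewrite addnS ltW // scale_lt.
Qed.

Lemma scale_small e : 0 < e -> exists N, forall n, (N <= n)%N -> scale n < e.
Proof.
move=> e0; have [N HN] : exists N : nat, e^-1 < N%:R.
  by exists (Num.truncn e^-1).+1; exact: truncnS_gt.
exists N => n Nn; rewrite /scale -[e]invrK ltf_pV2 ?posrE ?invr_gt0 //; last first.
  by have := scale_gt0 n; rewrite invr_gt0.
apply: (lt_le_trans HN); apply: (@le_trans _ _ (T%:R ^+ n)).
  rewrite -natrX ler_nat (leq_trans Nn) // ltnW // ltn_expl //.
by rewrite ler_peMl // exprn_ge0.
Qed.

Let cut k : R := if k is k'.+1 then scale k' else 1.
Let piece k : set R := `[cut k.+1, cut k[%classic.
Let m : R := K * T%:R.

Let m1 : 1 <= m.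
Proof. by have : 1 <= T%:R :> R by [rewrite ler1n; lia]; rewrite /m; move: K1; nra. Qed.

Let cut0 k : 0 < cut k. Proof. by case: k => //= k; exact: scale_gt0. Qed.

Let cutS k : cut k.+1 <= cut k.
Proof.
case: k => [|k] /=; last by rewrite ltW ?scale_lt.
by rewrite /scale expr0 mulr1 invf_le1 //; move: K1; lra.
Qed.

Let cut_ratio k : cut k <= m * cut k.+1.
Proof.
have T2 : 1 <= T%:R :> R by rewrite ler1n; lia.
case: k => [|k] /=.
  rewrite /scale expr0 mulr1 /m mulrAC divff ?mul1r // gt_eqF //; move: K1; lra.
rewrite -(scaleS k) /m [leRHS]mulrC; apply: ler_wpM2l; first exact: (ltW (scale_gt0 _)).
by rewrite ler_peMl //; lra.
Qed.

Let cut_le i j : (i <= j)%N -> cut j <= cut i.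
Proof.
move=> /subnKC <-; elim: (j - i)%N => [|k IH]; first by rewrite addn0.
by apply: le_trans IH; rewrite addnS cutS.
Qed.

Let bigcup_piece : `]0, 1[%classic = \bigcup_k piece k.
Proof.
apply/seteqP; split=> [x|x [k _]] /=; rewrite !in_itv /=; last first.
  move=> /andP[h1 h2]; apply/andP; split; first exact: (lt_le_trans (cut0 _) h1).
  exact: (lt_le_trans h2 (cut_le (leq0n k))).
move=> /andP[x0 x1]; have [N HN] := scale_small x0.
have [k kx kmin] := ex_minnP (P := fun k => cut k <= x) (ex_intro _ N.+1 (ltW (HN N (leqnn N)))).
case: k kx kmin => [|k] kx kmin; first by move: kx x1; rewrite /= => /le_lt_trans h /h; rewrite ltxx.
exists k => //; rewrite /piece /= in_itv /= kx /= ltNge; apply/negP => /kmin.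
by rewrite ltnn.
Qed.

Let triv_piece : trivIset setT piece.
Proof.
apply: ltn_trivIset => i j ij; rewrite -subset0 => x [].
rewrite /piece /= !in_itv /= => /andP[h2 _] /andP[_ h1].
have := cut_le ij => h3; have := lt_le_trans h1 h3; rewrite ltNge.
by rewrite h2.
Qed.

Let f (s : R) : \bar R := (psi s / s ^+ 2)%:E.

Let f0 x : `]0, 1[%classic x -> (0%E <= f x)%E.
Proof.
by rewrite /= in_itv /= => /andP[x0 _]; rewrite lee_fin divr_ge0 ?exprn_ge0 ?ltW ?psi0.
Qed.

Let mf : measurable_fun (`]0%R, 1%R[%classic : set R) f.
Proof.
apply/measurable_EFinP; apply: measurable_funM.
  apply: (measurable_funS _ _ (log_lipschitz_measurable psi0 psi_lip)) => //.
  by move=> x /=; rewrite !in_itv /= => /andP[->].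
have mi : measurable_fun (`]0, +oo[%classic : set R) (fun x : R => (x ^+ 2)^-1).
  apply: open_continuous_measurable_fun; first exact: interval_open.
  move=> x; rewrite inE /= in_itv /= andbT => x0.
  by apply: cvgV; [rewrite expf_neq0 // gt_eqF | exact: exprn_continuous].
apply: (measurable_funS _ _ mi) => //.
by move=> x /=; rewrite !in_itv /= => /andP[->].
Qed.

Let integral_pieces : (\int[mu]_(t in `]0%R, 1%R[) f t =
  \sum_(0 <= k <oo) \int[mu]_(t in piece k) f t)%E.
Proof.
have mf' : measurable_fun (\bigcup_k piece k) f by rewrite -bigcup_piece.
have f0' x : (\bigcup_k piece k) x -> (0%E <= f x)%E.
  by rewrite -bigcup_piece; exact: f0.
rewrite bigcup_piece; apply: ge0_integral_bigcup => // k.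
exact: measurable_itv.
Qed.

Let piece_sub k : piece k `<=` `]0, 1[%classic.
Proof. by rewrite bigcup_piece; exact: bigcup_sup. Qed.

Let fp k x : piece k x -> (0%E <= f x)%E.
Proof. by move=> h; apply: f0; apply: (piece_sub h). Qed.

Let mp k : measurable (piece k : set R).
Proof. exact: measurable_itv. Qed.

Let mfp k : measurable_fun (piece k) f.
Proof. by apply: measurable_funS mf => //; exact: piece_sub. Qed.

Let mu_piece k : mu (piece k) = (cut k - cut k.+1)%:E.
Proof.
rewrite lebesgue_measure_itv /= lte_fin; case: ltgtP (cutS k) => // -> _.
by rewrite subrr.
Qed.

(** On each piece between consecutive scales the integrand is at most a constant
    times its value at the lower end. *)
Lemma integral_divergent_series :
  (\int[mu]_(t in `]0%R, 1%R[) (psi t / t ^+ 2)%:E = +oo)%E ->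
  forall M, exists n, M <= \sum_(i < n) psi (scale i) / scale i.
Proof.
move=> int M; apply: contrapT => /forallNP bd.
have [C C1 HC] := log_lipschitz_doubling psi0 psi_lip m1.
have up k : (\int[mu]_(t in piece k) f t <= (C * m * (psi (scale k) / scale k))%:E)%E.
  have sk := scale_gt0 k; have pk := psi0 sk.
  apply: (@le_trans _ _ (\int[mu]_(t in piece k) cst (C * psi (scale k) / scale k ^+ 2)%:E t)%E).
    apply: ge0_le_integral => //.
    - exact: mp.
    - exact: fp.
    - exact: mfp.
    - move=> x; rewrite /piece /= in_itv /= => /andP[h1 h2].
      have x0 : 0 < x by apply: lt_le_trans h1.
      rewrite lee_fin ler_pM ?invr_ge0 ?exprn_ge0 ?(ltW x0) ?(ltW (psi0 x0)) //.
        apply: HC => //.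
          by apply: (le_trans (ltW h2)); exact: (cut_ratio k).
        by apply: (le_trans h1); rewrite ler_peMl // ltW.
      by rewrite lef_pV2 ?posrE ?exprn_gt0 // lerXn2r ?nnegrE // ltW.
  rewrite integral_cst; last exact: mp.
  rewrite /= mu_piece -EFinM lee_fin.
  have -> : C * m * (psi (scale k) / scale k) =
            C * psi (scale k) / scale k ^+ 2 * (m * scale k).
    by field; rewrite gt_eqF.
  rewrite ler_wpM2l //.
    by rewrite divr_ge0 ?exprn_ge0 ?mulr_ge0 // ltW //; lra.
  by have := cut_ratio k; have := cut0 k.+1; rewrite /=; lra.
have : (\int[mu]_(t in `]0%R, 1%R[) f t <= (C * m * M)%:E)%E.
  rewrite integral_pieces; apply: lime_le.
    apply: is_cvg_nneseries => n _ _; apply: integral_ge0 => x; exact: fp.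
  apply: nearW => n.
  apply: (@le_trans _ _ (\sum_(0 <= k < n) (C * m * (psi (scale k) / scale k))%:E)%E).
    by apply: lee_sum => k _; exact: up.
  rewrite sumEFin lee_fin -mulr_sumr big_mkord ler_wpM2l //.
    by rewrite mulr_ge0 ?(le_trans ler01).
  by rewrite ltW // ltNge; apply/negP.
by rewrite int leye_eq.
Qed.

(** On each piece between consecutive scales the integrand is at least a constant
    times [psi (scale k) / scale k ^ 2], and the length of the piece is at least
    half of [scale k]. *)
Lemma integral_convergent_series :
  (\int[mu]_(t in `]0%R, 1%R[) (psi t / t ^+ 2)%:E < +oo)%E ->
  exists M, forall n, \sum_(i < n) psi (scale i) / scale i <= M.
Proof.
move=> int; have [C C1 HC] := log_lipschitz_doubling psi0 psi_lip m1.
have T2 : 2 <= T%:R :> R by rewrite ler_nat.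
have C0 : 0 < C by lra.
have low k : ((psi (scale k) / scale k / (2 * C))%:E <= \int[mu]_(t in piece k.+1) f t)%E.
  have sk := scale_gt0 k; have pk := psi0 sk.
  apply: (@le_trans _ _ (\int[mu]_(t in piece k.+1) cst (psi (scale k) / C / scale k ^+ 2)%:E t)%E).
    rewrite integral_cst; last exact: mp.
  rewrite /= mu_piece -EFinM lee_fin.
    have -> : psi (scale k) / scale k / (2 * C) =
            psi (scale k) / C / scale k ^+ 2 * (scale k / 2).
      by field; rewrite !gt_eqF //; lra.
    rewrite ler_wpM2l //.
      by apply: divr_ge0; [apply: divr_ge0|apply: exprn_ge0]; exact: ltW.
    by have := scaleS k; have := scale_gt0 k.+1; rewrite /=; nra.
  apply: ge0_le_integral => //.
  - exact: mp.
  - by move=> x _; rewrite lee_fin; apply: divr_ge0; [apply: divr_ge0|apply: exprn_ge0]; exact: ltW.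
  - exact: mfp.
  - move=> x; rewrite /piece /= in_itv /= => /andP[h1 h2].
    have x0 : 0 < x by apply: lt_le_trans h1; exact: scale_gt0.
    rewrite lee_fin ler_pM ?invr_ge0 ?exprn_ge0 ?divr_ge0 ?(ltW sk) ?(ltW pk) ?(ltW C0) //.
      rewrite ler_pdivrMr; last by lra.
      rewrite mulrC; apply: HC => //.
        by apply: (le_trans (cut_ratio k.+1)); rewrite ler_wpM2l // (le_trans ler01).
      by apply: (le_trans (ltW h2)); rewrite ler_peMl // ltW.
    by rewrite lef_pV2 ?posrE ?exprn_gt0 // lerXn2r ?nnegrE ?(ltW x0) ?(ltW sk) ?(ltW h2).
have fin : (\int[mu]_(t in `]0%R, 1%R[) f t)%E \is a fin_num.
  by rewrite ge0_fin_numE // integral_ge0.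
exists (2 * C * fine (\int[mu]_(t in `]0%R, 1%R[) f t)%E) => n.
rewrite -ler_pdivrMl; last by lra.
rewrite -lee_fin fineK // integral_pieces mulr_sumr.
apply: (@le_trans _ _ (\sum_(0 <= k < n.+1) \int[mu]_(t in piece k) f t)%E).
  rewrite big_nat_recl //= -sumEFin big_mkord.
  apply: (@le_trans _ _ (\sum_(i < n) \int[mu]_(t in piece i.+1) f t)%E).
    by apply: lee_sum => i _; apply: le_trans (low i); rewrite lee_fin mulrC.
  rewrite leeDr //; apply: integral_ge0 => x; exact: fp.
apply: nneseries_lim_ge => k _ _; apply: integral_ge0 => x; exact: fp.
Qed.

End GeometricScales.

(** * The two almost everywhere statements *)

Section MetricTheory.
Variables (R : realType) (alpha0 : R).
Hypothesis halpha0 : quadratic_irrational alpha0.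
Local Notation E := (quad_orbit alpha0).
Local Notation sg := (@galois_conj R).
Local Notation mu := (@lebesgue_measure R).
Variable psi : R -> R.
Hypothesis psi0 : forall t, 0 < t -> 0 < psi t.
Hypothesis psi_lip : lipschitz (fun t : R => ln (psi (expR (- t)))).

Let width0 := quad_orbit_width_gt0 halpha0.

(** The radii are divided by [k.+1] for every [k], which keeps the series
    divergent and makes the lower limit zero. *)
Theorem orbit_khintchine_divergence :
  (forall (K : R) (T : nat), 1 <= K -> (1 < T)%N -> forall M, exists n,
     M <= \sum_(i < n) psi (scale K T i) / scale K T i) ->
  {ae mu, forall x, liminf_orbit alpha0
    (fun a => `|x - a| / psi `|a - sg a|) = 0%E}.
Proof.
move=> div.
have [Mw [kap [c [K [T [[M1 kap0 c0 K1 T1] [sep disj ubiq]]]]]]] :=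
  orbit_regular_system halpha0.
have t0 := @scale_gt0 R K T K1 T1.
have tsmall := @scale_small R K T K1 T1.
pose phi k n := psi (scale K T n) / scale K T n / k.+1%:R.
have H k := @regular_system_khintchine R _ _ kap c kap0 c0 t0 tsmall sep disj ubiq (phi k).
have ae k : {ae mu, forall x, forall N, exists n a, [/\ (N <= n)%N,
    [/\ E a, scale K T n <= `|a - sg a| & `|a - sg a| < Mw * scale K T n] &
    `|x - a| < phi k n * scale K T n]}.
  apply: H => [n|M].
    by rewrite /phi !divr_ge0 // ltW // psi0.
  have [n hn] := div K T K1 T1 (M * k.+1%:R).
  by exists n; rewrite -mulr_suml ler_pdivlMr // ltr0n.
have := ae_foralln ae; apply: filterS => x Hx.
have [C C1 HC] := log_lipschitz_doubling psi0 psi_lip (ltW M1).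
apply/liminf_orbit_eqP; split=> [d d0|d e d0 e0].
  exists 1 => // a Ea _; apply: (@le_trans _ _ 0); first by lra.
  by rewrite divr_ge0 // ltW // psi0 // width0.
have [k Hk] : exists k : nat, C / d < k.+1%:R.
  by exists (Num.truncn (C / d)); exact: truncnS_gt.
have Mw0 : 0 < Mw by lra.
have [N HN] := tsmall (e / Mw) (divr_gt0 e0 Mw0).
have [n [a [Nn [Ea a1 a2] xa]]] := Hx k N.
exists a; split=> //.
  apply: (lt_le_trans a2); rewrite mulrC -ler_pdivlMr //.
  by apply: ltW; exact: HN.
have w0 := width0 Ea; have pw := psi0 w0.
rewrite add0r ler_pdivrMr //; apply: (le_trans (ltW xa)).
have tn := t0 n; have ptn := psi0 tn.
have -> : phi k n * scale K T n = psi (scale K T n) / k.+1%:R.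
  by rewrite /phi mulrAC divfK // gt_eqF.
rewrite ler_pdivrMr ?ltr0n //.
have h1 : psi (scale K T n) <= C * psi `|a - sg a|.
  apply: HC => //; last exact: ltW.
  by apply: (le_trans a1); rewrite ler_peMl // ltW.
apply: (le_trans h1); rewrite mulrAC ler_pM2r //.
by move: Hk; rewrite ltr_pdivrMr // mulrC => /ltW.
Qed.

(** Borel-Cantelli for the balls of radius [c * psi (t n)] centred at the points
    of width about [t n] in a bounded window; repulsion bounds the number of
    centres by a multiple of [1 / t n]. *)
Theorem orbit_khintchine_convergence (K : R) (T : nat) (M : R) :
  1 <= K -> (1 < T)%N ->
  (forall n, \sum_(i < n) psi (scale K T i) / scale K T i <= M) ->
  {ae mu, forall x, liminf_orbit alpha0
    (fun a => `|x - a| / psi `|a - sg a|) = +oo%E}.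
Proof.
move=> K1 T1 bd; set t := scale K T.
have t0 : forall n, 0 < t n := scale_gt0 K1 T1.
have tS : forall n, t n.+1 * T%:R = t n := scaleS K1 T1.
have tsmall := @scale_small R K T K1 T1.
have t_le := scale_le K1 T1.
have T2 : 1 <= T%:R :> R by rewrite ler1n ltnW.
have [kap kap0 Hk] := quad_orbit_repulsion halpha0.
pose V (c w n : nat) : set R := \bigcup_(a in [set a | [/\ E a,
  t n.+1 <= `|a - sg a| & - (w%:R + 1) <= a <= w%:R + 1]])
  `]a - c%:R * psi (t n), a + c%:R * psi (t n)[%classic.
have mV c w n : measurable (V c w n).
  by apply: open_measurable; apply: bigcup_open => a _; exact: interval_open.
pose D (c w : nat) : R := 2 * c%:R * (2 * (w%:R + 1) + kap * t 0) * T%:R / kap.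
have muV c w n : (mu (V c w n) <= (D c w * (psi (t n) / t n))%:E)%E.
  have pt := psi0 (t0 n).
  have /finite_seqP[s sE] := finite_orbit_level halpha0 (- (w%:R + 1)) (w%:R + 1) (t0 n.+1).
  pose s' := undup s.
  have s'P a : a \in s' <-> [/\ E a, t n.+1 <= `|a - sg a| & - (w%:R + 1) <= a <= w%:R + 1].
    have : [set` s] a <-> [/\ E a, t n.+1 <= `|a - sg a| & - (w%:R + 1) <= a <= w%:R + 1].
      by rewrite -sE.
    by rewrite /s' mem_undup.
  have ks : (size s')%:R * (kap * t n.+1) <= 2 * (w%:R + 1) + kap * t 0.
    have w0 : 0 <= w%:R :> R by [].
    have := @size_separated R s' (kap * t n.+1) (- (w%:R + 1)) (w%:R + 1).
    rewrite mulr_gt0 // => /(_ isT) h.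
    have h2 : kap * t n.+1 <= kap * t 0 by rewrite ler_pM2l //; exact: t_le.
    have {}h : (size s')%:R * (kap * t n.+1) <= (w%:R + 1) - (- (w%:R + 1)) + kap * t n.+1.
      apply: h; [lra | exact: undup_uniq | by move=> x /s'P[] |].
      move=> x y /s'P[Ex tx _] /s'P[Ey ty _] xy; exact: Hk.
    by lra.
  apply: (@le_trans _ _ (total_length [seq (a, c%:R * psi (t n)) | a <- s'])%:E).
    apply: measure_le_covering => //.
      by move=> b /mapP[a _ ->] /=; rewrite mulr_ge0 // ltW.
    move=> x [a /s'P as' xa]; exists (a, c%:R * psi (t n)); first by apply/mapP; exists a.
    move: xa; rewrite /= in_itv /= => /andP[? ?].
    by rewrite ler_norml; apply/andP; split; lra.
  rewrite lee_fin /total_length big_map /= big_const_seq count_predT iter_addr_0.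
  have -> : (2 * (c%:R * psi (t n))) *+ size s' =
     2 * c%:R * T%:R / kap * (psi (t n) / t n) * ((size s')%:R * (kap * t n.+1)).
    rewrite -(mulr_natr (2 * _)) -(tS n); field.
    by rewrite !gt_eqF //; lra.
  have -> : D c w * (psi (t n) / t n) =
     2 * c%:R * T%:R / kap * (psi (t n) / t n) * (2 * (w%:R + 1) + kap * t 0).
    by rewrite /D; field; rewrite !gt_eqF.
  apply: ler_wpM2l ks.
  apply: mulr_ge0; last by apply: divr_ge0; exact: ltW.
  by apply: divr_ge0; [rewrite !mulr_ge0|exact: ltW].
have ae c w : {ae mu, forall x, exists N, forall n, (N <= n)%N -> ~ V c w n x}.
  have V0 : mu (lim_sup_set (V c w)) = 0%E.
    apply: lim_sup_set_cvg0; first exact: mV.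
    apply: (@le_lt_trans _ _ (D c w * M)%:E); last exact: ltry.
    apply: lime_le; first by apply: is_cvg_nneseries.
    apply: nearW => n.
    apply: (@le_trans _ _ (\sum_(0 <= k < n) (D c w * (psi (t k) / t k))%:E)%E).
      by apply: lee_sum => k _; exact: muV.
    rewrite sumEFin lee_fin -mulr_sumr big_mkord ler_wpM2l //.
    rewrite /D divr_ge0 ?(ltW kap0) // !mulr_ge0 // addr_ge0 ?mulr_ge0 ?addr_ge0 //.
      exact: ltW.
    exact: ltW.
  exists (lim_sup_set (V c w)); split=> //.
    apply: bigcap_measurable => // k _; apply: bigcup_measurable => n _; exact: mV.
  move=> x /= h k _; apply: contrapT => h2; apply: h; exists k => n kn Vx.
  by apply: h2; exists n.
have {ae} := ae_foralln (fun c => ae_foralln (ae c)).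
apply: filterS => x Hx; apply: liminf_orbit_eqyP => c'.
have [C C1 HC] := log_lipschitz_doubling psi0 psi_lip T2.
have [c Hc] : exists c : nat, c' * C < c%:R.
  have [h|h] := leP 0 (c' * C).
    by exists (Num.truncn (c' * C)).+1; exact: truncnS_gt.
  by exists 0%N.
have [w Hw] : exists w : nat, `|x| < w%:R.
  by exists (Num.truncn `|x|).+1; exact: truncnS_gt.
have [N HN] := Hx c w.
have M0 : 0 <= M by have := bd 0%N; rewrite big_ord0.
have [N2 HN2] : exists N2, forall n, (N2 <= n)%N -> c%:R * psi (t n) <= 1.
  have cM : 0 < (c%:R * M + 1)^-1 by rewrite invr_gt0 ltr_wpDl // mulr_ge0.
  have [N2 HN2] := tsmall _ cM; exists N2 => n /HN2 h.
  have : psi (t n) / t n <= M.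
    apply: le_trans (bd n.+1); rewrite big_ord_recr /= lerDr.
    by apply: sumr_ge0 => i _; rewrite divr_ge0 // ltW // psi0.
  rewrite ler_pdivrMr // => h2.
  move: h; rewrite -[_^-1]div1r ltr_pdivlMr; last by rewrite -invr_gt0.
  have c0 : 0 <= c%:R :> R by []; have := t0 n; have := psi0 (t0 n); rewrite -/t; nra.
exists (t (maxn N N2)) => // a Ea aw.
have w0 := width0 Ea; have pw := psi0 w0.
have [n [nN n1 n2]] : exists n, [/\ (maxn N N2 <= n)%N, t n.+1 <= `|a - sg a| & `|a - sg a| < t n].
  have [N3 HN3] := tsmall _ w0.
  have [k hk kmin] := ex_minnP (P := fun k => t k <= `|a - sg a|) (ex_intro _ N3 (ltW (HN3 N3 (leqnn N3)))).
  have kN : (maxn N N2 < k)%N.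
    rewrite ltnNge; apply/negP => /t_le h.
    by move: (lt_le_trans aw h); rewrite ltNge hk.
  case: k hk kmin kN => // k hk kmin kN; exists k; split=> //.
  by rewrite ltNge; apply/negP => /kmin; rewrite ltnn.
have h1 : psi `|a - sg a| <= C * psi (t n).
  apply: HC => //; first by apply: (le_trans (ltW n2)); rewrite ler_peMl // ltW.
  by rewrite -(tS n) mulrC ler_wpM2l //; lra.
rewrite ler_pdivlMr //.
have cpt : c%:R * psi (t n) <= `|x - a|.
  have [aw1|aw1] := boolP (- (w%:R + 1) <= a <= w%:R + 1).
    rewrite leNgt; apply/negP => xa.
    apply: (HN n); first by move: nN; rewrite geq_max => /andP[].
    exists a => //=; rewrite in_itv /=; move: xa; rewrite ltr_norml => /andP[? ?].
    by apply/andP; split; lra.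
  apply: (@le_trans _ _ 1); first by apply: HN2; move: nN; rewrite geq_max => /andP[].
  move: Hw; rewrite ltr_norml => /andP[x1 x2].
  move: aw1; rewrite negb_and -!ltNge => /orP[h|h].
    by rewrite ger0_norm; lra.
  by rewrite ler0_norm; lra.
have ptn := psi0 (t0 n).
apply: le_trans cpt; have [c'0|c'0] := leP c' 0; last by nra.
by apply: (@le_trans _ _ 0); [nra|rewrite mulr_ge0 // ltW].
Qed.

End MetricTheory.

(** * Coding of real numbers by paths in the Farey tessellation *)

(** The letter [true] is the matrix [(1 1; 0 1)] and [false] is [(1 0; 1 1)];
    [word_row v s k] is the row vector [v] multiplied by the first [k] letters. *)
Fixpoint word_row (v : int * int) (s : nat -> bool) (k : nat) : int * int :=
  if k is k'.+1 then
    let r := word_row v s k' in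
    if s k' then (r.1, r.1 + r.2) else (r.1 + r.2, r.2)
  else v.

Section Coding.
Variable R : realType.
Implicit Types (x y : R) (m : int) (s : nat -> bool) (k : nat).

Definition topl m s k : int := (word_row (1, m) s k).1.
Definition topr m s k : int := (word_row (1, m) s k).2.
Definition botl s k : int := (word_row (0, 1) s k).1.
Definition botr s k : int := (word_row (0, 1) s k).2.

(** Homogeneous coordinates of [g_k^-1 y], where [g_k] is the product of the
    translation by [m] and of the first [k] letters. *)
Definition cnum m s y k : R := (botr s k)%:~R * y - (topr m s k)%:~R.
Definition cden m s y k : R := (topl m s k)%:~R - (botl s k)%:~R * y.

Definition in_cell m s k y : Prop := 0 < cnum m s y k /\ 0 < cden m s y k.

Definition coded m s x : Prop := forall k, in_cell m s k x.

Lemma code_det m s k : topl m s k * botr s k - topr m s k * botl s k = 1.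
Proof.
elim: k => [|k]; first by rewrite /topl /topr /botl /botr /= mulr0 mul1r subr0.
by rewrite /topl /topr /botl /botr /=; case: (s k) => /= IH; rewrite -[RHS]IH; ring.
Qed.

Lemma bot_ge s k : 0 <= botl s k /\ 1 <= botr s k.
Proof.
by elim: k => //= k []; rewrite /botl /botr /=; case: (s k) => /=; lia.
Qed.

Lemma botlS s k : botl s k.+1 = if s k then botl s k else botl s k + botr s k.
Proof. by rewrite /botl /=; case: (s k). Qed.

Lemma botrS s k : botr s k.+1 = if s k then botl s k + botr s k else botr s k.
Proof. by rewrite /botr /=; case: (s k). Qed.

Lemma cnum0 m s y : cnum m s y 0 = y - m%:~R.
Proof. by rewrite /cnum /= mul1r. Qed.

Lemma cden0 m s y : cden m s y 0 = 1.
Proof. by rewrite /cden /= mul0r subr0. Qed.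

Lemma cnumS m s y k :
  cnum m s y k.+1 = if s k then cnum m s y k - cden m s y k else cnum m s y k.
Proof.
rewrite /cnum /cden /botr /botl /topl /topr /=; case: (s k) => //=.
by rewrite !rmorphD /=; ring.
Qed.

Lemma cdenS m s y k :
  cden m s y k.+1 = if s k then cden m s y k else cden m s y k - cnum m s y k.
Proof.
rewrite /cnum /cden /botr /botl /topl /topr /=; case: (s k) => //=.
by rewrite !rmorphD /=; ring.
Qed.

Lemma code_detR m s k : (topl m s k)%:~R * (botr s k)%:~R -
  (topr m s k)%:~R * (botl s k)%:~R = 1 :> R.
Proof. by rewrite -!rmorphM /= -rmorphB /= code_det. Qed.

Lemma cnum_cden_unit m s y k :
  (botl s k)%:~R * cnum m s y k + (botr s k)%:~R * cden m s y k = 1.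
Proof. by apply: etrans (code_detR m s k); rewrite /cnum /cden; ring. Qed.

Lemma cnum_cdenE m s y k :
  y = (topl m s k)%:~R * cnum m s y k + (topr m s k)%:~R * cden m s y k.
Proof.
have -> : (topl m s k)%:~R * cnum m s y k + (topr m s k)%:~R * cden m s y k =
  ((topl m s k)%:~R * (botr s k)%:~R - (topr m s k)%:~R * (botl s k)%:~R) * y.
  by rewrite /cnum /cden; ring.
by rewrite code_detR mul1r.
Qed.

Lemma in_cell_nested m s k j y : (j <= k)%N -> in_cell m s k y -> in_cell m s j y.
Proof.
move=> /subnKC <-; elim: (k - j)%N => [|i IH]; first by rewrite addn0.
rewrite addnS => h; apply: IH; move: h; rewrite /in_cell cnumS cdenS.
by case: (s _) => -[? ?]; split; lra.
Qed.

Fixpoint euclid (u : R * R) k : R * R :=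
  if k is k'.+1 then
    let v := euclid u k' in
    if v.2 < v.1 then (v.1 - v.2, v.2) else (v.1, v.2 - v.1)
  else u.

(** The word records the comparisons in the subtractive Euclidean algorithm
    applied to the fractional part of [x] and 1. *)
Lemma code_exists x : ~ rational x -> exists m s, coded m s x.
Proof.
move=> xirr; pose m := Num.floor x.
pose s k := let v := euclid (x - m%:~R, 1) k in v.2 < v.1.
have E k : (cnum m s x k, cden m s x k) = euclid (x - m%:~R, 1) k.
  elim: k => [|k IH]; first by rewrite cnum0 cden0.
  rewrite cnumS cdenS /= -IH /= /s -IH /=.
  by case: ifP.
exists m, s => k; elim: k => [|k [n0 d0]].
  rewrite /in_cell cnum0 cden0; split=> //; rewrite subr_gt0 lt_neqAle floor_le andbT.
  by apply/eqP => e; apply: xirr; rewrite -e; apply: rational_int.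
rewrite /in_cell cnumS cdenS /s -E /=.
have nd : cnum m s x k != cden m s x k.
  rewrite -subr_eq0.
  have -> : cnum m s x k - cden m s x k = (botl s k + botr s k)%:~R * x +
     (- (topl m s k + topr m s k))%:~R.
    by rewrite /cnum /cden rmorphN !rmorphD /=; ring.
  apply: irrational_affine_neq0 => //.
  by have := bot_ge s k; lia.
by case: (ltP (cden m s x k) (cnum m s x k)) => h; split=> //; rewrite subr_gt0 //
  lt_neqAle nd.
Qed.

Lemma coded_infinitely_false m s x j : coded m s x -> exists2 i, (j <= i)%N & s i = false.
Proof.
move=> cx; apply: contrapT => H.
have st i : s (j + i)%N = true.
  apply/negPn/negP => /negPf h; apply: H; exists (j + i)%N => //; exact: leq_addr.
have E i : cden m s x (j + i) = cden m s x j /\ cnum m s x (j + i) = cnum m s x j - i%:R * cden m s x j.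
  elim: i => [|i [IH1 IH2]]; first by rewrite addn0 mul0r subr0.
  by rewrite addnS cnumS cdenS st IH1 IH2 -natr1; split=> //; ring.
have [n0 d0] := cx j.
pose i := (Num.truncn (cnum m s x j / cden m s x j)).+1.
have hi : cnum m s x j / cden m s x j < i%:R by exact: truncnS_gt.
have [] := cx (j + i)%N; have [-> ->] := E i.
by move: hi; rewrite ltr_pdivrMr //; lra.
Qed.

(** Were [x] rational, the sum of the two homogeneous coordinates would decrease
    forever by at least the inverse of its denominator. *)
Lemma coded_irrational m s x : coded m s x -> ~ rational x.
Proof.
move=> cx /rationalP[p [q xE]].
have [n [p' [n0 xE']]] : exists (n : nat) (p' : int), (0 < n)%N /\ n%:R * x = p'%:~R.
  case: q xE => [|q] ->; first by exists 1%N, 0; rewrite invr0 mulr0 mulr0.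
  exists q.+1, p; split=> //; rewrite mulrC divfK // pnatr_eq0 //.
have nN k : exists z : int, n%:R * cnum m s x k = z%:~R.
  exists (botr s k * p' - n%:Z * topr m s k).
  by rewrite rmorphB !rmorphM /= -xE' /cnum /=; ring.
have nD k : exists z : int, n%:R * cden m s x k = z%:~R.
  exists (n%:Z * topl m s k - botl s k * p').
  by rewrite rmorphB !rmorphM /= -xE' /cden /=; ring.
have nR : 0 < n%:R :> R by rewrite ltr0n.
have nN1 k : 1 <= n%:R * cnum m s x k.
  have [z zE] := nN k; have [h _] := cx k.
  have : 0 < n%:R * cnum m s x k by rewrite mulr_gt0.
  by rewrite zE ltr0z ler1z; lia.
have nD1 k : 1 <= n%:R * cden m s x k.
  have [z zE] := nD k; have [_ h] := cx k.
  have : 0 < n%:R * cden m s x k by rewrite mulr_gt0.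
  by rewrite zE ltr0z ler1z; lia.
have dec k : n%:R * (cnum m s x k + cden m s x k) <= n%:R * (cnum m s x 0 + cden m s x 0) - k%:R.
  elim: k => [|k IH]; first by rewrite subr0.
  rewrite cnumS cdenS -natr1; have := nN1 k; have := nD1 k.
  by case: (s k); lra.
pose k := (Num.truncn (n%:R * (cnum m s x 0 + cden m s x 0))).+1.
have hk : n%:R * (cnum m s x 0 + cden m s x 0) < k%:R by exact: truncnS_gt.
by have := dec k; have := nN1 k; have := nD1 k; lra.
Qed.

(** The number is the supremum of the left ends of the cells; it is interior to
    each of them because both letters come back. *)
Lemma code_real m s : (forall j, exists2 i, (j <= i)%N & s i = false) ->
  (forall j, exists2 i, (j <= i)%N & s i = true) -> exists x, coded m s x.
Proof.
move=> infF infT.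
pose f k : R := (topr m s k)%:~R / (botr s k)%:~R.
have d0 k : 0 < (botr s k)%:~R :> R by rewrite ltr0z; have := bot_ge s k; lia.
have c0 k : 0 <= (botl s k)%:~R :> R by rewrite ler0z; have := bot_ge s k; lia.
have numf k : cnum m s (f k) k = 0.
  by rewrite /cnum /f mulrCA divff ?mulr1 ?subrr // gt_eqF.
have denf k : 0 < cden m s (f k) k.
  have := cnum_cden_unit m s (f k) k; rewrite numf mulr0 add0r => h.
  by rewrite -(pmulr_rgt0 _ (d0 k)) h.
have back y i k : (i <= k)%N -> 0 <= cnum m s y k -> 0 <= cden m s y k ->
    0 <= cnum m s y i /\ 0 <= cden m s y i.
  move=> /subnKC <-; elim: (k - i)%N => [|j IH]; first by rewrite addn0.
  rewrite addnS cnumS cdenS; case: (s _) => h1 h2; apply: IH; lra.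
have f_mono i k : (i <= k)%N -> f i <= f k.
  move=> ik; have [] := back (f k) i k ik; rewrite ?numf ?(ltW (denf k)) // => h _.
  by move: h; rewrite /cnum subr_ge0 mulrC -ler_pdivrMr.
have denf_ge0 j k : 0 <= cden m s (f k) j.
  have [jk|kj] := leqP j k.
    by have [] := back (f k) j k jk; rewrite ?numf ?(ltW (denf k)).
  apply: (le_trans (ltW (denf j))); rewrite /cden lerD2l lerN2.
  by apply: ler_wpM2l => //; apply: f_mono; exact: ltnW.
have [i0 _ si0] := infF 0%N.
have ci0 : 0 < (botl s i0.+1)%:~R :> R.
  by rewrite ltr0z botlS si0; have := bot_ge s i0; lia.
have fub : has_ubound (range f).
  exists ((topl m s i0.+1)%:~R / (botl s i0.+1)%:~R) => _ [k _ <-].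
  by have := denf_ge0 i0.+1 k; rewrite /cden subr_ge0 mulrC -ler_pdivlMr.
pose x := sup (range f).
have fx k : f k <= x by apply: ub_le_sup => //; exists k.
have xn k : 0 <= cnum m s x k.
  by rewrite /cnum subr_ge0; have := fx k; rewrite {1}/f ler_pdivrMr // mulrC.
have xd k : 0 <= cden m s x k.
  rewrite /cden subr_ge0; have := c0 k; rewrite le_eqVlt => /orP[/eqP c00|c00].
    have := denf_ge0 k 0%N; rewrite /cden -c00 !mul0r; lra.
  rewrite mulrC -ler_pdivlMr //; apply: ge_sup; first by exists (f 0%N); exists 0%N.
  by move=> _ [j _ <-]; rewrite ler_pdivlMr // mulrC -subr_ge0; exact: denf_ge0.
have nd k : 0 < cnum m s x k + cden m s x k.
  have h3 := cnum_cden_unit m s x k; have h2 := xn k; have h1 := xd k.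
  rewrite lt_neqAle addr_ge0 // andbT; apply/eqP => e.
  have e1 : cnum m s x k = 0 by lra.
  have e2 : cden m s x k = 0 by lra.
  by move: h3; rewrite e1 e2 !mulr0 addr0 => /eqP; rewrite eq_sym oner_eq0.
exists x => k; split; rewrite lt_neqAle ?xn ?xd andbT; apply/eqP => e.
- have [i ki si] := infT k.
  have E j : cnum m s x (k + j) = 0.
    elim: j => [|j IH]; first by rewrite addn0.
    have := xn (k + j.+1)%N; rewrite addnS cnumS IH; case: (s _) => // h.
    by have := nd (k + j)%N; rewrite IH; lra.
  have := xn i.+1; rewrite cnumS si; have := nd i.
  by rewrite -(subnKC ki) E; lra.
- have [i ki si] := infF k.
  have E j : cden m s x (k + j) = 0.
    elim: j => [|j IH]; first by rewrite addn0.
    have := xd (k + j.+1)%N; rewrite addnS cdenS IH; case: (s _) => // h.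
    by have := nd (k + j)%N; rewrite IH; lra.
  have := xd i.+1; rewrite cdenS si; have := nd i.
  by rewrite -(subnKC ki) E; lra.
Qed.

(** The length of the cell of bottom row [(c, d)] is [1 / (c * d)]. *)
Lemma cell_shrinks m s x : coded m s x -> forall e, 0 < e ->
  exists k0, forall k, (k0 <= k)%N -> forall y, in_cell m s k y -> `|y - x| < e.
Proof.
move=> cx e e0; have [i _ si] := coded_infinitely_false 0 cx.
have grow k : (i.+1 <= k)%N -> 1 <= botl s k /\ (k - i)%:Z <= botl s k + botr s k - 1.
  move=> /subnKC <-; elim: (k - i.+1)%N => [|j [IH1 IH2]].
    by rewrite addn0 botlS botrS si; have := bot_ge s i; lia.
  rewrite addnS botlS botrS; have := bot_ge s (i.+1 + j).
  by case: (s _); lia.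
pose n := (Num.truncn e^-1).+1.
have nE : e^-1 < n%:R by exact: truncnS_gt.
exists (i + n).+1 => k kn y [ny dy]; have [nx dx] := cx k.
have [|c1 cd] := grow k; first by move: kn; clear; lia.
have [_ d1] := bot_ge s k.
have c1R : 1 <= (botl s k)%:~R :> R by rewrite ler1z.
have d1R : 1 <= (botr s k)%:~R :> R by rewrite ler1z.
have cdR : n%:R <= (botl s k)%:~R + (botr s k)%:~R - 1 :> R.
  rewrite -rmorphD -[1]/(1%:~R) -rmorphB /= -[n%:R]/(n%:Z%:~R) ler_int.
  by apply: le_trans cd; rewrite lez_nat; move: kn; clear; lia.
have uy := cnum_cden_unit m s y k; have ux := cnum_cden_unit m s x k.
have numB : (botr s k)%:~R * (y - x) = cnum m s y k - cnum m s x k by rewrite /cnum; ring.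
set c := (botl s k)%:~R in uy ux c1R cdR; set d := (botr s k)%:~R in uy ux d1R cdR numB.
have bx : c * cnum m s x k < 1 by have : 0 < d * cden m s x k by [rewrite mulr_gt0 //; lra]; lra.
have by_ : c * cnum m s y k < 1 by have : 0 < d * cden m s y k by [rewrite mulr_gt0 //; lra]; lra.
have h : c * (d * `|y - x|) < 1.
  rewrite -[d]ger0_norm; last by lra.
  rewrite -normrM numB -[c]ger0_norm; last by lra.
  rewrite -normrM ltr_norml mulrBr.
  have : 0 < c * cnum m s x k by rewrite mulr_gt0 //; lra.
  have : 0 < c * cnum m s y k by rewrite mulr_gt0 //; lra.
  by lra.
have cd2 : n%:R <= c * d by nra.
have h2 : n%:R * `|y - x| < 1.
  by apply: le_lt_trans h; rewrite mulrA ler_wpM2r.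
have h3 : 1 < e * n%:R by move: nE; rewrite -[e^-1]div1r ltr_pdivrMr // mulrC.
have := normr_ge0 (y - x) => h4.
have n0 : 0 < n%:R :> R by rewrite ltr0n.
by rewrite -(ltr_pM2l n0); lra.
Qed.

End Coding.

(** * Windows of the coding and continuity of the normalised distance *)

Section Windows.
Variable R : realType.
Implicit Types (x y e : R) (m : int) (s : nat -> bool) (k r : nat).

(** The two ends of the geodesic from infinity to [x], seen from the cell of
    rank [k] in coordinates which map the projective half-lines to the unit
    interval. The first depends on the letters from rank [k] on, the second on
    the letters before. *)
Definition future m s x k : R := cnum m s x k / (cnum m s x k + cden m s x k).
Definition past s k : R := (botr s k)%:~R / ((botl s k)%:~R + (botr s k)%:~R).

(** Two positive vectors undergoing the same unimodular steps keep the same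
    determinant while the product of their sizes grows by at least that
    determinant at each step. *)
Lemma future_det m1 s1 x1 k1 m2 s2 x2 k2 r : coded m1 s1 x1 -> coded m2 s2 x2 ->
  (forall i, (i < r)%N -> s1 (k1 + i)%N = s2 (k2 + i)%N) ->
  r.+1%:R * `|cnum m1 s1 x1 k1 * cden m2 s2 x2 k2 - cnum m2 s2 x2 k2 * cden m1 s1 x1 k1| <=
  (cnum m1 s1 x1 k1 + cden m1 s1 x1 k1) * (cnum m2 s2 x2 k2 + cden m2 s2 x2 k2).
Proof.
move=> c1 c2; elim: r k1 k2 => [|r IH] k1 k2 agree.
  have [u1 w1] := c1 k1; have [u2 w2] := c2 k2.
  have := mulr_gt0 u1 u2; have := mulr_gt0 w1 w2.
  have := mulr_gt0 u1 w2; have := mulr_gt0 u2 w1.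
  by rewrite mul1r => *; rewrite ler_norml; apply/andP; split; lra.
have h0 := agree 0%N (ltn0Sn _); rewrite !addn0 in h0.
have agree' i : (i < r)%N -> s1 (k1.+1 + i)%N = s2 (k2.+1 + i)%N.
  by move=> ir; rewrite !addSnnS; apply: agree.
have := IH _ _ agree'.
have [u1 w1] := c1 k1.+1; have [u2 w2] := c2 k2.+1.
have := mulr_gt0 u1 u2; have := mulr_gt0 w1 w2.
have := mulr_gt0 u1 w2; have := mulr_gt0 u2 w1.
rewrite !cnumS !cdenS h0; set U1 := cnum m1 s1 x1 k1; set W1 := cden m1 s1 x1 k1.
set U2 := cnum m2 s2 x2 k2; set W2 := cden m2 s2 x2 k2.
rewrite -[r.+2%:R]natr1.
case: (s2 k2) => p1 p2 p3 p4 h.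
  have dE : (U1 - W1) * W2 - (U2 - W2) * W1 = U1 * W2 - U2 * W1 by ring.
  rewrite dE in h; set D := `|_| in h *.
  have : D <= (U1 - W1) * W2 + (U2 - W2) * W1.
    by rewrite /D -dE ler_norml; apply/andP; split; lra.
  by nra.
have dE : U1 * (W2 - U2) - U2 * (W1 - U1) = U1 * W2 - U2 * W1 by ring.
rewrite dE in h; set D := `|_| in h *.
have : D <= U1 * (W2 - U2) + U2 * (W1 - U1).
  by rewrite /D -dE ler_norml; apply/andP; split; lra.
by nra.
Qed.

Lemma past_det s1 k1 s2 k2 r :
  (forall i, (i < r)%N -> s1 (k1 + i)%N = s2 (k2 + i)%N) ->
  r.+1%:R * `|(botl s1 (k1 + r))%:~R * (botr s2 (k2 + r))%:~R -
     (botl s2 (k2 + r))%:~R * (botr s1 (k1 + r))%:~R| <=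
  ((botl s1 (k1 + r))%:~R + (botr s1 (k1 + r))%:~R) *
  ((botl s2 (k2 + r))%:~R + (botr s2 (k2 + r))%:~R) :> R.
Proof.
have pos s k : 0 <= (botl s k)%:~R :> R /\ 0 <= (botr s k)%:~R :> R.
  by have := bot_ge s k; rewrite !ler0z; lia.
elim: r => [|r IH] agree.
  rewrite !addn0 mul1r; have [u1 w1] := pos s1 k1; have [u2 w2] := pos s2 k2.
  have := mulr_ge0 u1 u2; have := mulr_ge0 w1 w2.
  have := mulr_ge0 u1 w2; have := mulr_ge0 u2 w1.
  by move=> *; rewrite ler_norml; apply/andP; split; lra.
have h := IH (fun i ir => agree i (ltnW ir)).
have h0 := agree r (ltnSn r).
rewrite !addnS !botlS !botrS h0.
have [u1 w1] := pos s1 (k1 + r)%N; have [u2 w2] := pos s2 (k2 + r)%N.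
move: h u1 w1 u2 w2; set c1 := (botl s1 _)%:~R; set d1 := (botr s1 _)%:~R.
set c2 := (botl s2 _)%:~R; set d2 := (botr s2 _)%:~R => h u1 w1 u2 w2.
have p1 := mulr_ge0 u1 u2; have p2 := mulr_ge0 w1 w2.
have p3 := mulr_ge0 u1 w2; have p4 := mulr_ge0 u2 w1.
have hD : `|c1 * d2 - c2 * d1| <= c1 * d2 + c2 * d1.
  by rewrite ler_norml; apply/andP; split; lra.
rewrite -[r.+2%:R]natr1.
case: (s2 _); rewrite !rmorphD /= -/c1 -/c2 -/d1 -/d2.
  have -> : c1 * (c2 + d2) - c2 * (c1 + d1) = c1 * d2 - c2 * d1 by ring.
  by move: h hD; set D := `|_|; nra.
have -> : (c1 + d1) * d2 - (c2 + d2) * d1 = c1 * d2 - c2 * d1 by ring.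
by move: h hD; set D := `|_|; nra.
Qed.

Lemma botsum_gt0 s k : 0 < (botl s k)%:~R + (botr s k)%:~R :> R.
Proof. by rewrite -rmorphD /= ltr0z; have := bot_ge s k; lia. Qed.

Lemma future_in m s x k : coded m s x -> 0 <= future m s x k <= 1.
Proof.
move=> cx; have [u w] := cx k; rewrite /future.
by rewrite divr_ge0 ?ler_pdivrMr ?mul1r ?lerDl //=; lra.
Qed.

Lemma past_in s k : 0 <= past s k <= 1.
Proof.
have := bot_ge s k => -[c d]; have := botsum_gt0 s k => T0.
have c0 : 0 <= (botl s k)%:~R :> R by rewrite ler0z.
have d0 : 0 <= (botr s k)%:~R :> R by rewrite ler0z; lia.
by rewrite /past divr_ge0 ?ler_pdivrMr ?mul1r ?lerDr //=; lra.
Qed.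

Lemma future_close m1 s1 x1 k1 m2 s2 x2 k2 r : coded m1 s1 x1 -> coded m2 s2 x2 ->
  (forall i, (i < r)%N -> s1 (k1 + i)%N = s2 (k2 + i)%N) ->
  `|future m1 s1 x1 k1 - future m2 s2 x2 k2| <= r.+1%:R^-1.
Proof.
move=> cx1 cx2 agree; have := future_det cx1 cx2 agree.
have [u1 w1] := cx1 k1; have [u2 w2] := cx2 k2; rewrite /future.
move: u1 w1 u2 w2; set U1 := cnum m1 s1 x1 k1; set W1 := cden m1 s1 x1 k1.
set U2 := cnum m2 s2 x2 k2; set W2 := cden m2 s2 x2 k2 => u1 w1 u2 w2 h.
have S1 : 0 < U1 + W1 by lra.
have S2 : 0 < U2 + W2 by lra.
have -> : U1 / (U1 + W1) - U2 / (U2 + W2) =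
   (U1 * W2 - U2 * W1) / ((U1 + W1) * (U2 + W2)) by field; rewrite !gt_eqF.
rewrite normrM normfV (gtr0_norm (mulr_gt0 S1 S2)) ler_pdivrMr ?mulr_gt0 //.
by rewrite ler_pdivlMl ?ltr0n.
Qed.

Lemma past_close s1 k1 s2 k2 r :
  (forall i, (i < r)%N -> s1 (k1 + i)%N = s2 (k2 + i)%N) ->
  `|past s1 (k1 + r) - past s2 (k2 + r)| <= r.+1%:R^-1.
Proof.
move=> agree; have := past_det agree.
have T1 := botsum_gt0 s1 (k1 + r); have T2 := botsum_gt0 s2 (k2 + r).
move: T1 T2; rewrite /past; set c1 := (botl s1 _)%:~R; set d1 := (botr s1 _)%:~R.
set c2 := (botl s2 _)%:~R; set d2 := (botr s2 _)%:~R => T1 T2 h.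
have -> : d1 / (c1 + d1) - d2 / (c2 + d2) =
   - ((c1 * d2 - c2 * d1) / ((c1 + d1) * (c2 + d2))) by field; rewrite !gt_eqF.
rewrite normrN normrM normfV (gtr0_norm (mulr_gt0 T1 T2)) ler_pdivrMr ?mulr_gt0 //.
by rewrite ler_pdivlMl ?ltr0n.
Qed.

(** The denominator and the numerator of the cross-ratio in these coordinates.
    On the unit square [crossing] vanishes only at two corners, where both ends
    of the geodesic tend to the same cusp. *)
Definition crossing (p q : R) : R := (1 - q) * p + q * (1 - p).
Definition gauge (e e' p q : R) : R := `|p - e * (1 - p)| * `|(1 - q) * e' + q|.

(** The normalised distance between [x] and the image of [e] under [g_k], whose
    conjugate is the image of [e']. *)
Definition hval m s x k (e e' : R) : R :=
  `|cnum m s x k - e * cden m s x k| * `|(botl s k)%:~R * e' + (botr s k)%:~R| / `|e - e'|.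

Lemma hval_gauge m s x k e e' : coded m s x -> e != e' ->
  0 < crossing (future m s x k) (past s k) /\
  gauge e e' (future m s x k) (past s k) =
  hval m s x k e e' * (crossing (future m s x k) (past s k) * `|e - e'|).
Proof.
move=> cx ee'; have [u w] := cx k; have T0 := botsum_gt0 s k.
have unit := cnum_cden_unit m s x k.
rewrite /gauge /hval /crossing /future /past; move: u w T0 unit.
set U := cnum m s x k; set W := cden m s x k.
set c := (botl s k)%:~R; set d := (botr s k)%:~R => u w T0 unit.
have S0 : 0 < U + W by lra.
have crE : (1 - d / (c + d)) * (U / (U + W)) + d / (c + d) * (1 - U / (U + W)) =
   ((U + W) * (c + d))^-1.
  rewrite -[RHS]mul1r -[X in _ = X * _]unit; field.
  by rewrite !gt_eqF.
rewrite crE; split; first by rewrite invr_gt0 mulr_gt0.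
have -> : U / (U + W) - e * (1 - U / (U + W)) = (U - e * W) / (U + W).
  by field; rewrite gt_eqF.
have -> : (1 - d / (c + d)) * e' + d / (c + d) = (c * e' + d) / (c + d).
  by field; rewrite gt_eqF.
rewrite !normrM !normfV (gtr0_norm S0) (gtr0_norm T0).
have w0 : `|e - e'| != 0 by rewrite normr_eq0 subr_eq0.
by field; rewrite w0 !gt_eqF.
Qed.

Definition bounded_pair (K e e' : R) : Prop :=
  [/\ K^-1 <= `|e|, K^-1 <= `|e'|, K^-1 <= `|e - e'|, `|e| <= K & `|e'| <= K].

(** Near the two corners where [crossing] vanishes, [gauge] is bounded below
    because [e] and [e'] stay away from 0 and from infinity. *)
Lemma crossing_lower (K C0 e e' p q : R) : 1 <= K -> 1 <= C0 -> bounded_pair K e e' ->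
  0 <= p <= 1 -> 0 <= q <= 1 ->
  gauge e e' p q <= C0 * (crossing p q * `|e - e'|) ->
  (8 * K ^+ 3 * C0)^-1 <= crossing p q.
Proof.
move=> K1 C1 [e1 e1' w1 e2 e2'] /andP[p0 p1] /andP[q0 q1] hg.
set D := crossing p q in hg *.
have K0 : 0 < K by lra.
have w2 : `|e - e'| <= 2 * K by have := ler_normB e e'; lra.
have K30 : 1 <= K ^+ 3 by rewrite exprn_ege1.
have m0 : 0 < 8 * K ^+ 3 * C0 by nra.
rewrite leNgt; apply/negP => small.
have D0 : 0 <= D by rewrite /D /crossing addr_ge0 // mulr_ge0 // subr_ge0.
have small' : D * (8 * K ^+ 3 * C0) < 1 by rewrite -ltr_pdivlMr // div1r.
have DK : D * (8 * K ^+ 2) < 1.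
  apply: le_lt_trans small'; apply: ler_wpM2l => //.
  have : K ^+ 2 <= K ^+ 3 by rewrite ler_weXn2l.
  have : 0 <= K ^+ 2 by rewrite exprn_ge0 // ltW.
  by nra.
have D8 : D < 1 / 8.
  have : D * 8 <= D * (8 * K ^+ 2) by apply: ler_wpM2l => //; have := exprn_ege1 2 K1; lra.
  by lra.
have Kinv : K^-1 * K = 1 by rewrite mulVf // gt_eqF.
have Ki0 : 0 < K^-1 by rewrite invr_gt0.
have D4 : 2 * D * (1 + K) <= K^-1 / 2.
  rewrite -(ler_pM2r K0) [leRHS]mulrAC Kinv.
  have : D * K <= D * K ^+ 2 by apply: ler_wpM2l => //; rewrite expr2 ler_peMl // ltW.
  by move: DK; rewrite expr2; nra.
have far1 : K^-1 / 2 <= `|p - e * (1 - p)| /\ K^-1 / 2 <= `|(1 - q) * e' + q|.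
  have DE : D = (1 - q) * p + q * (1 - p) by [].
  have [ph|ph] := leP p (1 / 2).
    have q2 : q <= 2 * D by clear -D8 DE p0 ph q0 q1; nra.
    have p2 : p <= 2 * D by clear -D8 DE q2 p0 ph q0 q1; nra.
    split.
      have : `|e| <= `|p - e * (1 - p)| + p * (1 + K).
        have E : e = p * (1 + e) - (p - e * (1 - p)) by ring.
        rewrite {1}E; apply: (le_trans (ler_normB _ _)); rewrite addrC lerD2l.
        rewrite normrM (ger0_norm p0) ler_wpM2l //.
        by apply: (le_trans (ler_normD _ _)); rewrite normr1 lerD2l.
      by clear -p2 D4 K0 e1; nra.
    have : `|e'| <= `|(1 - q) * e' + q| + q * (1 + K).
      have E : e' = ((1 - q) * e' + q) - q * (1 - e') by ring.
      rewrite {1}E; apply: (le_trans (ler_normB _ _)); rewrite lerD2l.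
      rewrite normrM (ger0_norm q0) ler_wpM2l //.
      by apply: (le_trans (ler_normB _ _)); rewrite normr1 lerD2l.
    by clear -q2 D4 K0 e1'; nra.
  have q2 : 1 - q <= 2 * D by clear -D8 DE p0 p1 ph q0 q1; nra.
  have p2 : 1 - p <= 2 * D by clear -D8 DE q2 p0 p1 ph q0 q1; nra.
  have Ki1 : K^-1 <= 1 by rewrite invf_le1.
  split.
    have : 1 <= `|p - e * (1 - p)| + (1 - p) * (1 + K).
      have E : 1 = (p - e * (1 - p)) + (1 - p) * (1 + e) by ring.
      rewrite -[X in X <= _]normr1 [X in `|X| <= _]E.
      apply: (le_trans (ler_normD _ _)); rewrite lerD2l normrM ger0_norm ?subr_ge0 //.
      apply: ler_wpM2l; first by rewrite subr_ge0.
      by apply: (le_trans (ler_normD _ _)); rewrite normr1 lerD2l.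
    by clear -p2 D4 K0 Ki1; nra.
  have : 1 <= `|(1 - q) * e' + q| + (1 - q) * (1 + K).
    have E : 1 = ((1 - q) * e' + q) + (1 - q) * (1 - e') by ring.
    rewrite -[X in X <= _]normr1 [X in `|X| <= _]E.
    apply: (le_trans (ler_normD _ _)); rewrite lerD2l normrM ger0_norm ?subr_ge0 //.
    apply: ler_wpM2l; first by rewrite subr_ge0.
    by apply: (le_trans (ler_normB _ _)); rewrite normr1 lerD2l.
  by clear -q2 D4 K0 Ki1; nra.
have [f1 f2] := far1.
have g1 : K^-1 / 2 * (K^-1 / 2) <= gauge e e' p q by apply: ler_pM => //; rewrite divr_ge0 // ltW.
have g2 : gauge e e' p q <= C0 * (D * (2 * K)).
  apply: (le_trans hg); apply: ler_wpM2l; first exact: le_trans ler01 C1.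
  exact: ler_wpM2l.
have g3 := le_trans g1 g2.
have : K^-1 / 2 * (K^-1 / 2) * (4 * K ^+ 2) <= C0 * (D * (2 * K)) * (4 * K ^+ 2).
  by apply: ler_wpM2r => //; rewrite mulr_ge0 // exprn_ge0 // ltW.
have -> : K^-1 / 2 * (K^-1 / 2) * (4 * K ^+ 2) = (K^-1 * K) ^+ 2 by field; rewrite gt_eqF.
rewrite Kinv expr1n.
have -> : C0 * (D * (2 * K)) * (4 * K ^+ 2) = D * (8 * K ^+ 3 * C0) by ring.
by rewrite leNgt small'.
Qed.

Lemma gauge_continuous (K C0 eps : R) : 1 <= K -> 1 <= C0 -> 0 < eps ->
  exists2 rho, 0 < rho & forall e e' p q p' q' h, bounded_pair K e e' ->
  0 <= p <= 1 -> 0 <= q <= 1 -> 0 <= p' <= 1 -> 0 <= q' <= 1 ->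
  `|p - p'| <= rho -> `|q - q'| <= rho -> 0 <= h <= C0 ->
  gauge e e' p q = h * (crossing p q * `|e - e'|) ->
  gauge e e' p' q' <= (h + eps) * (crossing p' q' * `|e - e'|).
Proof.
move=> K1 C1 eps0.
pose m0 := (8 * K ^+ 3 * C0)^-1.
have K0 : 0 < K by lra.
have K30 : 1 <= K ^+ 3 by rewrite exprn_ege1.
have m00 : 0 < m0 by rewrite invr_gt0; nra.
pose L := 2 * K * C0 + K * (1 + K).
have L0 : 0 < L by rewrite /L; nra.
pose rho := Num.min (m0 / 4) (eps * m0 / (4 * K * L)).
have KL0 : 0 < 4 * K * L by nra.
exists rho.
  by rewrite lt_min; apply/andP; split; apply: divr_gt0 => //; apply: mulr_gt0.
move=> e e' p q p' q' h be hp hq hp' hq' pp qq /andP[h0 hC] hg.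
have rho1 : rho <= m0 / 4 by rewrite ge_min lexx.
have rho2 : rho * (4 * K * L) <= eps * m0.
  by rewrite -ler_pdivlMr // ge_min lexx orbT.
have lowD : m0 <= crossing p q.
  apply: (crossing_lower K1 C1 be hp hq); rewrite hg; apply: ler_wpM2r => //.
  move: hp hq => /andP[? ?] /andP[? ?].
  by rewrite mulr_ge0 // /crossing addr_ge0 // mulr_ge0 // subr_ge0.
have [e1 e1' w1 e2 e2'] := be.
have w2 : `|e - e'| <= 2 * K by have := ler_normB e e'; clear -e2 e2'; lra.
move: hp hq hp' hq' => /andP[p0 p1] /andP[q0 q1] /andP[p'0 p'1] /andP[q'0 q'1].
have cr : `|crossing p q - crossing p' q'| <= 2 * rho.
  have -> : crossing p q - crossing p' q' = (1 - 2 * q) * (p - p') + (1 - 2 * p') * (q - q').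
    by rewrite /crossing; ring.
  apply: (le_trans (ler_normD _ _)); rewrite !normrM.
  have : `|1 - 2 * q| <= 1 by rewrite ler_norml; clear -q0 q1; apply/andP; split; lra.
  have : `|1 - 2 * p'| <= 1 by rewrite ler_norml; clear -p'0 p'1; apply/andP; split; lra.
  by have := normr_ge0 (p - p'); have := normr_ge0 (q - q'); clear -pp qq; nra.
have ga : gauge e e' p' q' <= gauge e e' p q + 2 * K * (1 + K) * rho.
  rewrite /gauge.
  have b1 : `|p' - e * (1 - p')| <= `|p - e * (1 - p)| + (1 + K) * rho.
    have -> : p' - e * (1 - p') = p - e * (1 - p) - (1 + e) * (p - p') by ring.
    apply: (le_trans (ler_normB _ _)); rewrite lerD2l normrM.
    have : `|1 + e| <= 1 + K by apply: (le_trans (ler_normD _ _)); rewrite normr1 lerD2l.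
    by move=> ?; apply: ler_pM.
  have b2 : `|(1 - q') * e' + q'| <= `|(1 - q) * e' + q| + (1 + K) * rho.
    have -> : (1 - q') * e' + q' = (1 - q) * e' + q - (1 - e') * (q - q') by ring.
    apply: (le_trans (ler_normB _ _)); rewrite lerD2l normrM.
    have : `|1 - e'| <= 1 + K by apply: (le_trans (ler_normB _ _)); rewrite normr1 lerD2l.
    by move=> ?; apply: ler_pM.
  have b3 : `|p - e * (1 - p)| <= K.
    apply: (le_trans (ler_normB _ _)); rewrite normrM (ger0_norm p0) (@ger0_norm _ (1 - p)) ?subr_ge0 //.
    by clear -p0 p1 e2 K1; nra.
  have b4 : `|(1 - q') * e' + q'| <= K.
    apply: (le_trans (ler_normD _ _)); rewrite normrM (ger0_norm q'0) (@ger0_norm _ (1 - q')) ?subr_ge0 //.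
    by clear -q'0 q'1 e2' K1; nra.
  have r0 : 0 <= rho by apply: le_trans pp.
  have := normr_ge0 (p - e * (1 - p)); have := normr_ge0 ((1 - q') * e' + q').
  have := normr_ge0 ((1 - q) * e' + q); have := normr_ge0 (p' - e * (1 - p')).
  move: b1 b2 b3 b4; set A' := `|p' - _|; set B' := `|(1 - q') * _ + _|.
  set A := `|p - _|; set B := `|_ + q| => b1 b2 b3 b4 *.
  have t1 : A' * B' <= (A + (1 + K) * rho) * B' by apply: ler_wpM2r.
  have t2 : A * B' <= A * (B + (1 + K) * rho) by apply: ler_wpM2l.
  have Kr : 0 <= (1 + K) * rho by rewrite mulr_ge0 // addr_ge0 // ltW.
  have t3 : (1 + K) * rho * B' <= (1 + K) * rho * K by apply: ler_wpM2l.
  have t4 : A * ((1 + K) * rho) <= K * ((1 + K) * rho) by apply: ler_wpM2r.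
  by clear -t1 t2 t3 t4; lra.
have Dd : crossing p q <= crossing p' q' + 2 * rho.
  by move: cr; rewrite ler_norml => /andP[c1 c2]; clear -c1 c2; lra.
apply: (le_trans ga); rewrite hg.
have D'0 : m0 / 2 <= crossing p' q' by clear -lowD Dd rho1; lra.
have w0 : 0 <= `|e - e'| by [].
have t1 : h * (crossing p q * `|e - e'|) <= h * (crossing p' q' * `|e - e'|) + h * (2 * rho * `|e - e'|).
  by rewrite -mulrDr -mulrDl ler_wpM2l // ler_wpM2r.
have r0 : 0 <= rho by apply: le_trans pp.
have t2 : h * (2 * rho * `|e - e'|) <= C0 * (2 * rho * (2 * K)).
  by apply: ler_pM => //; [rewrite !mulr_ge0|apply: ler_wpM2l => //; exact: mulr_ge0].
have t3 : eps * (m0 / 2 * K^-1) <= eps * (crossing p' q' * `|e - e'|).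
  rewrite ler_wpM2l ?(ltW eps0) //; apply: ler_pM => //; first by rewrite divr_ge0 // ltW.
  by rewrite invr_ge0 ltW.
have t4 : C0 * (2 * rho * (2 * K)) + 2 * K * (1 + K) * rho <= eps * (m0 / 2 * K^-1).
  have -> : eps * (m0 / 2 * K^-1) = eps * m0 / (2 * K) by field; rewrite gt_eqF.
  rewrite ler_pdivlMr ?mulr_gt0 //.
  apply: le_trans rho2; rewrite le_eqVlt; apply/orP; left; apply/eqP.
  by rewrite /L; ring.
rewrite [leRHS]mulrDl; apply: le_trans (lerD (lexx _) (le_trans t4 t3)).
by clear t3 t4; rewrite addrA lerD2r; apply: (le_trans t1); rewrite lerD2l.
Qed.

End Windows.

(** * Bounds on integral forms *)

Section ReducedForms.
Variable R : realType.
Implicit Types (A B C D : int) (e U W c d N : R).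

Lemma conj_pair_neq A B C e e' (r : int) : conj_pair A B C e e' -> e != r%:~R.
Proof. by move=> [_ _ _ eirr _]; apply/eqP => h; apply: eirr; rewrite h; apply: rational_int. Qed.

(** The product of the roots is [C / A], and their sum and their difference are
    controlled by the discriminant. *)
Lemma conj_pair_bounded A B C e e' N : conj_pair A B C e e' ->
  1 <= N -> (B ^+ 2 - 4 * A * C)%:~R <= N -> `|A%:~R| <= N -> `|C%:~R| <= N ->
  bounded_pair (2 * N ^+ 2) e e'.
Proof.
move=> h N1 DN AN CN; have disc := conj_pair_disc h.
have hs := conj_pair_sym h; have N0 : 0 < N := lt_le_trans ltr01 N1; have [A0 sm pr eirr ee'] := h.
have e0 : e != 0 by exact: (conj_pair_neq 0 h).
have e'0 : e' != 0 by exact: (conj_pair_neq 0 hs).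
have A1 : 1 <= `|A%:~R| :> R by exact: intr_norm_ge1.
have C1 : 1 <= `|C%:~R| :> R.
  by apply: intr_norm_ge1; rewrite -(intr_eq0 R) -pr !mulf_neq0 ?intr_eq0.
have D1 : 1 <= (B ^+ 2 - 4 * A * C)%:~R :> R.
  have : 0 < (B ^+ 2 - 4 * A * C)%:~R :> R.
    by rewrite -disc exprn_even_gt0 //= mulf_neq0 ?intr_eq0 // subr_eq0.
  by rewrite ltr0z ler1z gtz0_ge1.
set w := `|e - e'|; set sg := `|e + e'|.
have w2 : (`|A%:~R| * w) ^+ 2 = (B ^+ 2 - 4 * A * C)%:~R.
  by rewrite /w -normrM real_normK ?num_real.
have s2 : (`|A%:~R| * sg) ^+ 2 = B%:~R ^+ 2.
  by rewrite /sg -normrM sm normrN real_normK ?num_real.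
have BE : B%:~R ^+ 2 <= N + 4 * (N * N).
  have -> : B%:~R ^+ 2 = (B ^+ 2 - 4 * A * C)%:~R + 4 * (A%:~R * C%:~R) :> R.
    by rewrite rmorphB rmorphXn /= !rmorphM /= -[4%:~R]/(4%:R); ring.
  apply: lerD => //; rewrite ler_pM2l //; apply: (le_trans (ler_norm _)).
  by rewrite normrM ler_pM.
have w0 : 0 <= w by exact: normr_ge0.
have sg0 : 0 <= sg by exact: normr_ge0.
have Aw : 1 <= `|A%:~R| * w.
  by rewrite -ler_sqr ?nnegrE ?ler01 ?mulr_ge0 // expr1n w2.
have wlow : 1 <= N * w by apply: (le_trans Aw); apply: ler_wpM2r.
have wup : w <= N.
  have Aw2 : w <= `|A%:~R| * w by rewrite ler_peMl.
  have : (`|A%:~R| * w) ^+ 2 <= N ^+ 2.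
    by rewrite w2; apply: (le_trans DN); rewrite expr2 ler_peMl // ltW.
  by rewrite ler_sqr ?nnegrE ?mulr_ge0 ?(ltW N0) //; exact: le_trans.
have sup : sg <= 3 * N.
  have As : sg <= `|A%:~R| * sg by rewrite ler_peMl.
  have : (`|A%:~R| * sg) ^+ 2 <= (3 * N) ^+ 2.
    by rewrite s2; apply: (le_trans BE); rewrite exprMn expr2; clear -N1; nra.
  by rewrite ler_sqr ?nnegrE ?mulr_ge0 ?(ltW N0) //; exact: le_trans.
have eup : `|e| <= 2 * N.
  have -> : e = (e + e') / 2 + (e - e') / 2 by field.
  apply: (le_trans (ler_normD _ _)); rewrite !normrM (@ger0_norm _ 2^-1) ?invr_ge0 //.
  by rewrite -/sg -/w; clear -sup wup; lra.
have e'up : `|e'| <= 2 * N.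
  have -> : e' = (e + e') / 2 - (e - e') / 2 by field.
  apply: (le_trans (ler_normB _ _)); rewrite !normrM (@ger0_norm _ 2^-1) ?invr_ge0 //.
  by rewrite -/sg -/w; clear -sup wup; lra.
have prod : 1 <= N * (`|e| * `|e'|).
  apply: (le_trans C1); rewrite -pr normrM normrM.
  by apply: ler_wpM2r => //; rewrite mulr_ge0.
have N2 : N <= N ^+ 2 by rewrite expr2 ler_peMl // ltW.
have NN : 0 < 2 * N ^+ 2 by rewrite mulr_gt0 // exprn_gt0.
split.
- rewrite -div1r ler_pdivrMr //; apply: (le_trans prod).
  have -> : `|e| * (2 * N ^+ 2) = N * `|e| * (2 * N) by ring.
  by rewrite [leLHS]mulrA; apply: ler_wpM2l => //; rewrite mulr_ge0 // ltW.
- rewrite -div1r ler_pdivrMr //; apply: (le_trans prod).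
  have -> : `|e'| * (2 * N ^+ 2) = N * `|e'| * (2 * N) by ring.
  by rewrite [leLHS]mulrA [leLHS]mulrAC; apply: ler_wpM2l => //; rewrite mulr_ge0 // ltW.
- by rewrite -div1r ler_pdivrMr //; rewrite -/w; clear -wlow w0 N2 N1; nra.
- by clear -eup N2; lra.
- by clear -e'up N2; lra.
Qed.

Lemma int_product_bounded (A C : int) N : A != 0 -> C != 0 -> `|A%:~R * C%:~R| <= N ->
  `|A%:~R| <= N /\ `|C%:~R| <= N :> R.
Proof.
move=> A0 C0; have := intr_norm_ge1 R A0; have := intr_norm_ge1 R C0.
by rewrite normrM => *; split; nra.
Qed.

(** Here [A * C] is negative, hence [4 * |A * C| <= B ^ 2 - 4 * A * C]. *)
Lemma conj_pair_opposite_bounded A B C e e' : conj_pair A B C e e' -> e * e' < 0 ->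
  let N := (B ^+ 2 - 4 * A * C)%:~R : R in `|A%:~R| <= N /\ `|C%:~R| <= N.
Proof.
move=> h ee /=; have hs := conj_pair_sym h; have [A0 sm pr eirr _] := h.
have e0 : e != 0 by exact: (conj_pair_neq 0 h).
have e'0 : e' != 0 by exact: (conj_pair_neq 0 hs).
have C0 : C != 0 by rewrite -(intr_eq0 R) -pr !mulf_neq0 ?intr_eq0.
apply: int_product_bounded => //.
have AC : A%:~R * C%:~R <= 0 :> R.
  by rewrite -pr mulrA -expr2 mulr_ge0_le0 ?ltW // ?exprn_even_ge0 // exprn_even_gt0 // intr_eq0.
rewrite ler0_norm // rmorphB rmorphXn /= !rmorphM /= -[4%:~R]/(4%:R) -mulrA.
by have := sqr_ge0 (B%:~R : R); lra.
Qed.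

(** When the line from the past towards [U / W] leaves the cell on the side of
    infinity while the conjugate pair does not follow it, the values of the
    form at the three vertices 0, 1 and infinity are bounded. *)
Lemma splitting_bounded A B C e e' U W c d (C0 : R) : conj_pair A B C e e' ->
  0 < e -> 0 < e' -> (e < 1) || (e' < 1) -> 0 < W -> W < U -> 0 <= c -> 0 <= d ->
  0 < c * U + d * W -> 1 <= C0 ->
  `|U - e * W| * (c * e' + d) <= C0 * (`|e - e'| * (c * U + d * W)) ->
  `|U - e' * W| * (c * e + d) <= C0 * (`|e - e'| * (c * U + d * W)) ->
  let N := 5 * C0 ^+ 2 * (B ^+ 2 - 4 * A * C)%:~R in `|A%:~R| <= N /\ `|C%:~R| <= N.
Proof.
move=> h e0 e'0 e1 W0 WU c0 d0 cd C1 h1 h2 /=.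
have hs := conj_pair_sym h; have disc := conj_pair_disc h; have [A0 sm pr eirr ee'] := h.
set D : R := (B ^+ 2 - 4 * A * C)%:~R in disc *.
have D0 : 0 <= D by rewrite -disc sqr_ge0.
have C2 : 1 <= C0 ^+ 2 by rewrite exprn_ege1.
have DE : D = B%:~R ^+ 2 - 4 * (A%:~R * C%:~R).
  by rewrite /D rmorphB rmorphXn /= !rmorphM /= -[4%:~R]/(4%:R) -mulrA.
have ne1 : e != 1 by exact: (conj_pair_neq 1 h).
have ne1' : e' != 1 by exact: (conj_pair_neq 1 hs).
pose F := A + B + C.
have FE : F%:~R = A%:~R * ((1 - e) * (1 - e')) :> R.
  by rewrite /F !rmorphD /= -pr -[B%:~R]opprK -sm; ring.
have Cn0 : C != 0 by rewrite -(intr_eq0 R) -pr !mulf_neq0 ?intr_eq0 // gt_eqF.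
have Fn0 : F != 0.
  by rewrite -(intr_eq0 R) FE !mulf_neq0 ?intr_eq0 // subr_eq0 eq_sym.
have A20 : 0 < A%:~R ^+ 2 :> R by rewrite exprn_even_gt0 // intr_eq0.
have FR : F%:~R = A%:~R + B%:~R + C%:~R :> R by rewrite /F !rmorphD.
have [sep|nsep] := ltP ((1 - e) * (1 - e')) 0.
  have AF : A%:~R * F%:~R <= 0 :> R.
    by rewrite FE mulrA -expr2 mulr_ge0_le0 ?ltW.
  have CF : C%:~R * F%:~R <= 0 :> R.
    rewrite FE -pr; have -> : A%:~R * (e * e') * (A%:~R * ((1 - e) * (1 - e'))) =
      A%:~R ^+ 2 * (e * e') * ((1 - e) * (1 - e')) by ring.
    by rewrite mulr_ge0_le0 ?ltW // mulr_gt0 // mulr_gt0.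
  (* moving the vertex 1 to 0 gives [D = (B + 2 A) ^ 2 - 4 A F] *)
  have [hA _] : `|A%:~R| <= D /\ `|F%:~R| <= D :> R.
    apply: int_product_bounded => //; rewrite ler0_norm // DE.
    by have := sqr_ge0 (B%:~R + 2 * A%:~R : R); move: AF; rewrite FR; clear -A0; nra.
  have [hC _] : `|C%:~R| <= D /\ `|F%:~R| <= D :> R.
    apply: int_product_bounded => //; rewrite ler0_norm // DE.
    by have := sqr_ge0 (B%:~R + 2 * C%:~R : R); move: CF; rewrite FR; clear -A0; nra.
  have DN : D <= 5 * C0 ^+ 2 * D by rewrite ler_peMl //; clear -C2; lra.
  by split; apply: le_trans DN.
have [lt1 lt1'] : e < 1 /\ e' < 1.
  move: e1 => /orP[e1|e1]; split=> //; rewrite lt_neqAle ?ne1 ?ne1' /= leNgt;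
    apply/negP => e2; move: nsep; rewrite leNgt => /negP; apply; clear -e1 e2; nra.
set T := c * U + d * W in cd h1 h2.
have key f f' : 0 < f -> f < 1 -> 0 < f' -> f' < 1 ->
    (1 - f) * f' * T <= `|U - f * W| * (c * f' + d).
  move=> f0 f1 f'0 f'1.
  have p1 : (1 - f) * U <= U - f * W by clear -f0 f1 W0 WU; nra.
  have p2 : (1 - f) * W <= U - f * W by clear -f0 f1 W0 WU; nra.
  rewrite ger0_norm; last by clear -p1 f1 W0 WU; nra.
  have q1 : (1 - f) * U * (c * f') <= (U - f * W) * (c * f').
    by apply: ler_wpM2r => //; rewrite mulr_ge0 // ltW.
  have q2 : (1 - f) * W * d <= (U - f * W) * d by apply: ler_wpM2r.
  have q3 : (1 - f) * W * d * f' <= (1 - f) * W * d.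
    by apply: ler_piMr; [rewrite !mulr_ge0 ?subr_ge0 // ltW|exact: ltW].
  by rewrite /T; clear -q1 q2 q3; lra.
have k1 : (1 - e) * e' <= C0 * `|e - e'|.
  rewrite -(ler_pM2r cd); apply: (le_trans (key _ _ e0 lt1 e'0 lt1')).
  by rewrite -mulrA.
have k2 : (1 - e') * e <= C0 * `|e - e'|.
  rewrite -(ler_pM2r cd); apply: (le_trans (key _ _ e'0 lt1' e0 lt1)).
  by rewrite -mulrA.
(* multiplying both estimates bounds the product of the values at 0 and 1 *)
pose P := C0 ^+ 2 * D.
have CF : `|C%:~R * F%:~R| <= P :> R.
  have -> : C%:~R * F%:~R = A%:~R ^+ 2 * ((1 - e) * e' * ((1 - e') * e)) :> R.
    by rewrite FE -pr; ring.
  rewrite normrM (ger0_norm (ltW A20)) ger0_norm; last first.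
    by rewrite !mulr_ge0 ?subr_ge0 ?ltW.
  have -> : P = A%:~R ^+ 2 * (C0 * `|e - e'| * (C0 * `|e - e'|)).
    by rewrite /P -disc -[in LHS](real_normK (num_real (_ * _))) normrM exprMn
      real_normK ?num_real //; ring.
  apply: ler_wpM2l; first exact: ltW.
  by apply: ler_pM => //; rewrite mulr_ge0 ?subr_ge0 ?ltW.
have [hC hF] := int_product_bounded Cn0 Fn0 CF.
have P0 : 0 <= P by rewrite /P mulr_ge0 // sqr_ge0.
have DP : D <= P by rewrite /P ler_peMl.
have PE : 5 * C0 ^+ 2 * D = 5 * P by rewrite /P; ring.
rewrite PE; split; last by clear -hC P0; lra.
have quad : A%:~R ^+ 2 <= `|A%:~R| * (4 * P) + D :> R.
  have -> : A%:~R ^+ 2 = A%:~R * (2 * (F%:~R + C%:~R)) - (F%:~R - C%:~R) ^+ 2 + D :> R.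
    by rewrite DE FR; ring.
  rewrite lerD2r; have := sqr_ge0 (F%:~R - C%:~R : R).
  have : A%:~R * (2 * (F%:~R + C%:~R)) <= `|A%:~R| * (4 * P) :> R.
    apply: (le_trans (ler_norm _)); rewrite normrM ler_wpM2l // normrM ger0_norm //.
    by have := ler_normD (F%:~R : R) C%:~R; clear -hC hF; lra.
  by clear -D0; lra.
have A1 : 1 <= `|A%:~R| :> R by exact: intr_norm_ge1.
rewrite -(real_normK (num_real (A%:~R : R))) in quad.
rewrite leNgt; apply/negP => big.
have : `|A%:~R| * (5 * P) < `|A%:~R| ^+ 2 :> R by rewrite expr2 ltr_pM2l // (lt_le_trans ltr01 A1).
have : P <= `|A%:~R| * P :> R by rewrite ler_peMl.
by clear -quad DP; lra.
Qed.

End ReducedForms.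

(** * Reading the orbit through the coding *)

Section OrbitCoding.
Variables (R : realType) (alpha0 : R).
Hypothesis halpha0 : quadratic_irrational alpha0.
Local Notation E := (quad_orbit alpha0).
Local Notation sg := (@galois_conj R).
Implicit Types (x y b e : R) (m : int) (s : nat -> bool) (k : nat).

Definition code_map m s k e : R :=
  ((topl m s k)%:~R * e + (topr m s k)%:~R) / ((botl s k)%:~R * e + (botr s k)%:~R).

Definition code_inv m s k y : R := cnum m s y k / cden m s y k.

Lemma code_map_denom s k e : ~ rational e -> (botl s k)%:~R * e + (botr s k)%:~R != 0.
Proof. by move=> ei; apply: irrational_affine_neq0 => //; have := bot_ge s k; lia. Qed.

Lemma orbit_code_map m s k e : E e -> E (code_map m s k e) /\
  sg (code_map m s k e) = code_map m s k (sg e).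
Proof.
move=> Ee; have det := code_det m s k; split.
  exact: quad_orbit_moebius.
exact: (galois_conj_moebius halpha0 Ee det).
Qed.

Lemma orbit_code_inv m s k b : E b -> [/\ E (code_inv m s k b),
  sg (code_inv m s k b) = code_inv m s k (sg b) & code_map m s k (code_inv m s k b) = b].
Proof.
move=> Eb; have Eb' := quad_orbit_conj halpha0 Eb.
have det : botr s k * topl m s k - (- topr m s k) * (- botl s k) = 1.
  by rewrite -(code_det m s k); ring.
have invE y : code_inv m s k y =
    ((botr s k)%:~R * y + (- topr m s k)%:~R) / ((- botl s k)%:~R * y + (topl m s k)%:~R).
  by rewrite /code_inv /cnum /cden !rmorphN /= mulNr [- _ + _]addrC.
have Ei : E (code_inv m s k b) by rewrite invE; exact: quad_orbit_moebius.
split=> //; first by rewrite !invE (galois_conj_moebius halpha0 Eb det).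
have bi := quad_orbit_irr halpha0 Eb.
have d0 : cden m s b k != 0.
  have -> : cden m s b k = (- botl s k)%:~R * b + (topl m s k)%:~R.
    by rewrite /cden rmorphN /=; ring.
  apply: irrational_affine_neq0 => //; rewrite -negb_and; apply/negP => /andP[/eqP e1 /eqP e2].
  by move: det; rewrite e1 e2 !mulr0 subr0.
have botE : (botl s k)%:~R * code_inv m s k b + (botr s k)%:~R = (cden m s b k)^-1.
  apply: (mulIf d0); rewrite mulVf // mulrDl -mulrA divfK //.
  exact: cnum_cden_unit.
have topE : (topl m s k)%:~R * code_inv m s k b + (topr m s k)%:~R = b / cden m s b k.
  apply: (mulIf d0); rewrite divfK // mulrDl -mulrA divfK //.
  exact: (esym (cnum_cdenE m s b k)).
by rewrite /code_map botE topE invrK divfK.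
Qed.

Lemma cnum_code_map m s k e : ~ rational e ->
  cnum m s (code_map m s k e) k = e / ((botl s k)%:~R * e + (botr s k)%:~R).
Proof.
move=> /(code_map_denom s k) d0; have det := code_detR R m s k.
rewrite /cnum /code_map; move: d0 det; move: (topl m s k)%:~R (topr m s k)%:~R (botl s k)%:~R (botr s k)%:~R.
move=> a b c d d0 det.
have -> : d * ((a * e + b) / (c * e + d)) - b = (a * d - b * c) * e / (c * e + d).
  by field.
by rewrite det mul1r.
Qed.

Lemma cden_code_map m s k e : ~ rational e ->
  cden m s (code_map m s k e) k = ((botl s k)%:~R * e + (botr s k)%:~R)^-1.
Proof.
move=> /(code_map_denom s k) d0; have det := code_detR R m s k.
rewrite /cden /code_map; move: d0 det; move: (topl m s k)%:~R (topr m s k)%:~R (botl s k)%:~R (botr s k)%:~R.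
move=> a b c d d0 det.
have -> : a - c * ((a * e + b) / (c * e + d)) = (a * d - b * c) / (c * e + d).
  by field.
by rewrite det mul1r.
Qed.

Lemma in_cell_code_map m s k e : ~ rational e -> 0 < e -> in_cell m s k (code_map m s k e).
Proof.
move=> ei e0; rewrite /in_cell cnum_code_map // cden_code_map //.
have h : 0 < (botl s k)%:~R * e + (botr s k)%:~R.
  have [c d] := bot_ge s k.
  have : 0 <= (botl s k)%:~R * e by rewrite mulr_ge0 ?ler0z // ltW.
  have : 1 <= (botr s k)%:~R :> R by rewrite ler1z.
  by lra.
by rewrite divr_gt0 // invr_gt0.
Qed.

(** The normalised distance to a point of the orbit is invariant under the
    modular group, so that it can be computed in any cell of the coding. *)
Lemma hval_ratio m s x k e : coded m s x -> E e ->
  `|x - code_map m s k e| / `|code_map m s k e - sg (code_map m s k e)| =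
  hval m s x k e (sg e).
Proof.
move=> cx Ee; have [_ sE] := orbit_code_map m s k Ee; rewrite sE.
have ei := quad_orbit_irr halpha0 Ee.
have ei' := quad_orbit_irr halpha0 (quad_orbit_conj halpha0 Ee).
have ee' := quad_orbit_neq halpha0 Ee.
have d0 := code_map_denom s k ei; have d0' := code_map_denom s k ei'.
have det := code_detR R m s k; have unit := cnum_cden_unit m s x k.
have xE := cnum_cdenE m s x k.
rewrite /hval /code_map; move: d0 d0' det unit xE.
move: (cnum m s x k) (cden m s x k) (topl m s k)%:~R (topr m s k)%:~R.
move: (botl s k)%:~R (botr s k)%:~R => c d U W a b d0 d0' det unit xE.
have -> : x - (a * e + b) / (c * e + d) = (U - e * W) / (c * e + d).
  have -> : x - (a * e + b) / (c * e + d) =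
    (x * (c * e + d) - (a * e + b) * 1) / (c * e + d) by field.
  rewrite -[X in (a * e + b) * X]unit {1}xE; congr (_ / _).
  by rewrite -[RHS]mul1r -[X in X * (U - _)]det; ring.
have -> : (a * e + b) / (c * e + d) - (a * sg e + b) / (c * sg e + d) =
   (e - sg e) / ((c * e + d) * (c * sg e + d)).
  rewrite -[X in X / (_ * _)]mul1r -[X in X * (e - _)]det.
  by field; rewrite d0 d0'.
rewrite !normrM !normfV !normrM.
have w0 : `|e - sg e| != 0 by rewrite normr_eq0 subr_eq0.
have n0 : `|c * e + d| != 0 by rewrite normr_eq0.
have n0' : `|c * sg e + d| != 0 by rewrite normr_eq0.
by field; rewrite w0 n0 n0'.
Qed.

(** The points which may appear as translates of good approximations. Their
    images under [g_k], or the conjugates of the images, lie in the cell of rank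
    [k], which makes the widths of the images small. *)
Definition seen (K : R) e : Prop :=
  [/\ E e, (0 < e) \/ (0 < sg e) & bounded_pair K e (sg e)].

Lemma bounded_pair_le (K K' e e' : R) : 0 < K -> K <= K' ->
  bounded_pair K e e' -> bounded_pair K' e e'.
Proof.
move=> K0 KK [h1 h2 h3 h4 h5].
have KV : K'^-1 <= K^-1 by rewrite lef_pV2 // posrE; lra.
by split; lra.
Qed.

Lemma seen_opposite : exists2 K0 : R, 1 <= K0 & forall K e, K0 <= K -> E e ->
  e * sg e < 0 -> seen K e.
Proof.
have [D D0 HD] := quad_orbit_disc halpha0.
have D1 : 1 <= D%:~R :> R by rewrite ler1z; lia.
exists (2 * D%:~R ^+ 2); first by have := exprn_ege1 2 D1; lra.
move=> K e KK Ee ee; have [A [B [C [dE h]]]] := HD e Ee.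
have := conj_pair_opposite_bounded h ee; rewrite dE => -[hA hC].
split=> //.
  have [e0|e0] := ltP 0 e; [by left|right].
  rewrite ltNge; apply/negP => e0'; move: ee; rewrite ltNge => /negP; apply.
  by rewrite mulr_le0.
apply: bounded_pair_le KK _; first by have := exprn_ege1 2 D1; lra.
by apply: conj_pair_bounded h _ _ hA hC => //; rewrite dE.
Qed.

(** The rank [k] is the last one for which the cell contains both [b] and its
    conjugate. The next letter separates one of them from [x], and then
    [splitting_bounded] applies, directly or after exchanging 0 and infinity. *)
Lemma approximation_seen (C0 : R) : 1 <= C0 -> exists2 K0 : R, 1 <= K0 &
  forall m s x, coded m s x -> forall k0, exists2 e0, 0 < e0 &
  forall b, E b -> `|b - sg b| < e0 -> `|x - b| <= C0 * `|b - sg b| ->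
  exists k e, [/\ (k0 <= k)%N, seen K0 e & b = code_map m s k e].
Proof.
move=> C1; have [D D0 HD] := quad_orbit_disc halpha0.
have D1 : 1 <= D%:~R :> R by rewrite ler1z; lia.
have C11 : 1 <= C0 + 1 := ler_wpDr ler01 C1.
pose N : R := 5 * (C0 + 1) ^+ 2 * D%:~R.
have N1 : 1 <= N.
  have : 1 <= (C0 + 1) ^+ 2 by rewrite exprn_ege1.
  by rewrite /N; nra.
have DN : D%:~R <= N.
  have : 1 <= (C0 + 1) ^+ 2 by rewrite exprn_ege1.
  by rewrite /N; nra.
exists (2 * N ^+ 2); first by have := exprn_ege1 2 N1; lra.
move=> m s x cx k0.
have [n0 d0] := cx k0.
have [c0 d1] := bot_ge s k0.
have c0R : 0 <= (botl s k0)%:~R :> R by rewrite ler0z.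
have d1R : 1 <= (botr s k0)%:~R :> R by rewrite ler1z.
pose rho := Num.min (cnum m s x k0 / (botr s k0)%:~R) (cden m s x k0 / ((botl s k0)%:~R + 1)).
have rho0 : 0 < rho by rewrite lt_min !divr_gt0 //; lra.
have near_in y : `|x - y| < rho -> in_cell m s k0 y.
  rewrite lt_min => /andP[h1 h2]; split.
    have -> : cnum m s y k0 = cnum m s x k0 - (botr s k0)%:~R * (x - y) by rewrite /cnum; ring.
    move: h1; rewrite ltr_pdivlMr; last by lra.
    by have := ler_norm (x - y); nra.
  have -> : cden m s y k0 = cden m s x k0 + (botl s k0)%:~R * (x - y) by rewrite /cden; ring.
  move: h2; rewrite ltr_pdivlMr; last by lra.
  by have := ler_norm (y - x); rewrite distrC; have := normr_ge0 (x - y); nra.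
exists (rho / (C0 + 1)); first by rewrite divr_gt0 //; lra.
move=> b Eb bsmall xb.
have w0 := quad_orbit_width_gt0 halpha0 Eb.
have xb' : `|x - sg b| <= (C0 + 1) * `|b - sg b|.
  by have := ler_distD b x (sg b); lra.
have wr : (C0 + 1) * `|b - sg b| < rho by rewrite mulrC -ltr_pdivlMr // (lt_le_trans ltr01 C11).
have inb : in_cell m s k0 b by apply: near_in; clear -wr xb w0; nra.
have inb' : in_cell m s k0 (sg b) by apply: near_in; clear -wr xb'; lra.
have [k1 Hk1] := cell_shrinks cx (divr_gt0 w0 (ltr0n R 2)).
pose both k := `[< in_cell m s k b /\ in_cell m s k (sg b) >].
have ex1 : exists k, ~~ both (k0 + k)%N.
  exists k1; apply/negP => /asboolP[h1 h2].
  have := Hk1 _ (leq_addl _ _) _ h1; have := Hk1 _ (leq_addl _ _) _ h2.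
  by have := ler_distD x b (sg b); rewrite (distrC x (sg b)); clear; lra.
have [[|i] nb imin] := ex_minnP ex1.
  by move: nb => /negP; case; rewrite addn0; apply/asboolP.
have /asboolP[bk bk'] : both (k0 + i)%N.
  by apply/negPn/negP => /imin; rewrite ltnn.
move: nb; rewrite addnS; set k := (k0 + i)%N in bk bk' *.
move=> /asboolPn nb.
exists k, (code_inv m s k b).
have [Ei sE iE] := orbit_code_inv m s k Eb.
split; [exact: leq_addr| |by rewrite iE].
have [nx dx] := cx k; have [nx1 dx1] := cx k.+1.
move: bk bk' => [ub wb] [ub' wb'].
set e := code_inv m s k b in Ei sE iE *.
have epos : 0 < e by rewrite divr_gt0.
have epos' : 0 < sg e by rewrite sE divr_gt0.
split; [exact: Ei|by left|].
have [A [B [C [dE h]]]] := HD e Ei.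
have ei := quad_orbit_irr halpha0 Ei.
have ei' := quad_orbit_irr halpha0 (quad_orbit_conj halpha0 Ei).
have Esb := quad_orbit_conj halpha0 Eb.
have h1 : hval m s x k e (sg e) <= C0 + 1.
  by rewrite -hval_ratio // iE ler_pdivrMr //; clear -xb w0; nra.
have h2 : hval m s x k (sg e) e <= C0 + 1.
  have Esi := quad_orbit_conj halpha0 Ei.
  have := hval_ratio k cx Esi; rewrite (galois_conjK halpha0 Ei) => <-.
  have [_ sE'] := orbit_code_map m s k Ei.
  rewrite -sE' iE (galois_conjK halpha0 Eb) (distrC (sg b)).
  by rewrite ler_pdivrMr.
have ee' := quad_orbit_neq halpha0 Ei.
have we : 0 < `|e - sg e| by rewrite normr_gt0 subr_eq0.
have unit := cnum_cden_unit m s x k.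
have [ck dk] := bot_ge s k.
have ckR : 0 <= (botl s k)%:~R :> R by rewrite ler0z.
have dkR : 0 <= (botr s k)%:~R :> R by rewrite ler0z; exact: (le_trans ler01 dk).
move: h1 h2; rewrite /hval (distrC (sg e) e) !ler_pdivrMr //.
rewrite (@ger0_norm _ ((botl s k)%:~R * sg e + _)); last by rewrite addr_ge0 // mulr_ge0 // ltW.
rewrite (@ger0_norm _ ((botl s k)%:~R * e + _)); last by rewrite addr_ge0 // mulr_ge0 // ltW.
move: nx dx nx1 dx1 unit; rewrite cnumS cdenS.
set U := cnum m s x k; set W := cden m s x k => nx dx nx1 dx1 unit h1 h2.
suff [hA hC] : `|A%:~R| <= N /\ `|C%:~R| <= N.
  by apply: conj_pair_bounded h N1 _ hA hC; rewrite dE.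
have eE : e = cnum m s b k / cden m s b k by [].
have eE' : sg e = cnum m s (sg b) k / cden m s (sg b) k by rewrite sE.
have e1 : e != 1 := conj_pair_neq 1 h.
have e1' : sg e != 1 := conj_pair_neq 1 (conj_pair_sym h).
case sk : (s k) nx1 dx1 => nx1 dx1.
  have := @splitting_bounded R A B C e (sg e) U W (botl s k)%:~R (botr s k)%:~R (C0 + 1) h epos epos'.
  rewrite dE unit !mulr1; apply=> //; try by rewrite -subr_gt0.
  apply/negPn/negP; rewrite negb_or -!leNgt => /andP[g1 g2]; apply: nb.
  rewrite /in_cell !cnumS !cdenS sk; split; split => //; rewrite subr_gt0.
    by move: g1; rewrite le_eqVlt eq_sym (negPf e1) /= eE ltr_pdivlMr // mul1r.
  by move: g2; rewrite le_eqVlt eq_sym (negPf e1') /= eE' ltr_pdivlMr // mul1r.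
have hs : conj_pair C B A e^-1 (sg e)^-1.
  have e0 : e != 0 by rewrite gt_eqF.
  have e0' : sg e != 0 by rewrite gt_eqF.
  have [A0 sm pr _ _] := h; split.
  - by rewrite -(intr_eq0 R) -pr mulf_neq0 ?intr_eq0 // mulf_neq0.
  - by rewrite -pr -sm; field; rewrite e0 e0'.
  - by rewrite -pr; field; rewrite e0 e0'.
  - by move=> /rational_inv; rewrite invrK.
  - by rewrite (inj_eq invr_inj).
have ip : 0 < e^-1 by rewrite invr_gt0.
have ip' : 0 < (sg e)^-1 by rewrite invr_gt0.
have dE' : B ^+ 2 - 4 * C * A = D by rewrite -dE; ring.
have wI : `|e^-1 - (sg e)^-1| = `|e - sg e| / (e * sg e).
  have -> : e^-1 - (sg e)^-1 = - ((e - sg e) / (e * sg e)).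
    by field; rewrite !gt_eqF.
  by rewrite normrN normrM normfV (@gtr0_norm _ (e * _)) // mulr_gt0.
have tI (f f' : R) (c d : R) : 0 < f -> 0 < f' ->
   `|W - f^-1 * U| * (d * f'^-1 + c) = `|U - f * W| * (c * f' + d) / (f * f').
  move=> f0 f'0; have -> : W - f^-1 * U = - ((U - f * W) / f) by field; rewrite gt_eqF.
  rewrite normrN normrM normfV (gtr0_norm f0); field.
  by rewrite !gt_eqF.
have ee0 : 0 < e * sg e by rewrite mulr_gt0.
have := @splitting_bounded R C B A e^-1 (sg e)^-1 W U (botr s k)%:~R (botl s k)%:~R (C0 + 1) hs ip ip'.
rewrite dE' [_ * W + _]addrC unit !mulr1 => H.
suff : `|C%:~R| <= N /\ `|A%:~R| <= N by case.
apply: H => //; try by rewrite -subr_gt0.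
- apply/negPn/negP; rewrite negb_or -!leNgt => /andP[g1 g2]; apply: nb.
  rewrite /in_cell !cnumS !cdenS sk; split; split => //; rewrite subr_gt0.
    move: g1; rewrite invf_ge1 // le_eqVlt (negPf e1) /= eE ltr_pdivrMr // mul1r //.
  move: g2; rewrite invf_ge1 // le_eqVlt (negPf e1') /= eE' ltr_pdivrMr // mul1r //.
- by rewrite tI // wI [leRHS]mulrA ler_pM2r ?invr_gt0.
- by rewrite tI // wI [leRHS]mulrA [sg e * e]mulrC ler_pM2r ?invr_gt0.
Qed.

End OrbitCoding.

(** * Gluing infinite words *)

Section Gluing.

(** Compactness of the space of bi-infinite words, by an ultrafilter. *)
Lemma pattern_limit (I : Type) (u : nat -> I -> bool) (P : nat -> Prop) :
  (forall N, exists2 k, (N <= k)%N & P k) ->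
  exists S : I -> bool, forall (J : finType) (f : J -> I) N,
    exists k, [/\ (N <= k)%N, P k & forall j, u k (f j) = S (f j)].
Proof.
move=> infP.
pose F : set_system nat := filter_from setT (fun N => [set k | (N <= k)%N /\ P k]).
have FF : ProperFilter F.
  apply: filter_from_proper; last first.
    by move=> N _; have [k Nk Pk] := infP N; exists k.
  apply: filter_from_filter; first by exists 0%N.
  move=> N M _ _; exists (maxn N M) => // k /= [].
  by rewrite geq_max => /andP[? ?] ?.
have [U [UU FU]] := ultraFilterLemma FF.
pose S i := `[< U [set k | u k i] >].
have US i : U [set k | u k i = S i].
  have [h|h] := in_ultra_setVsetC [set k | u k i] UU.
    have -> : S i = true by apply/asboolP.
    by apply: filterS h => k /=.
  have -> : S i = false.
    apply/negbTE/negP => /asboolP h2.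
    have : U set0.
      by rewrite -(setICr [set k | u k i]); exact: filterI.
    exact: filter_not_empty.
  by apply: filterS h => k /= /negP/negbTE.
exists S => J f N.
have : U ([set k | (N <= k)%N /\ P k] `&` [set k | forall j, u k (f j) = S (f j)]).
  apply: filterI; first by apply: FU; exists N.
  by apply: filter_forall => j; exact: US.
by move=> /filter_ex[k [[Nk Pk] h]]; exists k.
Qed.

Definition agree (s s' : nat -> bool) (p q r : nat) : Prop :=
  forall i, (i < r + r)%N -> s (p - r + i)%N = s' (q - r + i)%N.

Section Blocks.
Variables (t : nat -> nat -> bool) (lo len : nat -> nat).
Hypothesis len_gt : forall j, (j < len j)%N.

Fixpoint start j : nat := if j is j'.+1 then (start j' + len j')%N else 0%N.

Fixpoint block p : nat * nat :=
  if p is p'.+1 then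
    let: (j, o) := block p' in
    if (o.+1 < len j)%N then (j, o.+1) else (j.+1, 0%N)
  else (0%N, 0%N).

Definition glued p : bool := let: (j, o) := block p in t j (lo j + o).

Lemma blockP p : p = (start (block p).1 + (block p).2)%N /\
  ((block p).2 < len (block p).1)%N.
Proof.
elim: p => [|p] /=; first by split=> //; exact: len_gt.
case: (block p) => j o /= [pE ol]; case: ltnP => h /=; split=> //.
- by rewrite pE addnS.
- by rewrite addn0 pE -addnS; congr (_ + _)%N; apply/eqP; rewrite eqn_leq ol h.
- exact: leq_ltn_trans (len_gt j.+1).
Qed.

Lemma start_mono i j : (i <= j)%N -> (start i <= start j)%N.
Proof.
move=> /subnKC <-; elim: (j - i)%N => [|k IH]; first by rewrite addn0.
by rewrite addnS /=; apply: (leq_trans IH); exact: leq_addr.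
Qed.

Lemma start_ge j : (j <= start j)%N.
Proof.
elim: j => //= j IH; have := len_gt j; move: IH; clear; lia.
Qed.

Lemma glued_block j o : (o < len j)%N -> glued (start j + o) = t j (lo j + o).
Proof.
move=> ol; rewrite /glued; have := blockP (start j + o).
case: (block _) => j' o' /= [e ol'].
have [jj|jj|jj] := ltngtP j j'.
- have := start_mono jj; rewrite /=; move: e ol ol'; clear; lia.
- have := start_mono jj; rewrite /=; move: e ol ol'; clear; lia.
- by move: e; rewrite -jj => /addnI <-.
Qed.

(** A window starting before or ending after its block continues in a neighbouring
    block, where it still follows the common pattern [S]. *)
Lemma glued_window (S : int -> bool) :
  (forall j, (j <= lo j)%N) ->
  (forall j i, (i < j + j)%N -> t j (lo j - j + i) = S (i%:Z - j%:Z)) ->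
  (forall j i, (i < j + j)%N -> t j (lo j + len j - j + i) = S (i%:Z - j%:Z)) ->
  forall j o r, (r < j)%N -> (o < len j)%N ->
    agree glued (t j) (start j + o) (lo j + o) r.
Proof.
move=> loj tlo thi j o r rj ol i ir.
have sj := start_ge j; have lj := loj j.
have [zneg|zpos] := ltnP (o + i) r.
  case: j => // j in rj ol sj lj zneg *.
  have lenj := len_gt j.
  have -> : (start j.+1 + o - r + i = start j + (len j + o + i - r))%N.
    by rewrite /=; move: sj rj zneg lenj; rewrite /=; clear; lia.
  rewrite glued_block; last by move: zneg rj lenj; clear; lia.
  have -> : (lo j + (len j + o + i - r) = lo j + len j - j + (j + o + i - r))%N.
    by move: zneg rj lenj; clear; lia.
  rewrite thi; last by move: zneg rj; clear; lia.
  have -> : (lo j.+1 + o - r + i = lo j.+1 - j.+1 + (j.+1 + o + i - r))%N.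
    by move: zneg rj lj; clear; lia.
  rewrite tlo; last by move: zneg rj; clear; lia.
  by congr (S _); move: zneg rj; clear; lia.
have pE : (start j + o - r + i = start j + (o + i - r))%N.
  by move: sj rj zpos; clear; lia.
have qE : (lo j + o - r + i = lo j + (o + i - r))%N.
  by move: lj rj zpos; clear; lia.
rewrite pE qE.
have [zin|zout] := ltnP (o + i - r) (len j); first by rewrite glued_block.
have lenj := len_gt j; have lenj1 := len_gt j.+1; have lj1 := loj j.+1.
have -> : (start j + (o + i - r) = start j.+1 + (o + i - r - len j))%N.
  by rewrite /=; move: zout; clear; lia.
rewrite glued_block; last by move: ir ol rj lenj lenj1; clear; lia.
have -> : (lo j.+1 + (o + i - r - len j) = lo j.+1 - j.+1 + (j.+1 + (o + i - r - len j)))%N.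
  by move: lj1; clear; lia.
rewrite tlo; last by move: ir ol rj; clear; lia.
have -> : (lo j + (o + i - r) = lo j + len j - j + (j + (o + i - r - len j)))%N.
  by move: zout lenj; clear; lia.
rewrite thi; last by move: ir ol rj; clear; lia.
by congr (S _); clear; lia.
Qed.

End Blocks.

(** Long pieces of the words [s_ n] are glued along a common limit pattern, so
    that every long window of the result is a window of some [s_ n]. *)
Lemma gluing (s_ : nat -> nat -> bool) (G : nat -> nat -> Prop) (K : nat -> nat) :
  (forall n N, exists2 k, (N <= k)%N & G n k) ->
  exists s, (forall r, exists P, forall p, (P <= p)%N -> exists n q,
      [/\ (r <= n)%N, (K n <= q)%N, (r <= q)%N, (r <= p)%N & agree s (s_ n) p q r]) /\
    (forall r P, exists p n q, [/\ (P <= p)%N, (r <= n)%N & G n q] /\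
      [/\ (r <= q)%N, (r <= p)%N & agree s (s_ n) p q r]).
Proof.
move=> infG.
pose u n k (z : int) := s_ n `|(k%:Z + z)%R|%N.
have /choice[S HS] : forall n, exists S : int -> bool, forall (J : finType) (f : J -> int) N,
    exists k, [/\ (N <= k)%N, G n k & forall j, u n k (f j) = S (f j)].
  by move=> n; exact: pattern_limit (infG n).
have HSw n r N : exists k, [/\ (N <= k)%N, G n k, (r <= k)%N &
    forall i, (i < r + r)%N -> s_ n (k - r + i)%N = S n (i%:Z - r%:Z)].
  have [k [Nk Gk Hk]] := HS n 'I_(r + r) (fun i => i%:Z - r%:Z) (maxn N r).
  exists k; split=> //; [lia|lia|move=> i ir].
  rewrite -(Hk (Ordinal ir)) /u /=; congr (s_ n _); move: Nk; clear; lia.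
have [T HT] := @pattern_limit int S (fun _ => True) (fun N => ex_intro2 _ _ N (leqnn N) I).
have /choice[nn Hnn] : forall j, exists n, (j <= n)%N /\
    forall i, (i < j + j)%N -> S n (i%:Z - j%:Z) = T (i%:Z - j%:Z).
  move=> j; have [n [jn _ Hn]] := HT 'I_(j + j) (fun i => i%:Z - j%:Z) j.
  by exists n; split=> // i ij; exact: (Hn (Ordinal ij)).
have /choice[lo Hlo] : forall j, exists k, [/\ (K (nn j) + j <= k)%N, G (nn j) k &
    forall i, (i < j + j)%N -> s_ (nn j) (k - j + i)%N = T (i%:Z - j%:Z)].
  move=> j; have [k [Kk Gk _ Hk]] := HSw (nn j) j (K (nn j) + j)%N.
  exists k; split=> // i ij; rewrite Hk //; exact: (Hnn j).2.
have /choice[len Hlen] : forall j, exists l, (j < l)%N /\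
    forall i, (i < j + j)%N -> s_ (nn j) (lo j + l - j + i)%N = T (i%:Z - j%:Z).
  move=> j; have [k [Kk _ _ Hk]] := HSw (nn j) j (lo j + j.+1)%N.
  exists (k - lo j)%N; split; first by move: Kk; clear; lia.
  move=> i ij; rewrite subnKC; last by move: Kk; clear; lia.
  rewrite Hk //; exact: (Hnn j).2.
pose t j := s_ (nn j).
have len_gt j : (j < len j)%N := (Hlen j).1.
have loj j : (j <= lo j)%N by have [h _ _] := Hlo j; move: h; clear; lia.
have W := @glued_window t lo len len_gt T loj _ _.
have {}W : forall j o r, (r < j)%N -> (o < len j)%N ->
    agree (glued t lo len) (t j) (start len j + o) (lo j + o) r.
  apply: W => j i ij; first by have [_ _ h] := Hlo j; exact: h.
  by have [_ h] := Hlen j; exact: h.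
exists (glued t lo len); split=> [r|r P].
  exists (start len r.+1) => p Pp.
  have [pE ol] := blockP len_gt p.
  set j := (block len p).1 in pE ol; set o := (block len p).2 in pE ol.
  have rj : (r < j)%N.
    rewrite ltnNge; apply/negP => jr; have := start_mono len jr.
    have : (start len j.+1 <= start len r.+1)%N by exact: start_mono.
    by move: pE ol Pp; rewrite /=; clear; lia.
  exists (nn j), (lo j + o)%N; have [h _ _] := Hlo j; have [h2 _] := Hnn j.
  have sj := start_ge len_gt j.
  split; [move: h2 rj|move: h|move: h rj|move: sj pE rj|]; try (clear; lia).
  by rewrite pE; exact: W.
pose j := maxn r.+1 P.
exists (start len j), (nn j), (lo j).
have [h Gj _] := Hlo j; have [h2 _] := Hnn j; have sj := start_ge len_gt j.
have rj : (r < j)%N by rewrite /j; clear; lia.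
have Pj : (P <= j)%N by rewrite /j; clear; lia.
split; split=> //; try by move: h h2 sj rj Pj; clear; lia.
by have := W j 0%N r rj (leq_ltn_trans (leq0n j) (len_gt j)); rewrite !addn0.
Qed.

End Gluing.

(** * The approximation constant as a lower limit along the coding *)

Section Spectrum.
Variables (R : realType) (alpha0 : R).
Hypothesis halpha0 : quadratic_irrational alpha0.
Local Notation E := (quad_orbit alpha0).
Local Notation sg := (@galois_conj R).
Local Notation seen := (seen alpha0).
Implicit Types (x y b e l K : R) (m : int) (s : nat -> bool) (k r : nat).

Definition ratio x b : R := `|x - b| / `|b - sg b|.

(** A point of the orbit of width at least [e0] is alone in a small cell; since
    it differs from [x], deeper cells avoid it. *)
Lemma deep_cell_small_width m s x e0 : coded m s x -> ~ E x -> 0 < e0 ->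
  exists k0, forall k, (k0 <= k)%N -> forall b, E b -> in_cell m s k b -> `|b - sg b| < e0.
Proof.
move=> cx nEx e00; have [kap kap0 rep] := quad_orbit_repulsion halpha0.
have ke : 0 < kap * e0 / 2 by rewrite divr_gt0 // mulr_gt0.
have [k1 Hk1] := cell_shrinks cx ke.
have [[b0 [Eb0 in0 big0]]|none] := pselect (exists b, [/\ E b, in_cell m s k1 b & e0 <= `|b - sg b|]).
  have xb0 : 0 < `|b0 - x|.
    by rewrite normr_gt0 subr_eq0; apply/eqP => bx; apply: nEx; rewrite -bx.
  have [k2 Hk2] := cell_shrinks cx xb0.
  exists (maxn k1 k2) => k; rewrite geq_max => /andP[kk1 kk2] b Eb inb.
  rewrite ltNge; apply/negP => big.
  have bb0 : b != b0.
    by apply/eqP => bE; have := Hk2 k kk2 b inb; rewrite bE ltxx.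
  have := rep b b0 e0 Eb Eb0 bb0 e00 big big0.
  have := Hk1 k1 (leqnn _) _ in0; have := Hk1 k kk1 _ inb.
  by have := ler_distD x b b0; rewrite (distrC x b0); lra.
exists k1 => k kk1 b Eb inb; rewrite ltNge; apply/negP => big; apply: none.
by exists b; split=> //; apply: in_cell_nested kk1 inb.
Qed.

Lemma seen_small_width m s x e0 : coded m s x -> ~ E x -> 0 < e0 ->
  exists k0, forall k, (k0 <= k)%N -> forall K e, seen K e ->
    `|code_map m s k e - sg (code_map m s k e)| < e0.
Proof.
move=> cx nEx e00; have [k0 Hk0] := deep_cell_small_width cx nEx e00.
exists k0 => k kk0 K e [Ee pos _].
have Ee' := quad_orbit_conj halpha0 Ee.
have [Em sm] := orbit_code_map halpha0 m s k Ee.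
case: pos => [e1|e1].
  by apply: Hk0 kk0 _ Em (in_cell_code_map _ _ _ (quad_orbit_irr halpha0 Ee) e1).
have [Em' sm'] := orbit_code_map halpha0 m s k Ee'.
have := Hk0 k kk0 _ Em' (in_cell_code_map _ _ _ (quad_orbit_irr halpha0 Ee') e1).
by rewrite -sm (galois_conjK halpha0 Em) distrC.
Qed.

Definition code_liminf K m s x l : Prop :=
  (forall d, 0 < d -> exists k0, forall k, (k0 <= k)%N -> forall e, seen K e ->
     l - d <= hval m s x k e (sg e)) /\
  (forall d k0, 0 < d -> exists k e, [/\ (k0 <= k)%N, seen K e &
     hval m s x k e (sg e) <= l + d]).

(** Points of the orbit of small width correspond to late positions of the
    coding, unless their normalised distance to [x] exceeds [C0]. *)
Lemma approx_constant_code (C0 : R) : 1 <= C0 -> exists2 K0, 1 <= K0 &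
  forall K, K0 <= K -> forall m s x l, coded m s x -> ~ E x -> l < C0 ->
    approx_constant alpha0 x = (2 * l)%:E <-> code_liminf K m s x l.
Proof.
move=> C1; have [K0 K01 HK] := approximation_seen halpha0 C1.
exists K0 => // K KK m s x l cx nEx lC.
have K0pos : 0 < K0 by lra.
have far_or_seen k0 : exists2 e0, 0 < e0 & forall b, E b -> `|b - sg b| < e0 ->
    C0 < ratio x b \/ exists k e, [/\ (k0 <= k)%N, seen K e & ratio x b = hval m s x k e (sg e)].
  have [e0 e00 He0] := HK m s x cx k0; exists e0 => // b Eb bs.
  have w0 := quad_orbit_width_gt0 halpha0 Eb.
  have [h|h] := ltP C0 (ratio x b); [by left|right].
  have [|k [e [kk [Ee pos be] bE]]] := He0 b Eb bs.
    by move: h; rewrite /ratio ler_pdivrMr.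
  exists k, e; split=> //; first by split=> //; apply: bounded_pair_le be.
  by rewrite -(hval_ratio halpha0 k cx Ee) -bE.
rewrite /approx_constant; split=> [/liminf_orbit_eqP[H1 H2]|[Q1 Q2]].
  split=> [d d0|d k0 d0].
    have [e0 e00 He0] := H1 (2 * d) ltac:(lra).
    have [k0 Hk0] := seen_small_width cx nEx e00.
    exists k0 => k kk e se; have [Ee _ _] := se.
    have [Em sm] := orbit_code_map halpha0 m s k Ee.
    have := He0 _ Em (Hk0 k kk K e se).
    by rewrite (hval_ratio halpha0 k cx Ee); lra.
  pose d' := Num.min d (C0 - l).
  have d'0 : 0 < d' by rewrite lt_min d0 subr_gt0.
  have d'd : d' <= d by rewrite ge_min lexx.
  have d'C : d' <= C0 - l by rewrite ge_min lexx orbT.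
  have [e0 e00 He0] := far_or_seen k0.
  have [b [Eb bs rb]] := H2 (2 * d') e0 ltac:(lra) e00.
  have [far|[k [e [kk se rE]]]] := He0 b Eb bs; first by rewrite /ratio in far; lra.
  by exists k, e; split=> //; rewrite -rE /ratio; lra.
apply/liminf_orbit_eqP; split=> [d d0|d e0 d0 e00].
  have [k0 Hk0] := Q1 (d / 2) ltac:(lra).
  have [e0 e00 He0] := far_or_seen k0.
  exists e0 => // b Eb bs; have [far|[k [e [kk se rE]]]] := He0 b Eb bs.
    by rewrite /ratio in far; lra.
  by have := Hk0 k kk e se; rewrite -rE /ratio; lra.
have [k0 Hk0] := seen_small_width cx nEx e00.
have [k [e [kk se he]]] := Q2 (d / 2) k0 ltac:(lra).
have [Ee _ _] := se; have [Em sm] := orbit_code_map halpha0 m s k Ee.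
exists (code_map m s k e); split=> //; first exact: Hk0 kk _ _ se.
by rewrite (hval_ratio halpha0 k cx Ee); lra.
Qed.

(** Once the conjugate of [x] has left the cell, the translates of [x] and of its
    conjugate have opposite signs, so that [x] is seen at distance 0. This keeps
    the number constructed for a positive limit value out of the orbit. *)
Lemma code_liminf_orbit : exists2 K0, 1 <= K0 & forall K m s x l, K0 <= K ->
  coded m s x -> E x -> code_liminf K m s x l -> l <= 0.
Proof.
have [K0 K01 HK] := seen_opposite halpha0.
exists K0 => // K m s x l KK cx Ex [Q1 _].
rewrite leNgt; apply/negP => l0.
have [k0 Hk0] := Q1 (l / 2) ltac:(lra).
have Ex' := quad_orbit_conj halpha0 Ex.
have w0 : 0 < `|sg x - x| by rewrite distrC; exact: (quad_orbit_width_gt0 halpha0 Ex).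
have [k1 Hk1] := cell_shrinks cx w0.
have [i _ si] := coded_infinitely_false 0 cx.
pose k := maxn k0 (maxn k1 i.+1).
have kk0 : (k0 <= k)%N by rewrite leq_maxl.
have kk1 : (k1 <= k)%N by rewrite /k; clear; lia.
have [u w] := cx k.
have [Ei sE iE] := orbit_code_inv halpha0 m s k Ex.
have hv : hval m s x k (code_inv m s k x) (sg (code_inv m s k x)) = 0.
  by rewrite -(hval_ratio halpha0 k cx Ei) iE subrr normr0 mul0r.
suff se : seen K (code_inv m s k x).
  by have := Hk0 k kk0 _ se; rewrite hv; lra.
apply: HK => //; rewrite sE /code_inv pmulr_rlt0 ?divr_gt0 //.
have nin : ~ in_cell m s k (sg x) by move=> /(Hk1 k kk1); rewrite ltxx.
have Ei' := quad_orbit_conj halpha0 Ei.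
have ei' := quad_orbit_irr halpha0 Ei'; rewrite sE /code_inv in ei'.
have n0 : cnum m s (sg x) k != 0.
  by apply/eqP => h; apply: ei'; rewrite h mul0r; exact: (@rational_int R 0).
have d0 : cden m s (sg x) k != 0.
  by apply/eqP => h; apply: ei'; rewrite h invr0 mulr0; exact: (@rational_int R 0).
have unit := cnum_cden_unit m s (sg x) k.
have [c0 d1] := bot_ge s k.
have cR : 0 <= (botl s k)%:~R :> R by rewrite ler0z.
have dR : 0 <= (botr s k)%:~R :> R by rewrite ler0z; exact: (le_trans ler01 d1).
have [np|nn] := ltP 0 (cnum m s (sg x) k).
  rewrite pmulr_rlt0 // invr_lt0 ltNge le_eqVlt eq_sym (negPf d0) /=.
  by apply/negP => h; apply: nin.
rewrite nmulr_rlt0 ?invr_gt0; last by rewrite lt_neqAle n0.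
rewrite ltNge; apply/negP => h.
have : (botl s k)%:~R * cnum m s (sg x) k <= 0 by rewrite mulr_ge0_le0.
have : (botr s k)%:~R * cden m s (sg x) k <= 0 by rewrite mulr_ge0_le0.
by lra.
Qed.

Lemma hval_ge0 m s x k e e' : 0 <= hval m s x k e e'.
Proof. by rewrite /hval !mulr_ge0 ?invr_ge0. Qed.

Lemma window_transfer K (C0 eps : R) : 1 <= K -> 1 <= C0 -> 0 < eps ->
  exists R0, forall r, (R0 <= r)%N -> forall m1 s1 x1 m2 s2 x2 p q e,
    coded m1 s1 x1 -> coded m2 s2 x2 -> (r <= p)%N -> (r <= q)%N ->
    agree s1 s2 p q r -> seen K e -> hval m1 s1 x1 p e (sg e) <= C0 ->
    hval m2 s2 x2 q e (sg e) <= hval m1 s1 x1 p e (sg e) + eps.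
Proof.
move=> K1 C1 eps0; have [rho rho0 H] := gauge_continuous K1 C1 eps0.
have [R0 HR0] : exists R0 : nat, rho^-1 < R0%:R.
  by exists (Num.truncn rho^-1).+1; exact: truncnS_gt.
exists R0 => r rR m1 s1 x1 m2 s2 x2 p q e c1 c2 rp rq ag [Ee _ be] hC.
have rinv : r.+1%:R^-1 <= rho.
  rewrite -[rho]invrK lef_pV2 ?posrE ?invr_gt0 ?ltr0n //.
  by apply: (le_trans (ltW HR0)); rewrite ler_nat; exact: leqW.
have ee := quad_orbit_neq halpha0 Ee.
have [cr1 g1] := hval_gauge p c1 ee; have [cr2 g2] := hval_gauge q c2 ee.
have f : `|future m1 s1 x1 p - future m2 s2 x2 q| <= rho.
  apply: le_trans rinv; apply: future_close => // i ir.
  have := ag (r + i)%N; rewrite ltn_add2l ir !addnA !subnK // => ->//.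
have g : `|past R s1 p - past R s2 q| <= rho.
  apply: le_trans rinv; rewrite -(subnK rp) -(subnK rq); apply: past_close => i ir.
  by apply: ag; exact: (leq_trans ir (leq_addr _ _)).
have := H e (sg e) _ _ _ _ _ be (future_in p c1) (past_in R s1 p) (future_in q c2)
  (past_in R s2 q) f g _ g1.
rewrite hval_ge0 hC => /(_ isT); rewrite g2 ler_pM2r //.
by rewrite mulr_gt0 // normr_gt0 subr_eq0.
Qed.

Lemma crossing_le_compl (p q : R) : 0 <= p <= 1 -> 0 <= q <= 1 ->
  crossing p q <= (1 - p) + (1 - q).
Proof. by rewrite /crossing => /andP[? ?] /andP[? ?]; nra. Qed.

Lemma crossing_le_add (p q : R) : 0 <= p <= 1 -> 0 <= q <= 1 -> crossing p q <= p + q.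
Proof. by rewrite /crossing => /andP[? ?] /andP[? ?]; nra. Qed.

Lemma frac_compl1 (u w : R) : 0 < u + w -> 1 - w / (u + w) = u / (u + w).
Proof. by move=> h; field; rewrite gt_eqF. Qed.

Lemma frac_compl2 (u w : R) : 0 < u + w -> 1 - u / (u + w) = w / (u + w).
Proof. by move=> h; field; rewrite gt_eqF. Qed.

(** A long constant window is an excursion into a cusp, where nothing is seen
    at bounded height. *)
Lemma constant_window_crossing m s x p r (b : bool) : coded m s x -> (r <= p)%N ->
  (forall i, (i < r + r)%N -> s (p - r + i)%N = b) ->
  crossing (future m s x p) (past R s p) <= 2 / r.+1%:R.
Proof.
move=> cx rp win.
have win1 i : (i < r)%N -> s (p + i)%N = b.
  by move=> ir; rewrite -(subnK rp) -addnA win // ltn_add2l.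
have win2 i : (i < r)%N -> s (p - r + i)%N = b.
  by move=> ir; apply: win; exact: (leq_trans ir (leq_addr _ _)).
have p01 := future_in p cx; have q01 := past_in R s p.
have r0 : 0 < r.+1%:R :> R by rewrite ltr0n.
have [u w] := cx p; have [u' w'] := cx (p + r)%N.
have T0 := botsum_gt0 R s p.
have [c0 d0] := bot_ge s (p - r).
have c0R : 0 <= (botl s (p - r))%:~R :> R by rewrite ler0z.
have d0R : 1 <= (botr s (p - r))%:~R :> R by rewrite ler1z.
case: b win1 win2 {win} => win1 win2.
- have E1 i : (i <= r)%N -> cden m s x (p + i) = cden m s x p /\
     cnum m s x (p + i) = cnum m s x p - i%:R * cden m s x p.
    elim: i => [|i IH] ir; first by rewrite addn0 mul0r subr0.
    have [IH1 IH2] := IH (ltnW ir).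
    by rewrite addnS cnumS cdenS win1 // IH1 IH2 -natr1; split=> //; ring.
  have E2 i : (i <= r)%N -> (botl s (p - r + i))%:~R = (botl s (p - r))%:~R :> R /\
     (botr s (p - r + i))%:~R = (botr s (p - r))%:~R + i%:R * (botl s (p - r))%:~R :> R.
    elim: i => [|i IH] ir; first by rewrite addn0 mul0r addr0.
    have [IH1 IH2] := IH (ltnW ir).
    by rewrite addnS botlS botrS win2 // rmorphD /= IH1 IH2 -natr1; split=> //; ring.
  have [e1 e2] := E1 r (leqnn r); have [] := E2 r (leqnn r); rewrite subnK // => e3 e4.
  rewrite e2 in u'.
  have a1 : 1 - future m s x p <= 1 / r.+1%:R.
    rewrite /future.
    rewrite (frac_compl2 (addr_gt0 u w)).
    rewrite ler_pdivrMr; last by lra.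
    rewrite mulrAC ler_pdivlMr // -natr1; lra.
  have a2 : 1 - past R s p <= 1 / r.+1%:R.
    rewrite /past.
    rewrite (frac_compl1 T0).
    rewrite ler_pdivrMr // mulrAC ler_pdivlMr // -natr1 e3 e4; lra.
  by apply: (le_trans (crossing_le_compl _ _)) => //; rewrite mulrDl lerD.
- have E1 i : (i <= r)%N -> cnum m s x (p + i) = cnum m s x p /\
     cden m s x (p + i) = cden m s x p - i%:R * cnum m s x p.
    elim: i => [|i IH] ir; first by rewrite addn0 mul0r subr0.
    have [IH1 IH2] := IH (ltnW ir).
    by rewrite addnS cnumS cdenS win1 // IH1 IH2 -natr1; split=> //; ring.
  have E2 i : (i <= r)%N -> (botr s (p - r + i))%:~R = (botr s (p - r))%:~R :> R /\
     (botl s (p - r + i))%:~R = (botl s (p - r))%:~R + i%:R * (botr s (p - r))%:~R :> R.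
    elim: i => [|i IH] ir; first by rewrite addn0 mul0r addr0.
    have [IH1 IH2] := IH (ltnW ir).
    by rewrite addnS botlS botrS win2 // rmorphD /= IH1 IH2 -natr1; split=> //; ring.
  have [e1 e2] := E1 r (leqnn r); have [] := E2 r (leqnn r); rewrite subnK // => e3 e4.
  rewrite e2 in w'.
  have a1 : future m s x p <= 1 / r.+1%:R.
    rewrite /future.
    rewrite ler_pdivrMr; last by lra.
    rewrite mulrAC ler_pdivlMr // -natr1; lra.
  have a2 : past R s p <= 1 / r.+1%:R.
    rewrite /past.
    rewrite ler_pdivrMr // mulrAC ler_pdivlMr // -natr1 e3 e4; lra.
  by apply: (le_trans (crossing_le_add _ _)) => //; rewrite mulrDl lerD.
Qed.

End Spectrum.

(** * Closedness of the spectrum *)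

Section SpectrumClosed.
Variables (R : realType) (alpha0 : R).
Hypothesis halpha0 : quadratic_irrational alpha0.
Local Notation E := (quad_orbit alpha0).
Local Notation sg := (@galois_conj R).
Local Notation mu := (@lebesgue_measure R).

Lemma spectrum_bound : exists2 C : R, 0 < C & forall c, approx_spectrum alpha0 c ->
  exists2 r, c = r%:E & 0 <= r <= C.
Proof.
have [C C0 HC] := orbit_dirichlet halpha0.
exists (2 * C); first by lra.
move=> _ [x /= nx <-].
have xirr : ~ rational x by move=> h; apply: nx; left.
have lo : (0%:E <= approx_constant alpha0 x)%E.
  apply: (liminf_orbit_ge ltr01) => a Ea _.
  by rewrite mulr_ge0 // divr_ge0.
have hi : (approx_constant alpha0 x <= (2 * C)%:E)%E.
  apply: liminf_orbit_le => e e0; have [a [Ea ae xa]] := HC x xirr e e0.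
  exists a; split=> //; rewrite ler_pM2l // ler_pdivrMr //.
  exact: (quad_orbit_width_gt0 halpha0 Ea).
case: (approx_constant alpha0 x) lo hi => [r| |] //=.
by rewrite !lee_fin => lo hi; exists r => //; rewrite lo.
Qed.

(** The orbit and the rationals are countable. *)
Lemma exists_generic (A : set R) : {ae mu, forall x, A x} ->
  exists2 x, A x & ~ (rational `|` E) x.
Proof.
move=> aeA; apply: contrapT => none.
have cnt (B : set R) : countable B -> mu.-negligible B.
  by move=> cB; apply/negligible_outer_measure; exact: countable_lebesgue_measure0.
have nE : mu.-negligible ((rational : set R) `|` E).
  apply: negligibleU; apply: cnt; last exact: countable_quad_orbit.
  exact: (card_le_trans (card_image_le (@ratr R) setT) (countableP _)).
have n01 : mu.-negligible (`]0%R, 1%R[%classic : set R).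
  apply: negligibleS (negligibleU aeA nE) => x _ /=.
  have [Ax|nAx] := pselect (A x); last by left.
  by right; apply: contrapT => h; apply: none; exists x.
move: n01 => /negligibleP -/(_ (measurable_itv _)).
rewrite /= lebesgue_measure_oo ?ler01 // subr0 => /eqP.
by rewrite eqe oner_eq0.
Qed.

(** The divergent case for the identity map. *)
Lemma zero_in_spectrum : approx_spectrum alpha0 0%E.
Proof.
pose psi := @id R.
have psi0 (t : R) : 0 < t -> 0 < psi t by [].
have psi_lip : lipschitz (fun t : R => ln (psi (expR (- t)))).
  apply: (@klipschitzW _ _ _ 1); first exact: (@globally_properfilter _ _ (0, 0)).
  move=> -[x y] _; rewrite /self_sub /= mul1r !expRK.
  have -> : - x - - y = - (x - y) by ring.
  by rewrite normrN.
have div (K : R) (T : nat) : 1 <= K -> (1 < T)%N -> forall M, exists n,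
     M <= \sum_(i < n) psi (scale K T i) / scale K T i.
  move=> K1 T1 M; exists (Num.truncn M).+1.
  rewrite (eq_bigr (fun _ => 1)); last first.
    by move=> i _; rewrite divff // gt_eqF // scale_gt0.
  rewrite sumr_const card_ord; exact: (ltW (truncnS_gt _)).
have [x lx nx] := exists_generic (orbit_khintchine_divergence halpha0 psi0 psi_lip div).
exists x => //; move: lx => /liminf_orbit_eqP[H1 H2].
apply/liminf_orbit_eqP; split=> [d d0|d e d0 e0].
  have [e e0 He] := H1 (d / 2) ltac:(lra); exists e => // a Ea ae.
  by have := He a Ea ae; rewrite /psi; lra.
have [a [Ea ae xa]] := H2 (d / 2) e ltac:(lra) e0; exists a; split=> //.
by move: xa; rewrite /psi; lra.
Qed.

(** The words coding numbers with constants close to the limit are glued into one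
    word. It contains both letters infinitely often, since a long constant window
    would be a cusp excursion, and the number it codes has the limit as constant. *)
Lemma spectrum_closed : closed [set r : R | approx_spectrum alpha0 r%:E].
Proof.
move=> r0 cl.
have [C Cpos HC] := spectrum_bound.
have /choice[xr Hxr] : forall n : nat, exists xr : R * R, [/\ ~ (rational `|` E) xr.1,
   approx_constant alpha0 xr.1 = xr.2%:E & `|r0 - xr.2| < n.+1%:R^-1].
  move=> n; have n0 : 0 < n.+1%:R^-1 :> R by rewrite invr_gt0.
  have [r [[x nx xr] rr]] := cl _ (nbhsx_ballx r0 _ n0).
  by exists (x, r).
pose X n := (xr n).1; pose l n := (xr n).2 / 2; pose l0 := r0 / 2.
have lr n : 0 <= l n <= C.
  have [nx ax _] := Hxr n; have [|r [<-] /andP[h1 h2]] := HC (xr n).2%:E; first by exists (X n).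
  by rewrite /l; apply/andP; split; lra.
have ln n : `|l0 - l n| <= n.+1%:R^-1.
  have [_ _ h] := Hxr n; rewrite /l0 /l -mulrBl normrM (@ger0_norm _ 2^-1) ?invr_ge0 //.
  by apply: le_trans (ltW h); rewrite ler_piMr // invf_le1 // ler1n.
have inv_small d : 0 < d -> exists N, forall n, (N <= n)%N -> n.+1%:R^-1 <= d :> R.
  move=> d0; have [N HN] : exists N : nat, d^-1 < N%:R.
    by exists (Num.truncn d^-1).+1; exact: truncnS_gt.
  exists N => n Nn; rewrite -[d]invrK lef_pV2 ?posrE ?invr_gt0 ?ltr0n //.
  by apply: (le_trans (ltW HN)); rewrite ler_nat; exact: leqW.
have [l0neg|l0pos] := leP l0 0.
  suff -> : r0 = 0 by exact: zero_in_spectrum.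
  have : 0 <= l0.
    rewrite leNgt; apply/negP => neg.
    have [N HN] := inv_small (- l0 / 2) ltac:(lra).
    have /andP[h _] := lr N; have := le_trans (ln N) (HN N (leqnn N)).
    by rewrite ler_norml => /andP[h2 h3]; lra.
  by rewrite /l0 in l0neg * => ?; lra.
have l0C : l0 <= C.
  rewrite leNgt; apply/negP => big.
  have [N HN] := inv_small ((l0 - C) / 2) ltac:(lra).
  have /andP[_ h] := lr N; have := le_trans (ln N) (HN N (leqnn N)).
  by rewrite ler_norml => /andP[h2 h3]; lra.
pose C0 := C + 1.
have C01 : 1 <= C0 by rewrite /C0; lra.
have [K1 K11 HK1] := approx_constant_code halpha0 C01.
have [K2 K21 HK2] := code_liminf_orbit halpha0.
pose K := Num.max K1 K2.
have KK1 : K1 <= K by rewrite le_max lexx.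
have KK2 : K2 <= K by rewrite le_max lexx orbT.
have Kge1 : 1 <= K by lra.
have /choice[ms Hms] : forall n, exists ms : int * (nat -> bool), coded ms.1 ms.2 (X n).
  move=> n; have [nx _ _] := Hxr n.
  have [m [s cs]] : exists m s, coded m s (X n) by apply: code_exists => h; apply: nx; left.
  by exists (m, s).
pose m n := (ms n).1; pose s_ n := (ms n).2.
have cX n : coded (m n) (s_ n) (X n) by exact: Hms.
have QX n : code_liminf alpha0 K (m n) (s_ n) (X n) (l n).
  have [nx ax _] := Hxr n; apply/(HK1 K KK1) => //.
  - by move=> h; apply: nx; right.
  - by have /andP[_ h] := lr n; rewrite /C0; lra.
  - by rewrite ax /l; congr (_%:E); field.
pose H n k e := hval (m n) (s_ n) (X n) k e (sg e).
pose G n k := exists2 e, seen alpha0 K e & H n k e <= l n + n.+1%:R^-1.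
have np (n : nat) : 0 < n.+1%:R^-1 :> R by rewrite invr_gt0.
have infG n N : exists2 k, (N <= k)%N & G n k.
  have [_ Q2] := QX n; have [k [e [Nk se he]]] := Q2 _ N (np n).
  by exists k => //; exists e.
have /choice[Kn HKn] : forall n, exists k0, forall k, (k0 <= k)%N -> forall e,
    seen alpha0 K e -> l n - n.+1%:R^-1 <= H n k e.
  by move=> n; have [Q1 _] := QX n; exact: Q1 (np n).
have [s [win1 win2]] := gluing s_ Kn infG.
have mixed (b : bool) j : exists2 i, (j <= i)%N & s i = b.
  apply: contrapT => none.
  have sc i : (j <= i)%N -> s i = ~~ b.
    move=> ji; have [sb|sb] := eqVneq (s i) b; first by exfalso; apply: none; exists i.
    by move: sb; case: (s i) (b) => -[].
  pose m0 : R := (8 * K ^+ 3 * (C0 + 1))^-1.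
  have m00 : 0 < m0.
    have Kp : 0 < K by lra.
    have K3 : 0 < K ^+ 3 by exact: exprn_gt0.
    by rewrite invr_gt0; apply: mulr_gt0; [rewrite mulr_gt0|rewrite /C0; lra].
  have m04 : 0 < m0 / 4 by rewrite divr_gt0.
  have [N HN] := inv_small _ m04.
  have [p [n [q [[Pp rn [e se he]] [rq rp ag]]]]] := win2 N (j + N)%N.
  have cw : crossing (future (m n) (s_ n) (X n) q) (past R (s_ n) q) <= 2 / N.+1%:R.
    apply: (constant_window_crossing (cX n) rq) => i iN; rewrite -ag //; apply: sc.
    by move: Pp; clear; lia.
  have [Ee _ be] := se.
  have [cr g] := hval_gauge q (cX n) (quad_orbit_neq halpha0 Ee).
  have n1 : n.+1%:R^-1 <= 1 :> R by rewrite invf_le1 // ler1n.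
  have /andP[_ lC] := lr n.
  have C11 : 1 <= C0 + 1 by lra.
  have := crossing_lower Kge1 C11 be (future_in q (cX n)) (past_in R (s_ n) q).
  rewrite -/m0 g ler_pM2r; last first.
    by rewrite mulr_gt0 // normr_gt0 subr_eq0; exact: (quad_orbit_neq halpha0 Ee).
  have -> : hval (m n) (s_ n) (X n) q e (sg e) <= C0 + 1.
    by move: he n1; rewrite /H /C0; move: n.+1%:R^-1 => dn; lra.
  move=> /(_ isT) low; have := HN N (leqnn N).
  have cw2 : 2 / N.+1%:R = 2 * (N.+1%:R^-1) :> R by [].
  move: cw low; rewrite cw2; move: N.+1%:R^-1 => dn.
  by move: m00; clearbody m0; lra.
have [x cx] := @code_real R 0 s (mixed false) (mixed true).
have Q1 d : 0 < d -> exists k0, forall k, (k0 <= k)%N -> forall e, seen alpha0 K e ->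
    l0 - d <= hval 0 s x k e (sg e).
  move=> d0; have d4 : 0 < d / 4 by lra.
  have [R0 HR0] := @window_transfer R alpha0 halpha0 K C0 (d / 4) Kge1 C01 d4.
  have [N HN] := inv_small _ d4.
  have [P HP] := win1 (maxn R0 N).
  exists P => k Pk e se.
  have [n [q [rn Kq rq rk ag]]] := HP k Pk.
  have nd := HN n (leq_trans (leq_maxr _ _) rn).
  have low := HKn n q Kq e se.
  rewrite leNgt; apply/negP => small.
  have := HR0 _ (leq_maxl R0 N) _ _ _ _ _ _ k q e cx (cX n) rk rq ag se.
  have -> : hval 0 s x k e (sg e) <= C0 by rewrite /C0; lra.
  move=> /(_ isT) up.
  move: (ln n) nd low; rewrite /H; move: n.+1%:R^-1 => dn.
  by rewrite ler_norml => /andP[h1 h2] *; lra.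
have Q2 d k0 : 0 < d -> exists k e, [/\ (k0 <= k)%N, seen alpha0 K e &
    hval 0 s x k e (sg e) <= l0 + d].
  move=> d0; have d4 : 0 < d / 4 by lra.
  have [R0 HR0] := @window_transfer R alpha0 halpha0 K (C0 + 1) (d / 4) Kge1 ltac:(lra) d4.
  have [N HN] := inv_small _ d4.
  have [p [n [q [[Pp rn [e se he]] [rq rp ag]]]]] := win2 (maxn R0 N) k0.
  have nd := HN n (leq_trans (leq_maxr _ _) rn).
  have ag' : agree (s_ n) s q p (maxn R0 N) by move=> i ir; rewrite ag.
  have n1 : n.+1%:R^-1 <= 1 :> R by rewrite invf_le1 // ler1n.
  have /andP[_ lC] := lr n.
  exists p, e; split=> //.
  have := HR0 _ (leq_maxl R0 N) _ _ _ _ _ _ q p e (cX n) cx rq rp ag' se.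
  have -> : hval (m n) (s_ n) (X n) q e (sg e) <= C0 + 1.
    by move: he n1; rewrite /H /C0; move: n.+1%:R^-1 => dn; lra.
  move=> /(_ isT) up.
  move: (ln n) nd he; rewrite /H; move: n.+1%:R^-1 => dn.
  by rewrite ler_norml => /andP[h1 h2] *; lra.
have cl0 : code_liminf alpha0 K 0 s x l0 by split.
have nEx : ~ E x.
  by move=> Ex; have := HK2 K 0 s x l0 KK2 cx Ex cl0; lra.
exists x; first by move=> [h|//]; exact: (coded_irrational cx h).
have -> : r0 = 2 * l0 by rewrite /l0; field.
by apply/(HK1 K KK1 0 s x l0 cx nEx) => //; rewrite /C0; lra.
Qed.

End SpectrumClosed.

(** * The theorem *)

Unset Implicit Arguments.

Theorem theorem1p3 (R : realType) (alpha0 : R)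
    (halpha0 : quadratic_irrational alpha0) :
  [/\ approx_spectrum alpha0 `<=` EFin @` [set r : R | 0 <= r],
      closed [set r : R | approx_spectrum alpha0 r%:E]
    & bounded_set [set r : R | approx_spectrum alpha0 r%:E]]
  /\
  (forall psi : R -> R,
     (forall t, 0 < t -> 0 < psi t) ->
     lipschitz (fun t : R => ln (psi (expR (- t)))) ->
     ((\int[lebesgue_measure]_(t in `]0%R, 1%R[) (psi t / t ^+ 2)%:E = +oo)%E ->
      {ae lebesgue_measure, forall x : R,
        liminf_orbit alpha0
          (fun alpha => `|x - alpha| / psi `|alpha - galois_conj alpha|)
        = 0%E})
     /\
     ((\int[lebesgue_measure]_(t in `]0%R, 1%R[) (psi t / t ^+ 2)%:E < +oo)%E ->
      {ae lebesgue_measure, forall x : R,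
        liminf_orbit alpha0
          (fun alpha => `|x - alpha| / psi `|alpha - galois_conj alpha|)
        = +oo%E})).
Proof.
split.
  have [C C0 HC] := spectrum_bound halpha0; split.
  - by move=> c /HC[r -> /andP[r0 _]]; exists r.
  - exact: spectrum_closed.
  - exists C; split; first exact: num_real.
    move=> M CM r /HC[r' [<-] /andP[r0 rC]].
    by rewrite /= ger0_norm //; apply: ltW; exact: (le_lt_trans rC CM).
move=> psi psi0 psi_lip; split=> int.
  apply: orbit_khintchine_divergence => // K T K1 T1.
  exact: integral_divergent_series.
have T1 : (1 < 2)%N by [].
have [M HM] := integral_convergent_series psi0 psi_lip (lexx 1) T1 int.
exact: (orbit_khintchine_convergence halpha0 psi0 psi_lip (lexx 1) T1 HM).
Qed.
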